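(* Let $C:f=0$ be a reduced plane curve of degree $d$ in $\mathbb{P}^2$ over $\mathbb{C}$ and set $r=\mathrm{mdr}(f)$, with $r\ge 1$. Then, for any choice of a nonzero syzygy $\rho_1\in AR(f)_r$, there is an exact sequence of graded $S$-modules $$0\to S(-r)\xrightarrow{\ u\ }AR(f)\xrightarrow{\ v\ }B(C,\rho_1)(r-d+1)\to 0,$$ and the following hold. (1) The ideal $B(C,\rho_1)$ is saturated, defines a subscheme $Z(C,\rho_1)=V(B(C,\rho_1))$ of $\mathbb{P}^2$ of dimension at most $0$, and its degree is given by $$\deg B(C,\rho_1)=(d-1)^2-r(d-r-1)-\tau(C)=\tau_{max}(d,r)-\tau(C).$$ (2) The ideal $B(C,\rho_1)$ and the codimension 2 subscheme $Z(C,\rho_1)$ are locally complete intersections. (3) The ideal $B(C,\rho_1)$ and the subscheme $Z(C,\rho_1)$ do not depend on the choice of $\rho_1$ when $\dim AR(f)_r=1$. (4) The curve $C$ is free if and only if $B(C,\rho_1)=S$. (5) The curve $C$ is nearly free if and only if the subscheme $Z(C,\rho_1)$ is a reduced point $P(C,\rho_1)$ in $\mathbb{P}^2$. The exact sequence and the point $P(C,\rho_1)$ are independent of $\rho_1$ when $2r<d$, i.e. when the exponents of the nearly free curve $C$ satisfy $r=d_1<d_2=d-r$.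
   Context: $S=\mathbb{C}[x,y,z]$ with the usual grading; for a graded module $M$, $M(m)_k=M_{m+k}$; $f\in S_d$ is the reduced homogeneous equation of $C$; $f_x,f_y,f_z$ are its partial derivatives. $AR(f)\subset S^3$ is the graded $S$-module with $AR(f)_k=\{(a,b,c)\in S_k^3: af_x+bf_y+cf_z=0\}$ and $\mathrm{mdr}(f)=\min\{k: AR(f)_k\neq 0\}$. Given a nonzero $\rho_1=(a_1,b_1,c_1)\in AR(f)_r$, the morphism $u:S(-r)\to AR(f)$ is $u(h)=h\cdot\rho_1$. For $\rho=(a,b,c)\in AR(f)_m$, let $\Delta(\rho)$ be the determinant of the $3\times3$ matrix with rows $(x,y,z)$, $(a_1,b_1,c_1)$, $(a,b,c)$; it is divisible by $f$, and $v:AR(f)\to S(r-d+1)$ is $v(\rho)=\Delta(\rho)/f$. The homogeneous ideal $B(C,\rho_1)\subset S$ is defined by $\mathrm{im}\,v=B(C,\rho_1)(r-d+1)$. The degree $\deg B(C,\rho_1)$ is the degree (length) of the scheme $Z(C,\rho_1)$ (zero if it is empty). $\tau(C)=\sum_{p\in C}\tau(C,p)$ is the global Tjurina number of $C$, and $\tau_{max}(d,r)=(d-1)^2-r(d-1-r)$. $C$ is free if $AR(f)$ is a free graded $S$-module. $C$ is nearly free with exponents $(d_1,d_2)$ if $AR(f)$ has a minimal generator system of syzygies $\rho_1,\rho_2,\rho_3$ with $\deg\rho_i=d_i$, $d_1\le d_2=d_3$, and a relation $h\rho_1+\ell_2\rho_2+\ell_3\rho_3=0$ with $h\in S$ and $\ell_2,\ell_3\in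 S$ independent linear forms. *)

(* Defs.v *)
From mathcomp Require Import all_boot all_order all_algebra.
From mathcomp Require Import complex boolp classical_sets fsbigop reals.
From mathcomp Require Import mpoly.

Set Implicit Arguments.
Unset Strict Implicit.
Unset Printing Implicit Defensive.

Import Order.TTheory GRing.Theory Num.Theory.
Local Open Scope classical_set_scope.
Local Open Scope ring_scope.

Local Notation "x %:F" := (@tofrac _ x).

(* Modules, ideals and local rings are represented by the set of their
   elements inside an ambient type. *)

Section Dimension.
Variables (K : fieldType) (E : zmodType) (sc : K -> E -> E).

(* dim_K (V / W) = n, where K acts on E through sc; V is a subspace and W a
   subspace of V (W need only meet V in a subspace of V). *)
Definition is_dim (V W : set E) (n : nat) : Prop :=
  exists e : 'I_n -> E, (forall i, V (e i)) /\
    forall x, V x -> exists! c : 'rV[K]_n, W (x - \sum_i sc (c 0 i) (e i)).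

(* 0 if V / W is infinite-dimensional *)
Definition dimq (V W : set E) : nat := xget 0%N [set n | is_dim V W n].

End Dimension.

Section Ideals.
Variable D : idomainType.

Definition is_ideal (I : set D) : Prop :=
  [/\ I 0, forall a b, I a -> I b -> I (a + b) & forall a b, I b -> I (a * b)].

Definition prime_ideal (P : set D) : Prop :=
  [/\ is_ideal P, ~ P 1 & forall a b, P (a * b) -> P a \/ P b].

(* The A-linear combinations of the elements of s, for A a subring of D. *)
Definition gen (A : set D) (s : seq D) : set D :=
  [set x | exists c : nat -> D,
     (forall j, A (c j)) /\ x = \sum_(j < size s) c j * s`_j].

Definition regular_seq (A : set D) (s : seq D) : Prop :=
  [/\ forall i, (i < size s)%N -> A s`_i,
      forall i, (i < size s)%N -> forall a, A a ->
        gen A (take i s) (s`_i * a) -> gen A (take i s) a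
    & ~ gen A s 1].

End Ideals.

Section Localization.
Variable D : idomainType.

Definition loc (P : set D) : set {fraction D} :=
  [set x | exists g h, ~ P h /\ x = g%:F / h%:F].

Definition loc_ideal (P I : set D) : set {fraction D} :=
  [set x | exists g h, [/\ I g, ~ P h & x = g%:F / h%:F]].

(* The localization of I at P is generated by a regular sequence of length c. *)
Definition ci_at (c : nat) (I P : set D) : Prop :=
  exists s : seq {fraction D},
    [/\ size s = c, regular_seq (loc P) s & loc_ideal P I = gen (loc P) s].

End Localization.

Section Plane.
Variable K : fieldType.
Local Notation S := {mpoly K[3]}.
Local Notation A2 := {mpoly K[2]}.

(* Closed points of P^2, each given by its homogeneous coordinates with first
   nonzero coordinate equal to 1. *)
Definition proj_points : set 'rV[K]_3 :=
  [set p | exists i : 'I_3,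
     p 0 i = 1 /\ forall j : 'I_3, (j < i)%N -> p 0 j = 0].

(* The index of a standard chart x_i <> 0 containing p. *)
Definition chart (p : 'rV[K]_3) : 'I_3 := odflt ord0 [pick i | p 0 i != 0].

Definition aff (i : 'I_3) (p : 'rV[K]_3) : 'I_2 -> K :=
  fun j => p 0 (lift i j) / p 0 i.

(* Set x_i := 1 and name the remaining two variables, in order, X_0 and X_1. *)
Definition dehom (i : 'I_3) (g : S) : A2 :=
  g \mPo [tuple (if unlift i j is Some k then 'X_k else 1) | j < 3].

(* A closed subscheme of P^2, given by its ideals in the coordinate rings of
   the three standard affine charts. *)
Definition subscheme := 'I_3 -> set A2.

Definition V_ (I : set S) : subscheme := fun i => dehom i @` I.

Definition max_ideal (q : 'I_2 -> K) : set A2 := [set g | g.@[q] = 0].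

(* The dimension of the quotient of the local ring of A^2 at q by the ideal
   that I generates in it. *)
Definition local_dim (I : set A2) (q : 'I_2 -> K) : nat :=
  dimq (fun (c : K) (x : {fraction A2}) => (c%:MP)%:F * x)
    (loc (max_ideal q)) (loc_ideal (max_ideal q) I).

Definition scheme_degree (Z : subscheme) : nat :=
  \sum_(p \in proj_points) local_dim (Z (chart p)) (aff (chart p) p).

Definition scheme_dim_le (Z : subscheme) (n : nat) : Prop :=
  forall (i : 'I_3) (P : 'I_n.+2 -> set A2),
    (forall k, prime_ideal (P k) /\ Z i `<=` P k) ->
    ~ (forall k l : 'I_n.+2, (k < l)%N -> P k `<` P l).

Definition scheme_lci (c : nat) (Z : subscheme) : Prop :=
  forall (i : 'I_3) (P : set A2),
    prime_ideal P -> Z i `<=` P -> ci_at c (Z i) P.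

Definition reduced_point (p : 'rV[K]_3) : subscheme :=
  V_ [set g : S | forall t : K, g.@[fun j => t * p 0 j] = 0].

(* Homogeneous ideals of S are considered away from the irrelevant ideal. *)
Definition ideal_lci (c : nat) (I : set S) : Prop :=
  forall P : set S, prime_ideal P -> I `<=` P -> (exists i, ~ P 'X_i) ->
    ci_at c I P.

Definition homogeneous_ideal (I : set S) : Prop :=
  is_ideal I /\ forall g d, I g -> I (pihomog mdeg d g).

Definition saturated (I : set S) : Prop :=
  forall g : S,
    (exists n, forall h : S, h \is n.-homog -> I (h * g)) -> I g.

Definition grading (V : Type) := int -> set V.

Definition gshift V (M : grading V) (m : int) : grading V := fun k => M (m + k).

Definition S_ : grading S :=
  fun k => [set p | if k is Posz n then is_true (p \is n.-homog) else p = 0].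

Definition graded_part (I : set S) : grading S := fun k => I `&` S_ k.

Definition graded_morphism (V W : lmodType S) (M : grading V) (N : grading W)
    (u : V -> W) : Prop :=
  [/\ forall k x, M k x -> N k (u x),
      forall k x y, M k x -> M k y -> u (x + y) = u x + u y
    & forall j k h x, S_ j h -> M k x -> u (h *: x) = h *: u x].

Definition graded_short_exact (V1 V2 V3 : lmodType S)
    (M1 : grading V1) (M2 : grading V2) (M3 : grading V3)
    (u : V1 -> V2) (v : V2 -> V3) : Prop :=
  [/\ graded_morphism M1 M2 u, graded_morphism M2 M3 v,
      forall k x, M1 k x -> u x = 0 -> x = 0,
      forall k y, M2 k y -> (v y = 0 <-> exists2 x, M1 k x & u x = y)
    & forall k z, M3 k z -> exists2 y, M2 k y & v y = z].

Section Curve.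
Variable f : S.

(* The ring S / (f) is reduced. *)
Definition reduced_equation : Prop :=
  forall (g : S) (n : nat), (exists h, g ^+ n = h * f) -> exists h, g = h * f.

Definition syz : set 'rV[S]_3 :=
  [set rho | \sum_(i < 3) rho 0 i * f^`M(i) = 0].

Definition AR : grading 'rV[S]_3 :=
  fun k => syz `&` [set rho | forall i, S_ k (rho 0 i)].

Definition is_mdr (r : nat) : Prop :=
  (exists rho, AR r rho /\ rho != 0) /\
  forall k : nat, (k < r)%N -> forall rho, AR k rho -> rho = 0.

Definition generate_syz (n : nat) (e : 'I_n -> 'rV[S]_3) (J : pred 'I_n) : Prop :=
  forall rho, syz rho ->
    exists c : 'I_n -> S, rho = \sum_(i < n | J i) c i *: e i.

Definition free_curve : Prop :=
  exists (n : nat) (e : 'I_n -> 'rV[S]_3) (deg : 'I_n -> nat),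
    [/\ forall i, AR (deg i) (e i), generate_syz e predT
      & forall c : 'I_n -> S, \sum_i c i *: e i = 0 -> forall i, c i = 0].

Definition nearly_free_exp (d1 d2 : nat) : Prop :=
  exists e : 'I_3 -> 'rV[S]_3, exists h l2 l3 : S,
    [/\ [/\ AR d1 (e 0), AR d2 (e 1), AR d2 (e 2%:R) & (d1 <= d2)%N],
        generate_syz e predT, forall i, ~ generate_syz e (predC1 i),
        [/\ l2 \is 1.-homog, l3 \is 1.-homog &
            forall a b : K, a *: l2 + b *: l3 = 0 -> a = 0 /\ b = 0]
      & h *: e 0 + l2 *: e 1 + l3 *: e 2%:R = 0].

Definition nearly_free : Prop := exists d1 d2, nearly_free_exp d1 d2.

(* Local Tjurina number at p, from the local equation of the curve in an
   affine chart containing p. *)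
Definition tjurina_at (p : 'rV[K]_3) : nat :=
  let g := dehom (chart p) f in
  local_dim (gen setT [:: g; g^`M(0); g^`M(1)]) (aff (chart p) p).

Definition tjurina : nat :=
  \sum_(p \in proj_points `&` [set p | f.@[p 0] = 0]) tjurina_at p.

Section Bourbaki.
Variable rho1 : 'rV[S]_3.

Definition Delta (rho : 'rV[S]_3) : S :=
  \det (\matrix_(i < 3) tnth [tuple (\row_(j < 3) 'X_j : 'rV[S]_3); rho1; rho] i).

Definition u_ (h : S^o) : 'rV[S]_3 := h *: rho1.

(* The quotient Delta rho / f (0 if f does not divide Delta rho). *)
Definition v_ (rho : 'rV[S]_3) : S^o := xget 0 [set h : S | Delta rho = h * f].

Definition B_ : set S := v_ @` syz.

End Bourbaki.

(* The exact sequences of rho1 and rho1' have the same third module and become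
   equal after rescaling their two maps by one and the same nonzero constant. *)
Definition same_sequence (rho1 rho1' : 'rV[S]_3) : Prop :=
  B_ rho1' = B_ rho1 /\
  exists c : K, [/\ c != 0,
    forall h, u_ rho1' h = c%:MP *: u_ rho1 h
    & forall rho, syz rho -> v_ rho1' rho = c%:MP * v_ rho1 rho].

End Curve.

Definition tau_max (d r : nat) : int := (d%:Z - 1) ^+ 2 - r%:Z * (d%:Z - 1 - r%:Z).

End Plane.

(* Main.v *)
Require Import Defs.
From mathcomp Require Import all_boot all_order all_algebra.
From mathcomp Require Import complex boolp classical_sets fsbigop reals.
From mathcomp Require Import mpoly ring zify.
From HB Require Import structures.

Set Implicit Arguments.
Unset Strict Implicit.
Unset Printing Implicit Defensive.

Import Order.TTheory GRing.Theory Num.Theory.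
Local Open Scope classical_set_scope.
Local Open Scope ring_scope.

(* The partial derivatives of f have no common factor, so the cross product of two
   syzygies a, b is w (f_x, f_y, f_z) for some w; Euler's formula then gives
   v rho = d w for a = rho1, b = rho, and v rho = 0 only if rho is a multiple of
   rho1, whose entries have no common factor because r is minimal. The Koszul
   syzygies show that these entries lie in B, so B has grade 2 and Z is finite.

   If x_i g = v rho_i for all i, then x_j rho_i - x_i rho_j is a multiple h_ij rho1;
   the Koszul complex of x, y, z gives h_ij = x_j h_i - x_i h_j, and rho_i - h_i rho1
   is x_i times a syzygy mapped to g: B is saturated. Near a point AR(f) is free of
   rank 2, so B is generated there by the images of two elements. The degree of Z is
   the stable value of the Hilbert function of S/B, found from the exact sequence
   and from 0 -> AR(f) -> S^3 -> J_f -> 0, since tau is that of S/J_f.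

   A basis of AR(f) makes B principal, hence equal to S, and the three generators of a
   nearly free curve make B the ideal generated by two independent linear forms;
   lifts of generators of B, together with rho1, give the converses. *)

(** * Unique factorization *)

Section Divisibility.
Variable D : idomainType.
Implicit Types a b c p q : D.

(** The arguments replace homological algebra by divisibility. Grade 2 is expressed by
    [coprime_family], and this one property serves three times: parallel vectors become multiples,
    elimination of one variable leaves a nonzero polynomial in the two others, and two local
    generators form a regular sequence. Local freeness of AR(f) is the main obstacle, since no
    resolution or depth argument is used. Two syzygies whose wedge has least contact at p with a
    fixed line t = 0 generate modulo t, up to a factor that does not vanish at p; iterating this,
    and using that the Jacobian ideal contains some u t^e with u(p) nonzero, forces the wedge not to
    vanish at p. Lengths of local rings are compared with Hilbert functions through the contractions
    of the localizations to S: in large degrees multiplication by a form that does not vanish at the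
    point is bijective modulo such a contraction, which makes the Chinese remainder theorem
    elementary. The same statement is applied to B and to the Jacobian ideal, and tau_max is what
    remains of the binomial coefficients. *)

Definition divides a b := exists c, b = c * a.

Definition irred p :=
  [/\ p != 0, p \isn't a GRing.unit &
      forall a b, p = a * b -> a \is a GRing.unit \/ b \is a GRing.unit].

Definition prime_elt p :=
  [/\ p != 0, p \isn't a GRing.unit &
      forall a b, divides p (a * b) -> divides p a \/ divides p b].

(* Unique factorization, stated as the induction principle it provides. *)
Definition is_ufd := forall P : D -> Prop,
  (forall u, u \is a GRing.unit -> P u) ->
  (forall p a, prime_elt p -> a != 0 -> P a -> P (p * a)) ->
  forall a, a != 0 -> P a.

Lemma divides_mull a b c : divides a b -> divides a (c * b).
Proof. by case=> d ->; exists (c * d); rewrite mulrA. Qed.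

Lemma divides_mulr a b c : divides a b -> divides a (b * c).
Proof. by rewrite mulrC; apply: divides_mull. Qed.

Lemma divides_refl a : divides a a.
Proof. by exists 1; rewrite mul1r. Qed.

Lemma divides0 a : divides a 0.
Proof. by exists 0; rewrite mul0r. Qed.

Lemma divides_add a b c : divides a b -> divides a c -> divides a (b + c).
Proof. by move=> [x ->] [y ->]; exists (x + y); rewrite mulrDl. Qed.

Lemma divides_opp a b : divides a b -> divides a (- b).
Proof. by move=> [x ->]; exists (- x); rewrite mulNr. Qed.

Lemma divides_sum a (I : Type) (r : seq I) (P : pred I) (F : I -> D) :
  (forall i, P i -> divides a (F i)) -> divides a (\sum_(i <- r | P i) F i).
Proof.
by move=> h; elim/big_ind: _ => //; [exact: divides0 | move=> *; exact: divides_add].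
Qed.

End Divisibility.

Section DivisibilityMorphism.
Variables (D E : idomainType) (F : {rmorphism D -> E}) (G : {rmorphism E -> D}).
Hypotheses (FK : cancel F G) (GK : cancel G F).

Lemma can_unit a : (F a \is a GRing.unit) = (a \is a GRing.unit).
Proof.
by apply/idP/idP => [/(rmorph_unit G)|]; [rewrite FK | exact: rmorph_unit].
Qed.

Lemma can_divides a b : divides (F a) (F b) <-> divides a b.
Proof.
split=> [[c /(congr1 G)]|[c ->]]; first by rewrite rmorphM !FK => ->; exists (G c).
by exists (F c); rewrite rmorphM.
Qed.

Lemma can_irred p : irred p -> irred (F p).
Proof.
case=> p0 pu pir; split; rewrite ?can_unit //.
  by rewrite -(rmorph0 F) (can_eq FK).
move=> a b /(congr1 G); rewrite FK rmorphM => /pir.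
by rewrite -{2}[a]GK -{2}[b]GK !can_unit.
Qed.

Lemma can_prime p : prime_elt (F p) -> prime_elt p.
Proof.
case=> p0 pu pir; split; rewrite -?can_unit //.
  by apply: contraNneq p0 => ->; rewrite rmorph0.
move=> a b /can_divides; rewrite rmorphM => /pir.
by case=> /can_divides; [left|right].
Qed.

End DivisibilityMorphism.

Section PolyPrime.
Variable D : idomainType.
Implicit Types (p q g u : {poly D}).

Lemma divides_polyC (c : D) p : divides c%:P p <-> forall i, divides c p`_i.
Proof.
split=> [[q ->] i|h]; first by exists q`_i; rewrite coefMC.
pose F i := xget 0 [set x | p`_i = x * c].
have FE i : p`_i = F i * c.
  by apply: (@xgetPex _ 0 [set x | p`_i = x * c]); case: (h i) => x e; exists x.
exists (\poly_(i < size p) F i); apply/polyP => i.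
rewrite coefMC coef_poly; case: ltnP => [_|le]; first exact: FE.
by rewrite mul0r nth_default.
Qed.

(** Let [i] and [j] be the least indices of coefficients of [p] and [q] that [c] does not divide: in
    the coefficient of index [i + j] of the product every other term is divisible by [c]. *)
Lemma gauss (c : D) p q :
  prime_elt c -> divides c%:P (p * q) -> divides c%:P p \/ divides c%:P q.
Proof.
move=> [c0 cu cpr] cpq; apply: contrapT => /not_orP[np nq].
have ex (r : {poly D}) : ~ divides c%:P r -> exists i, ~ divides c r`_i.
  by move=> nr; apply: contrapT => h; apply: nr; apply/divides_polyC => i;
     apply: contrapT => hi; apply: h; exists i.
have exb (r : {poly D}) : ~ divides c%:P r -> exists i, `[< ~ divides c r`_i >].
  by move=> /ex[i hi]; exists i; apply/asboolP.
pose i := ex_minn (exb _ np); pose j := ex_minn (exb _ nq).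
have [/asboolP hi li] : `[< ~ divides c p`_i >] /\
    forall k, (k < i)%N -> divides c p`_k.
  rewrite /i; case: ex_minnP => m hm hmin; split=> // k km.
  by apply: contrapT => /asboolP /hmin; rewrite leqNgt km.
have [/asboolP hj lj] : `[< ~ divides c q`_j >] /\
    forall k, (k < j)%N -> divides c q`_k.
  rewrite /j; case: ex_minnP => m hm hmin; split=> // k km.
  by apply: contrapT => /asboolP /hmin; rewrite leqNgt km.
have := (divides_polyC c (p * q)).1 cpq (i + j)%N.
have ilt : (i < (i + j).+1)%N by rewrite ltnS leq_addr.
rewrite coefM (bigD1 (Ordinal ilt)) //= addKn => h.
have h2 : divides c (p`_i * q`_j).
  rewrite -[_ * _](addrK (\sum_(k < (i + j).+1 | k != Ordinal ilt)
    p`_k * q`_(i + j - k))); apply: divides_add => //; apply: divides_opp.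
  apply: divides_sum => k; rewrite -val_eqE /= => ki.
  case: (ltngtP k i) ki => // ki _; first exact/divides_mulr/li.
  apply/divides_mull/lj; rewrite ltn_subLR ?ltn_add2r //.
  by rewrite -ltnS.
by case: (cpr _ _ h2).
Qed.

(** Clears the denominator [c] of a factorization: by Gauss's lemma each prime factor of [c] divides
    [g] or [u] and is cancelled there; those taken from [g] make up [b]. *)
Lemma ufd_descent (c : D) p g u :
  is_ufd D -> c != 0 -> c%:P * p = g * u ->
  exists (b : D) g1 u1, [/\ b != 0, g = b%:P * g1 & p = g1 * u1].
Proof.
move=> fD c0; move: c c0 g u.
apply: fD => [c cu|c a cpr a0 IH] g u e.
  exists 1, g, (c^-1%:P * u); rewrite oner_eq0 mul1r; split=> //.
  by rewrite mulrCA -e mulrA -polyCM mulVr // mul1r.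
have c0 : c%:P != 0 by rewrite polyC_eq0; case: cpr.
have : divides c%:P (g * u).
  by rewrite -e polyCM; exists (a%:P * p); rewrite -mulrA mulrC.
case/(gauss cpr)=> [[x ex]|[x ex]].
  have [|b [g1 [u1 [b0 ex' ->]]]] := IH x u.
    by apply: (mulfI c0); rewrite mulrA -polyCM e ex mulrA [x * _]mulrC.
  exists (c * b), g1, u1; rewrite mulf_neq0 //; last by case: cpr.
  by rewrite ex ex' polyCM mulrC mulrA.
have [|b [g1 [u1 [b0 -> ->]]]] := IH g x; last by exists b, g1, u1.
apply: (mulfI c0); rewrite mulrA -polyCM e ex mulrA.
by rewrite mulrC.
Qed.

(** A prime factor of [c] cannot divide [p], where it would be a constant factor of an irreducible
    polynomial of positive degree; so it cancels against the cofactor [w]. *)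
Lemma divides_scaled_irred (c : D) p q : is_ufd D -> c != 0 ->
  irred p -> (1 < size p)%N -> divides p (c%:P * q) -> divides p q.
Proof.
move=> fD c0 pir sp [w]; move: c c0 w.
apply: fD => [c cu|c a cpr a0 IH] w e.
  exists (c^-1%:P * w).
  by rewrite -mulrA -e mulrA -polyCM mulVr // mul1r.
have c0 : c%:P != 0 by rewrite polyC_eq0; case: cpr.
have : divides c%:P (w * p).
  by rewrite -e polyCM; exists (a%:P * q); rewrite -mulrA mulrC.
case/(gauss cpr)=> [[x ex]|[x ex]].
  apply: (IH x); apply: (mulfI c0).
  by rewrite [LHS]mulrA -polyCM e ex -mulrA mulrCA.
case: pir => p0 _ /(_ _ _ ex) [|].
  rewrite poly_unitE => /andP[/eqP sx _]; move: sp; rewrite ex mulrC.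
  by rewrite size_Cmul ?sx //; case: cpr.
move=> cu; have [_ /negP[]] := cpr.
by move: cu; rewrite poly_unitE coefC eqxx => /andP[].
Qed.

Lemma poly_irred_prime p : is_ufd D ->
  (forall a : D, irred a -> prime_elt a) -> irred p -> prime_elt p.
Proof.
move=> fD irD pir; have [p0 pu pf] := pir.
have [sp|sp] := leqP (size p) 1.
  have [c ep] : exists c, p = c%:P by exists p`_0; apply: size1_polyC.
  have cpr : prime_elt c.
    apply: irD; split.
    - by rewrite -polyC_eq0 -ep.
    - by apply: contraNN pu; rewrite ep => /(rmorph_unit (@polyC D)).
    - move=> a b e; have /pf[] : p = a%:P * b%:P by rewrite -polyCM -e.
        by rewrite poly_unitE coefC eqxx => /andP[]; left.
      by rewrite poly_unitE coefC eqxx => /andP[]; right.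
  by split=> // a b; rewrite ep; apply: gauss.
split=> // a b pab.
(* This is a gcd over the fraction field. If it is constant, Bezout puts the nonzero constant
   [c2 * x] in the ideal of [p] and [a]; otherwise it descends to a true factor of [p], which is
   then [p] up to a unit. *)
pose g := gcdp p a.
have g0 : g != 0 by rewrite gcdp_eq0 (negPf p0).
have [sg|sg] := leqP (size g) 1.
  have [u /eqpP[[c1 c2] /andP[/= c10 c20]]] := Bezoutp p a.
  have [x ex] : exists c, g = c%:P by exists g`_0; apply: size1_polyC.
  rewrite -/g ex => e; right.
  apply: (@divides_scaled_irred (c2 * x)) => //.
    by rewrite mulf_neq0 //; apply: contraNneq g0 => x0; rewrite ex x0.
  rewrite polyCM mul_polyC -e -mul_polyC -mulrA mulrDl.
  apply/divides_mull/divides_add; first exact/divides_mulr/divides_mull/divides_refl.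
  by rewrite -mulrA; apply: divides_mull.
have /Pdiv.Idomain.dvdpP[[c u] /= c0 e] : g %| p by apply: dvdp_gcdl.
have [b1 [g1 [u1 [b10 eg ep]]]] : exists (b : D) g1 u1,
    [/\ b != 0, g = b%:P * g1 & p = g1 * u1].
  by apply: (@ufd_descent c p g u); rewrite // mul_polyC e mulrC.
case: (pf _ _ ep) => [|u1u].
  rewrite poly_unitE => /andP[/eqP s1 _]; move: sg.
  by rewrite eg size_Cmul ?s1.
have /Pdiv.Idomain.dvdpP[[c' u'] /= c'0 e'] : g %| a by apply: dvdp_gcdr.
left; apply: (@divides_scaled_irred c') => //; rewrite mul_polyC e' eg.
apply/divides_mull/divides_mull; exists u1^-1; rewrite ep mulrC mulrK //.
Qed.

End PolyPrime.

Section MpolyMorphisms.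
Variable K : fieldType.

Lemma mpoly_rmorph_eq n (E : comNzRingType) (F G : {rmorphism {mpoly K[n]} -> E}) :
  (forall c, F c%:MP = G c%:MP) -> (forall i, F 'X_i = G 'X_i) -> F =1 G.
Proof.
move=> eC eX p; rewrite [p]mpolyE !rmorph_sum; apply: eq_bigr => m _.
rewrite -mul_mpolyC !rmorphM eC mpolyXE_id !rmorph_prod; congr (_ * _).
by apply: eq_bigr => i _; rewrite !rmorphXn /= eX.
Qed.

Section SplitVar.
Variables (n : nat) (k : 'I_n.+1).

(** Singles out the variable of index [k], so that facts on univariate polynomials apply; [join_var]
    is the inverse isomorphism. *)
Definition split_var : {mpoly K[n.+1]} -> {poly {mpoly K[n]}} :=
  mmap (polyC \o @mpolyC n K)
    (fun j => if unlift k j is Some l then ('X_l)%:P else 'X).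

HB.instance Definition _ := GRing.RMorphism.on split_var.

Definition lift_var : {mpoly K[n]} -> {mpoly K[n.+1]} :=
  comp_mpoly [tuple 'X_(lift k j) | j < n].

HB.instance Definition _ := GRing.RMorphism.on lift_var.

Definition join_var : {poly {mpoly K[n]}} -> {mpoly K[n.+1]} :=
  horner_eval 'X_k \o map_poly lift_var.

HB.instance Definition _ := GRing.RMorphism.on join_var.

Lemma lift_varC c : lift_var c%:MP = c%:MP.
Proof. exact: comp_mpolyC. Qed.

Lemma lift_varX j : lift_var 'X_j = 'X_(lift k j).
Proof. by rewrite /lift_var comp_mpolyXU -tnth_nth tnth_mktuple. Qed.

Lemma split_varC c : split_var c%:MP = (c%:MP)%:P.
Proof. exact: mmapC. Qed.

Lemma split_varXk : split_var 'X_k = 'X.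
Proof. by rewrite /split_var mmapX mmap1U unlift_none. Qed.

Lemma split_varX j : split_var 'X_(lift k j) = ('X_j)%:P.
Proof. by rewrite /split_var mmapX mmap1U liftK. Qed.

Lemma join_varC p : join_var p%:P = lift_var p.
Proof. by rewrite /join_var /= /horner_eval map_polyC hornerC. Qed.

Lemma join_varX : join_var 'X = 'X_k.
Proof. by rewrite /join_var /= /horner_eval map_polyX hornerX. Qed.

Lemma split_lift p : split_var (lift_var p) = p%:P.
Proof.
have /= := @mpoly_rmorph_eq n _ (split_var \o lift_var)
  (@polyC {mpoly K[n]}).
apply=> [c|i]; first by rewrite /= lift_varC split_varC.
by rewrite /= lift_varX split_varX.
Qed.

Lemma join_varK : cancel join_var split_var.
Proof.
elim/poly_ind => [|p c IH]; first by rewrite !rmorph0.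
by rewrite !rmorphD !rmorphM /= IH join_varX split_varXk join_varC split_lift.
Qed.

Lemma split_varK : cancel split_var join_var.
Proof.
move=> p; have /= := @mpoly_rmorph_eq n.+1 _ (join_var \o split_var) idfun.
apply=> [c|i] /=; first by rewrite split_varC join_varC lift_varC.
case: (unliftP k i) => [j|] ->; last by rewrite split_varXk join_varX.
by rewrite split_varX join_varC lift_varX.
Qed.

End SplitVar.

Lemma mpoly_unitP n (p : {mpoly K[n]}) :
  reflect (exists2 c, c != 0 & p = c%:MP) (p \is a GRing.unit).
Proof.
apply: (iffP idP) => [pu|[c c0 ->]].
  have [p0 q0] : p != 0 /\ p^-1 != 0.
    by rewrite invr_eq0; case: eqP pu => // ->; rewrite unitr0.
  apply/msize_poly1P; have := msizeM p0 q0; rewrite divrr // msize1.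
  have := @mmeasure_poly_eq0 _ _ mdeg p; have := @mmeasure_poly_eq0 _ _ mdeg p^-1.
  rewrite (negPf p0) (negPf q0); case: (msize p) => [//|a]; case: (msize _) => [//|b] _ _.
  by rewrite addSn addnS /=; case: a.
by apply: (rmorph_unit (@mpolyC n K)); rewrite unitfE.
Qed.

Lemma mpoly_nonunit_size n (p : {mpoly K[n]}) :
  p != 0 -> p \isn't a GRing.unit -> (1 < msize p)%N.
Proof.
move=> p0 pu; rewrite ltn_neqAle lt0n mmeasure_poly_eq0 p0 andbT.
apply: contraNneq pu => e; apply/mpoly_unitP/msize_poly1P.
by rewrite -e.
Qed.

Lemma mpoly_ufd_of_prime n :
  (forall p : {mpoly K[n]}, irred p -> prime_elt p) ->
  is_ufd {mpoly K[n]}.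
Proof.
move=> ip P Pu Pp a; have [m] := ubnP (msize a).
elim: m a => // m IH a am a0.
have [au|au] := boolP (a \is a GRing.unit); first exact: Pu.
have [p [q [pir e]]] : exists p q : {mpoly K[n]}, irred p /\ a = p * q.
  move: {IH} a am a0 au; elim: m => [|m IH] a am a0 au.
    by move: am (mpoly_nonunit_size a0 au); case: (msize a) => [|[]].
  have [air|nir] := pselect (irred a).
    by exists a, 1; rewrite mulr1.
  have [b [c [e bu cu]]] : exists b c : {mpoly K[n]},
      [/\ a = b * c, b \isn't a GRing.unit & c \isn't a GRing.unit].
    apply: contrapT => h; apply: nir; split=> // b c e.
    have [|bu] := boolP (b \is a GRing.unit); first by left.
    by right; apply/negPn/negP => cu; apply: h; exists b, c.
  have [b0 c0] : b != 0 /\ c != 0.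
    by apply/andP; rewrite -negb_or -mulf_eq0 -e.
  have [|p [q [pir eb]]] := IH b _ b0 bu.
    have := mpoly_nonunit_size c0 cu; move: am; rewrite e msizeM //.
    by move: (msize _) (msize _) => x y; lia.
  by exists p, (q * c); rewrite e eb mulrA.
have ppr := ip _ pir; have [p0 pu _] := ppr.
have q0 : q != 0 by apply: contraNneq a0 => q0; rewrite e q0 mulr0.
rewrite e; apply: Pp => //; apply: IH => //.
have := mpoly_nonunit_size p0 pu; move: am; rewrite e msizeM //.
    by move: (msize _) (msize _) => x y; lia.
Qed.

Lemma split_var_prime n (k : 'I_n.+1) (p : {mpoly K[n.+1]}) :
  prime_elt (split_var k p) -> prime_elt p.
Proof.
have := @can_prime {mpoly K[n.+1]} {poly {mpoly K[n]}} (split_var k) (join_var k).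
by move=> /(_ (split_varK k)) h; exact: h.
Qed.

Lemma split_var_irred n (k : 'I_n.+1) (p : {mpoly K[n.+1]}) :
  irred p -> irred (split_var k p).
Proof.
have := @can_irred {mpoly K[n.+1]} {poly {mpoly K[n]}} (split_var k) (join_var k).
by move=> /(_ (split_varK k) (join_varK k)) h; exact: h.
Qed.

(** Induction on the number of variables, through [poly_irred_prime]. With no variable every nonzero
    element is a unit, so nothing is irreducible. *)
Lemma mpoly_irred_prime n (p : {mpoly K[n]}) : irred p -> prime_elt p.
Proof.
elim: n p => [|n IH] p pir.
  case: pir => p0 pu _; case/mpoly_unitP: pu; exists (p@_0%MM); last exact: nvar0_mpolyC.
  by apply: contraNneq p0 => e; rewrite (nvar0_mpolyC p) e mpolyC0.
apply: (@split_var_prime _ ord0).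
apply: (@poly_irred_prime {mpoly K[n]}); first exact: mpoly_ufd_of_prime.
  exact: IH.
exact: split_var_irred.
Qed.

Lemma mpoly_ufd n : is_ufd {mpoly K[n]}.
Proof. by apply: mpoly_ufd_of_prime; apply: mpoly_irred_prime. Qed.

End MpolyMorphisms.

(** * Homogeneous polynomials and charts *)

Section Homogeneous.
Variables (K : fieldType) (n : nat).
Implicit Types (p q : {mpoly K[n]}).

Lemma mpoly_ring_ind (P : {mpoly K[n]} -> Prop) :
  (forall c, P c%:MP) -> (forall i, P 'X_i) ->
  (forall p q, P p -> P q -> P (p + q)) ->
  (forall p q, P p -> P q -> P (p * q)) -> forall p, P p.
Proof.
move=> hC hX hD hM p; rewrite [p]mpolyE; elim/big_ind: _; [by rewrite -mpolyC0 | exact: hD|].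
move=> m _; rewrite -mul_mpolyC; apply: (hM) => //; rewrite mpolyXE_id.
elim/big_ind: _; [by rewrite -mpolyC1 | exact: hM |].
move=> i _; elim: (m i) => [|k IH]; first by rewrite expr0 -mpolyC1.
by rewrite exprS; apply: hM.
Qed.

Lemma dhomog_mdeg N p m : p \is N.-homog -> m \in msupp p -> mdeg m = N.
Proof. by move=> /dhomogP; apply. Qed.

Lemma dhomog_monomial m : ('X_[m] : {mpoly K[n]}) \is (mdeg m).-homog.
Proof. by rewrite dhomogX. Qed.

Lemma dhomogXi i : ('X_i : {mpoly K[n]}) \is 1.-homog.
Proof. by rewrite -(mdeg1 i); apply: dhomog_monomial. Qed.

Lemma dhomogXn i k : ('X_i ^+ k : {mpoly K[n]}) \is k.-homog.
Proof. by have := dhomogMn k (dhomogXi i); rewrite mul1n. Qed.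

Lemma comp_homog k N p (y : {mpoly K[k]}) (u : 'I_n -> {mpoly K[k]}) :
  p \is N.-homog ->
  p \mPo [tuple y * u j | j < n] = y ^+ N * (p \mPo [tuple u j | j < n]).
Proof.
move=> hp; rewrite !comp_mpolyEX big_distrr /= !big_seq; apply: eq_bigr => m mp.
rewrite -scalerAr; congr (_ *: _); rewrite !comp_mpolyX -(dhomog_mdeg hp mp) mdegE.
rewrite -prodrXr -big_split /=; apply: eq_bigr => j _.
by rewrite !tnth_mktuple exprMn.
Qed.

Lemma meval_homog N p (c : K) (v : 'I_n -> K) :
  p \is N.-homog -> p.@[fun j => c * v j] = c ^+ N * p.@[v].
Proof.
move=> hp; rewrite !mevalE big_distrr /= !big_seq; apply: eq_bigr => m mp.
rewrite mulrCA; congr (_ * _); rewrite -(dhomog_mdeg hp mp) mdegE.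
by rewrite -prodrXr -big_split /=; apply: eq_bigr => j _; rewrite exprMn.
Qed.

Lemma comp_const k p (v : 'I_n -> K) :
  p \mPo [tuple (v j)%:MP_[k] | j < n] = (p.@[v])%:MP.
Proof.
have := @mpoly_rmorph_eq K n _ (comp_mpoly [tuple (v j)%:MP_[k] | j < n])
  (@mpolyC k K \o meval v).
apply=> [c|i] /=; first by rewrite comp_mpolyC mevalC.
by rewrite comp_mpolyXU -tnth_nth tnth_mktuple mevalXU.
Qed.

Lemma comp_congr k (I : set {mpoly K[k]}) p (u v : 'I_n -> {mpoly K[k]}) :
  is_ideal I -> (forall j, I (u j - v j)) ->
  I ((p \mPo [tuple u j | j < n]) - (p \mPo [tuple v j | j < n])).
Proof.
case=> I0 ID IM h; elim/mpoly_ring_ind: p => [c|i|p q|p q].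
- by rewrite !comp_mpolyC subrr.
- by rewrite !comp_mpolyXU -!tnth_nth !tnth_mktuple.
- by move=> hp hq; rewrite !comp_mpolyD opprD addrACA; apply: ID.
move=> hp hq; rewrite !rmorphM /=.
have E (a b a' b' : {mpoly K[k]}) : a * b - a' * b' = b * (a - a') + a' * (b - b').
  by ring.
by rewrite E; apply: ID; apply: IM.
Qed.

Lemma pihomogM d k p q : q \is d.-homog ->
  pihomog mdeg (k + d) (p * q) = pihomog mdeg k p * q.
Proof.
move=> hq; have hmax := leq_maxl (msize p) k.+1.
rewrite {1}(pihomog_partitionE hmax) big_distrl /= raddf_sum /=.
have kl : (k < maxn (msize p) k.+1)%N by rewrite leq_maxr.
rewrite (bigD1 (Ordinal kl)) //= [X in _ + X]big1 ?addr0 => [|j jk].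
  by apply: pihomog_dE; apply: dhomogM => //; apply: pihomogP.
apply: (@pihomog_ne0 _ _ _ (j + d)%N); last by apply: dhomogM => //; apply: pihomogP.
by apply: contraNneq jk => /addIn e; rewrite -val_eqE /= e.
Qed.

Lemma pihomogM_lt d e p q : q \is d.-homog -> (e < d)%N ->
  pihomog mdeg e (p * q) = 0.
Proof.
move=> hq ed.
rewrite {1}(pihomog_partitionE (leqnn (msize p))) big_distrl /= raddf_sum /=.
apply: big1 => j _; apply: (@pihomog_ne0 _ _ _ (j + d)%N); last first.
  by apply: dhomogM => //; apply: pihomogP.
by apply: contraTneq ed => <-; rewrite -leqNgt leq_addl.
Qed.

Lemma pihomog_eq0 p : (forall k, pihomog mdeg k p = 0) -> p = 0.
Proof.
by move=> h; rewrite (pihomog_partitionE (leqnn (msize p))) big1 // => i _.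
Qed.

Lemma dhomog_div_lt d e p q : q != 0 -> q \is d.-homog ->
  p * q \is e.-homog -> (e < d)%N -> p = 0.
Proof.
move=> q0 hq hpq ed; apply/eqP; rewrite -(mulIr_eq0 _ (mulIf q0)).
by rewrite -(pihomog_dE hpq) (pihomogM_lt _ hq).
Qed.

Lemma dhomog_div d e p q : q != 0 -> q \is d.-homog ->
  p * q \is (e + d).-homog -> p \is e.-homog.
Proof.
move=> q0 hq hpq; suff -> : p = pihomog mdeg e p by apply: pihomogP.
by apply: (mulIf q0); rewrite -(pihomogM _ _ hq) pihomog_dE.
Qed.

End Homogeneous.

Section Dehom.
Variables (K : fieldType) (i : 'I_3).
Implicit Types (F G : {mpoly K[3]}) (g : {mpoly K[2]}).

Lemma dehom_is_zmod_morphism : zmod_morphism (@dehom K i).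
Proof. by move=> F G; rewrite /dehom raddfB. Qed.

Lemma dehom_is_monoid_morphism : monoid_morphism (@dehom K i).
Proof. by split=> [|F G]; rewrite /dehom ?rmorph1 ?rmorphM. Qed.

HB.instance Definition _ :=
  GRing.isZmodMorphism.Build _ _ (@dehom K i) dehom_is_zmod_morphism.
HB.instance Definition _ :=
  GRing.isMonoidMorphism.Build _ _ (@dehom K i) dehom_is_monoid_morphism.

Lemma dehomC c : dehom i c%:MP = c%:MP_[2] :> {mpoly K[2]}.
Proof. exact: comp_mpolyC. Qed.

Lemma dehomZ (c : K) F : dehom i (c *: F) = c *: dehom i F.
Proof. exact: comp_mpolyZ. Qed.

Lemma dehomXi : dehom i 'X_i = 1 :> {mpoly K[2]}.
Proof. by rewrite /dehom comp_mpolyXU -tnth_nth tnth_mktuple unlift_none. Qed.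

Lemma dehomX j : dehom i 'X_(lift i j) = 'X_j :> {mpoly K[2]}.
Proof. by rewrite /dehom comp_mpolyXU -tnth_nth tnth_mktuple liftK. Qed.

Lemma dehom_lift_var g : dehom i (lift_var i g) = g.
Proof.
have := @mpoly_rmorph_eq K 2 _ (@dehom K i \o lift_var i) idfun.
by apply=> [c|j] /=; rewrite ?lift_varC ?dehomC ?lift_varX ?dehomX.
Qed.

Lemma dehomXm m : dehom i 'X_[m] = 'X_[[multinom m (lift i j) | j < 2]] :> {mpoly K[2]}.
Proof.
rewrite mpolyXE_id rmorph_prod /= [RHS]mpolyXE_id (bigD1_ord i) //= rmorphXn /= dehomXi expr1n mul1r.
by apply: eq_bigr => j _; rewrite rmorphXn /= dehomX mnmE.
Qed.

(** In a fixed degree the exponent of ['X_i] is determined by the two others, so distinct monomials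
    stay distinct. *)
Lemma dehom_homog_eq0 N F : F \is N.-homog -> dehom i F = 0 -> F = 0.
Proof.
move=> hF F0; apply/mpolyP => m0; rewrite mcoeff0.
have [m0F|] := boolP (m0 \in msupp F); last exact: memN_msupp_eq0.
pose r (m : 'X_{1..3}) : 'X_{1..2} := [multinom m (lift i j) | j < 2].
have /(congr1 (mcoeff (r m0))) := F0.
rewrite [in X in X -> _](mpolyE F) rmorph_sum /= raddf_sum /= mcoeff0.
rewrite (bigD1_seq m0) ?msupp_uniq //= dehomZ dehomXm mcoeffZ mcoeffX eqxx mulr1.
rewrite big_seq_cond big1 ?addr0 // => m /andP[mF mm0].
rewrite dehomZ dehomXm mcoeffZ mcoeffX; case: eqP => [e|]; last by rewrite mulr0.
case/eqP: mm0; apply/mnmP => j.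
have el l : m (lift i l) = m0 (lift i l).
  by move/mnmP: e => /(_ l); rewrite !mnmE.
have := dhomogP _ _ _ hF m mF; rewrite -(dhomog_mdeg hF m0F) /= !mdegE.
rewrite !(bigD1_ord i) //= (eq_bigr _ (fun l _ => el l)) => /addIn ei.
by case: (unliftP i j) => [l|] ->.
Qed.

Lemma dehom_homog_inj N F G : F \is N.-homog -> G \is N.-homog ->
  dehom i F = dehom i G -> F = G.
Proof.
move=> hF hG e; apply/eqP; rewrite -subr_eq0; apply/eqP.
by apply: (@dehom_homog_eq0 N); rewrite ?rpredB // rmorphB /= e subrr.
Qed.

(** [F] is any polynomial in the three variables; its components are brought to degree [N]
    separately, so that a homogeneous ideal is preserved. Components of degree above [N] are
    dropped, hence the bound in [dehom_homogenize]. *)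
Definition homogenize N F : {mpoly K[3]} :=
  \sum_(j < N.+1) 'X_i ^+ (N - j) * pihomog mdeg j F.

Lemma homogenize_homog N F : homogenize N F \is N.-homog.
Proof.
apply: rpred_sum => j _; have := dhomogM (dhomogXn K i (N - j)%N) (pihomogP mdeg j F).
by rewrite subnK // -ltnS ltn_ord.
Qed.

Lemma dehom_homogenize N F : (msize F <= N.+1)%N -> dehom i (homogenize N F) = dehom i F.
Proof.
move=> hN; rewrite [in RHS](pihomog_partitionE hN) !rmorph_sum /=.
by apply: eq_bigr => j _; rewrite rmorphM rmorphXn /= dehomXi expr1n mul1r.
Qed.

Lemma homogenize_ideal (I : set {mpoly K[3]}) N F :
  homogeneous_ideal I -> I F -> I (homogenize N F).
Proof.
move=> [[I0 ID IM] Ih] IF; rewrite /homogenize; elim/big_ind: _ => // j _.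
exact/IM/Ih.
Qed.

Lemma dehom_surj g : exists N0, forall N, (N0 <= N)%N ->
  exists2 G, G \is N.-homog & dehom i G = g.
Proof.
exists (msize (lift_var i g)) => N hN; exists (homogenize N (lift_var i g)).
  exact: homogenize_homog.
by rewrite dehom_homogenize ?dehom_lift_var // leqW.
Qed.

Lemma dehom_homog_eq M N F G : F \is M.-homog -> G \is N.-homog ->
  dehom i F = dehom i G -> 'X_i ^+ N * F = 'X_i ^+ M * G.
Proof.
move=> hF hG e; apply: (@dehom_homog_inj (N + M)).
- by apply: dhomogM => //; apply: dhomogXn.
- by rewrite addnC; apply: dhomogM => //; apply: dhomogXn.
- by rewrite !rmorphM !rmorphXn /= dehomXi !expr1n e.
Qed.

Lemma dehom_meval N F (p : 'rV[K]_3) : p 0 i != 0 -> F \is N.-homog ->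
  F.@[p 0] = p 0 i ^+ N * (dehom i F).@[aff i p].
Proof.
move=> pi hF; rewrite /dehom comp_mpoly_meval -(meval_homog _ _ hF).
apply: meval_eq => j; rewrite tnth_mktuple.
case: (unliftP i j) => [k|] ->; last by rewrite meval1 mulr1.
by rewrite mevalXU /aff mulrCA divff ?mulr1.
Qed.

End Dehom.

Section Points.
Variables (K : fieldType) (n : nat).
Implicit Types (p : 'rV[K]_n) (F G : {mpoly K[n]}).

Definition minor_form p (i j : 'I_n) : {mpoly K[n]} := p 0 i *: 'X_j - p 0 j *: 'X_i.

Lemma minor_form_homog p i j : minor_form p i j \is 1.-homog.
Proof. by rewrite rpredB // dhomogZ // dhomogXi. Qed.

Lemma minor_form_point p i j : (minor_form p i j).@[p 0] = 0.
Proof. by rewrite /minor_form mevalB !mevalZ !mevalXU mulrC subrr. Qed.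

(** Modulo [I], [p 0 i *: 'X_j] and [p 0 j *: 'X_i] agree; substituting one for the other in a form
    of degree [N] gives the congruence. A form thus becomes, up to a constant, its value at [p]
    times a power of ['X_i]. *)
Lemma point_congr p i N F (I : set {mpoly K[n]}) : is_ideal I ->
  (forall j, j != i -> I (minor_form p i j)) -> F \is N.-homog ->
  I (p 0 i ^+ N *: F - F.@[p 0] *: 'X_i ^+ N).
Proof.
move=> hI h hF.
have -> : p 0 i ^+ N *: F = F \mPo [tuple (p 0 i)%:MP * 'X_j | j < n].
  rewrite (comp_homog _ _ hF) comp_mpoly_id.
  by rewrite -(rmorphXn (@mpolyC n K)) /= mul_mpolyC.
have -> : F.@[p 0] *: 'X_i ^+ N = F \mPo [tuple 'X_i * (p 0 j)%:MP | j < n].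
  by rewrite (comp_homog _ _ hF) comp_const mulrC mul_mpolyC.
apply: comp_congr => // j; rewrite [_ * _%:MP]mulrC !mul_mpolyC.
have [->|ji] := eqVneq j i; first by rewrite subrr; case: hI.
exact: h.
Qed.

End Points.

(** * Coprime families *)

Section CoprimeFamily.
Variable D : idomainType.

(* Equivalently, the ideal generated by I has grade at least 2. *)
Definition coprime_family (I : set D) := forall g e, g != 0 ->
  (forall b, I b -> divides g (e * b)) -> divides g e.

Lemma coprime_familyS (I J : set D) : I `<=` J -> coprime_family I -> coprime_family J.
Proof. by move=> IJ h g e g0 hg; apply: h => // b /IJ /hg. Qed.

(** The primes of [g] are stripped one at a time: a prime that divides every [e * b] but not every
    [b] divides [e]. *)
Lemma coprime_family_prime (I : set D) : is_ufd D ->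
  (forall p, prime_elt p -> ~ (forall b, I b -> divides p b)) -> coprime_family I.
Proof.
move=> ufd hI g e g0; move: g g0 e; apply: ufd => [u uu|p a ppr a0 IH] e h.
  by exists (e * u^-1); rewrite mulrVK.
have [p0 pu pdiv] := ppr.
have [e' ee] : divides p e.
  apply: contrapT => pe; apply: (hI _ ppr) => b /h.
  move=> [x ex]; have : divides p (e * b) by rewrite ex mulrCA; apply/divides_mulr/divides_refl.
  by case/pdiv.
have [|c ec] := IH e'.
  move=> b /h[x ex]; exists x; apply: (mulfI p0).
  by rewrite [RHS]mulrCA -ex ee; ring.
by exists c; rewrite ee ec; ring.
Qed.

End CoprimeFamily.

Lemma ord3P (i : 'I_3) : [\/ i = 0, i = 1 | i = 2%:R].
Proof.
case: i => [[|[|[|m]]] hi] //;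
  [apply: Or31 | apply: Or32 | apply: Or33]; exact: val_inj.
Qed.

Lemma forall_ord3 (P : 'I_3 -> Prop) : P 0 -> P 1 -> P 2%:R -> forall i, P i.
Proof. by move=> h0 h1 h2 i; case: (ord3P i) => ->. Qed.

Lemma sum3 (V : nmodType) (F : 'I_3 -> V) :
  \sum_(i < 3) F i = F 0 + F 1 + F 2%:R.
Proof.
rewrite !big_ord_recr big_ord0 /= add0r.
by congr (F _ + F _ + F _); apply: val_inj.
Qed.

Lemma det2 (A : comNzRingType) (M : 'M[A]_2) :
  \det M = M 0 0 * M 1 1 - M 0 1 * M 1 0.
Proof.
have e0 : lift (0 : 'I_2) 0 = 1 by apply: val_inj.
have e1 : lift (1 : 'I_2) 0 = 0 by apply: val_inj.
rewrite (expand_det_row _ 0) !big_ord_recr big_ord0 /= add0r /cofactor !det_mx11 !mxE.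
have -> : widen_ord (leqnSn 1) ord_max = 0 :> 'I_2 by apply: val_inj.
have -> : ord_max = 1 :> 'I_2 by apply: val_inj.
by rewrite !e0 !e1 /= expr0 expr1 mul1r mulN1r mulrN.
Qed.

Lemma det3 (A : comNzRingType) (a b c : 'rV[A]_3) :
  \det (\matrix_(i < 3) tnth [tuple a; b; c] i) =
  a 0 0 * (b 0 1 * c 0 2%:R - b 0 2%:R * c 0 1) +
  a 0 1 * (b 0 2%:R * c 0 0 - b 0 0 * c 0 2%:R) +
  a 0 2%:R * (b 0 0 * c 0 1 - b 0 1 * c 0 0).
Proof.
have e0 : lift (0 : 'I_3) 0 = 1 by apply: val_inj.
have e1 : lift (0 : 'I_3) 1 = 2%:R by apply: val_inj.
have e2 : lift (1 : 'I_3) 0 = 0 by apply: val_inj.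
have e3 : lift (1 : 'I_3) 1 = 2%:R by apply: val_inj.
have e4 : lift (2%:R : 'I_3) 0 = 0 by apply: val_inj.
have e5 : lift (2%:R : 'I_3) 1 = 1 by apply: val_inj.
have t0 : tnth [tuple a; b; c] 0 = a by [].
have t1 : tnth [tuple a; b; c] 1 = b by [].
have t2 : tnth [tuple a; b; c] 2%:R = c by [].
rewrite (expand_det_row _ 0) sum3 /cofactor !det2 !mxE.
rewrite ?e0 ?e1 ?e2 ?e3 ?e4 ?e5 ?t0 ?t1 ?t2 /=.
by rewrite expr0 expr1 -signr_odd /= expr0; ring.
Qed.

(** * Cross products and Cramer's rule in rank 3 *)

Section Cross.
Variable D : idomainType.
Implicit Types a b c : 'rV[D]_3.

Definition cross a b : 'rV[D]_3 := \row_i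
  tnth [tuple a 0 1 * b 0 2%:R - a 0 2%:R * b 0 1;
              a 0 2%:R * b 0 0 - a 0 0 * b 0 2%:R;
              a 0 0 * b 0 1 - a 0 1 * b 0 0] i.

Definition dot a b : D := \sum_(i < 3) a 0 i * b 0 i.

Lemma cross0E a b : cross a b 0 0 = a 0 1 * b 0 2%:R - a 0 2%:R * b 0 1.
Proof. by rewrite mxE. Qed.

Lemma cross1E a b : cross a b 0 1 = a 0 2%:R * b 0 0 - a 0 0 * b 0 2%:R.
Proof. by rewrite mxE. Qed.

Lemma cross2E a b : cross a b 0 2%:R = a 0 0 * b 0 1 - a 0 1 * b 0 0.
Proof. by rewrite mxE. Qed.

Definition crossE := (cross0E, cross1E, cross2E).

Lemma dotE a b : dot a b = a 0 0 * b 0 0 + a 0 1 * b 0 1 + a 0 2%:R * b 0 2%:R.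
Proof. exact: sum3. Qed.

(** A nonzero entry [a 0 i] divides [c 0 i * a 0 j] for every [j], so by coprimality it divides
    [c 0 i]. *)
Lemma parallel_multiple a c : a != 0 ->
  coprime_family [set x | exists i, x = a 0 i] ->
  (forall i j, c 0 i * a 0 j = c 0 j * a 0 i) -> exists w, c = w *: a.
Proof.
move=> a0 acop h.
have [i ai] : exists i, a 0 i != 0.
  apply: contrapT => na; case/eqP: a0; apply/rowP => i; rewrite mxE.
  by apply/eqP/negPn/negP => ai; apply: na; exists i.
have [w ew] : divides (a 0 i) (c 0 i).
  apply: acop => // b [j ->]; rewrite h; exact/divides_mull/divides_refl.
exists w; apply/rowP => j; rewrite mxE; apply: (mulIf ai).
by rewrite -h ew; ring.
Qed.

Lemma cross_orthogonal a b g : dot a g = 0 -> dot b g = 0 ->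
  forall i j, cross a b 0 i * g 0 j = cross a b 0 j * g 0 i.
Proof.
rewrite !dotE => ag bg i j; apply/eqP; rewrite -subr_eq0; apply/eqP.
suff [s [t ->]] : exists s t, cross a b 0 i * g 0 j - cross a b 0 j * g 0 i =
    s * (a 0 0 * g 0 0 + a 0 1 * g 0 1 + a 0 2%:R * g 0 2%:R) +
    t * (b 0 0 * g 0 0 + b 0 1 * g 0 1 + b 0 2%:R * g 0 2%:R).
  by rewrite ag bg !mulr0 addr0.
case: (ord3P i) => ->; case: (ord3P j) => ->; rewrite !crossE.
- by exists 0, 0; ring.
- by exists (b 0 2%:R), (- a 0 2%:R); ring.
- by exists (- b 0 1), (a 0 1); ring.
- by exists (- b 0 2%:R), (a 0 2%:R); ring.
- by exists 0, 0; ring.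
- by exists (b 0 0), (- a 0 0); ring.
- by exists (b 0 1), (- a 0 1); ring.
- by exists (- b 0 0), (a 0 0); ring.
- by exists 0, 0; ring.
Qed.

Lemma dot_cross_l a b : dot a (cross a b) = 0.
Proof. by rewrite dotE !crossE; ring. Qed.

Lemma dot_cross_cyc a b c : dot a (cross b c) = dot b (cross c a).
Proof. by rewrite !dotE !crossE; ring. Qed.

(** The difference of the two sides, times an entry of [g], is a multiple of the determinant of [m],
    [a], [b]; this vanishes because [cross a b] is parallel to [g] and [m] is orthogonal to [g]. *)
Lemma cross_cramer m a b g (w wa wb : D) : g != 0 -> dot m g = 0 ->
  cross a b = w *: g -> cross m b = wa *: g -> cross a m = wb *: g ->
  w *: m = wa *: a + wb *: b.
Proof.
move=> g0 mg ew ea eb.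
have [k gk] : exists i, g 0 i != 0.
  apply: contrapT => ng; case/eqP: g0; apply/rowP => i; rewrite mxE.
  by apply/eqP/negPn/negP => gi; apply: ng; exists i.
have mab : dot m (cross a b) = 0.
  rewrite ew dotE !mxE; move: mg; rewrite dotE => mg.
  by rewrite (_ : _ + _ = w * (m 0 0 * g 0 0 + m 0 1 * g 0 1 + m 0 2%:R * g 0 2%:R));
    [rewrite mg mulr0 | ring].
apply/rowP => j; rewrite !mxE; apply: (mulIf gk).
have -> : w * m 0 j * g 0 k = cross a b 0 k * m 0 j by rewrite ew mxE; ring.
have -> : (wa * a 0 j + wb * b 0 j) * g 0 k =
   cross m b 0 k * a 0 j + cross a m 0 k * b 0 j by rewrite ea eb !mxE; ring.
move: mab; rewrite dotE !crossE => mab {ew ea eb mg gk}.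
apply/eqP; rewrite -subr_eq0; apply/eqP.
have [s ->] : exists s, cross a b 0 k * m 0 j -
   (cross m b 0 k * a 0 j + cross a m 0 k * b 0 j) = s *
   (m 0 0 * (a 0 1 * b 0 2%:R - a 0 2%:R * b 0 1) +
    m 0 1 * (a 0 2%:R * b 0 0 - a 0 0 * b 0 2%:R) +
    m 0 2%:R * (a 0 0 * b 0 1 - a 0 1 * b 0 0)); last by rewrite mab mulr0.
by case: (ord3P j) => ->; case: (ord3P k) => ->; rewrite !crossE;
   ((exists 0; ring) || (exists 1; ring)).
Qed.

End Cross.

(** * Syzygies and the Bourbaki ideal *)

Section Gradient.
Variables (K : numClosedFieldType).
Local Notation S := {mpoly K[3]}.
Implicit Types (f p : S) (rho : 'rV[S]_3).

Definition grad f : 'rV[S]_3 := \row_i f^`M(i).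

Lemma syzE f rho : syz f rho <-> dot rho (grad f) = 0.
Proof. by rewrite /syz /dot /=; under [X in _ <-> X = 0]eq_bigr do rewrite mxE. Qed.

Lemma mpoly_natr_neq0 n (d : nat) : (0 < d)%N -> (d%:R : {mpoly K[n]}) != 0.
Proof. by move=> d0; rewrite -mpolyC_nat mpolyC_eq0 pnatr_eq0 -lt0n. Qed.

Lemma mpoly_natr_unit n (d : nat) : (0 < d)%N -> (d%:R : {mpoly K[n]}) \is a GRing.unit.
Proof.
move=> d0; apply/mpoly_unitP; exists d%:R; rewrite ?mpolyC_nat //.
by rewrite pnatr_eq0 -lt0n.
Qed.

Lemma euler n d (f : {mpoly K[n]}) : f \is d.-homog ->
  \sum_(i < n) 'X_i * f^`M(i) = d%:R * f.
Proof.
move=> hf.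
transitivity (\sum_(m <- msupp f) \sum_(i < n) f@_m *: ('X_i * ('X_[m])^`M(i))).
  rewrite exchange_big /=; apply: eq_bigr => i _.
  rewrite [in LHS](mpolyE f) raddf_sum big_distrr /=; apply: eq_bigr => m _.
  by rewrite mderivZ scalerAr.
rewrite [in RHS](mpolyE f) big_distrr /= !big_seq; apply: eq_bigr => m mf.
rewrite -scaler_sumr -scalerAr; congr (_ *: _).
rewrite -(dhomog_mdeg hf mf) mdegE natr_sum big_distrl /=; apply: eq_bigr => i _.
rewrite mderivX -scalerAr -mpolyXD -mul_mpolyC mpolyC_nat.
have [->|mi] := eqVneq (m i) 0%N; first by rewrite !mul0r.
by rewrite addmC submK // lep1mP.
Qed.

Lemma dot_X_grad d f : f \is d.-homog ->
  dot (\row_(j < 3) 'X_j) (grad f) = d%:R * f.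
Proof. by move=> hf; rewrite -(euler hf); apply: eq_bigr => i _; rewrite !mxE. Qed.

Lemma mderiv_homog n d (f : {mpoly K[n]}) i : f \is d.+1.-homog -> f^`M(i) \is d.-homog.
Proof.
move=> hf; apply/dhomogP => m; rewrite mcoeff_msupp mcoeff_deriv => h.
have /(dhomog_mdeg hf) : (m + U_(i))%MM \in msupp f.
  by rewrite mcoeff_msupp; apply: contraNneq h => ->; rewrite mul0rn.
by rewrite mdegD mdeg1 addn1 => -[].
Qed.

Lemma divides_msize n (p q : {mpoly K[n]}) : q != 0 -> divides p q -> (msize p <= msize q)%N.
Proof.
move=> q0 [c e]; have [c0 p0] : c != 0 /\ p != 0.
  by apply/andP; rewrite -negb_or -mulf_eq0 -e.
rewrite e msizeM //.
have := @mmeasure_poly_eq0 _ _ mdeg c; rewrite (negPf c0).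
by move: (msize c) (msize p) => x y; lia.
Qed.

(** A nonzero derivative has smaller degree than [p] and is no multiple of it; in characteristic 0
    the vanishing of all derivatives leaves a constant. *)
Lemma mderiv_divides_const n (p : {mpoly K[n]}) :
  (forall i, divides p p^`M(i)) -> exists c, p = c%:MP.
Proof.
move=> h; have p0 i : p^`M(i) = 0.
  apply/eqP/negPn/negP => pi0; have := divides_msize pi0 (h i).
  have p0 : p != 0 by apply: contraNneq pi0 => ->; rewrite mderiv0.
  rewrite leqNgt -(mlead_deg pi0) => /negP; apply.
  have := mlead_supp pi0; rewrite mcoeff_msupp mcoeff_deriv => nz.
  have : (mlead p^`M(i) + U_(i))%MM \in msupp p.
    by rewrite mcoeff_msupp; apply: contraNneq nz => ->; rewrite mul0rn.
  by move/msize_mdeg_lt; rewrite mdegD mdeg1 addn1.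
exists (p@_0%MM); apply/mpolyP => m; rewrite mcoeffC.
have [->|m0] := eqVneq m 0%MM; first by rewrite mulr1.
have [i mi] : exists i, m i != 0%N.
  apply: contrapT => nm; case/eqP: m0; apply/mnmP => i; rewrite mnm0E.
  by apply/eqP/negPn/negP => mi; apply: nm; exists i.
have /(congr1 (mcoeff (m - U_(i))%MM)) := p0 i.
rewrite mcoeff_deriv mcoeff0 submK ?lep1mP // => /eqP.
by rewrite mulrn_eq0 /= mulr0 => /eqP.
Qed.

(** A prime [p] dividing all partial derivatives divides [f] by Euler's formula, and only once
    because [f] is reduced. Writing [f = q * p], it then divides the derivatives of [p] itself, so
    that [p] is constant. *)
Lemma grad_coprime d f : (0 < d)%N -> f \is d.-homog -> f != 0 ->
  reduced_equation f -> coprime_family [set x | exists i, x = grad f 0 i].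
Proof.
move=> d0 hf f0 fred; apply: (coprime_family_prime (@mpoly_ufd K 3)).
move=> p ppr h; have [p0 pu pdiv] := ppr.
have hp i : divides p f^`M(i) by apply: h; exists i; rewrite mxE.
have : divides p (d%:R * f).
  by rewrite -(euler hf); apply: divides_sum => i _; apply: divides_mull.
case/pdiv => [[c e]|[q fq]].
  case/negP: pu; have := mpoly_natr_unit 3 d0; rewrite e unitrM.
  by case/andP.
have pq : ~ divides p q.
  (* If [f = q' * p ^+ 2], the square of [q' * p] is a multiple of [f]; reducedness makes [q' * p] a
     multiple of [f], hence [p] a unit. *)
  move=> [q' eq]; have [|h' eh] := fred (q' * p) 2%N.
    by exists q'; rewrite fq eq; ring.
  have qp0 : q' * p != 0 by apply: contraNneq f0 => e; rewrite fq eq e mul0r.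
  case/negP: pu; suff e1 : h' * p = 1 by apply/unitrP; exists h'; rewrite e1 mulrC e1.
  by apply: (mulfI qp0); rewrite mulr1 {2}eh fq eq; ring.
have [c pc] : exists c, p = c%:MP.
  apply: mderiv_divides_const => i; have := hp i; rewrite fq mderivM => h1.
  have : divides p (q * p^`M(i)).
    rewrite -[_ * _](addKr (q^`M(i) * p)); apply: divides_add => //.
    exact/divides_opp/divides_mull/divides_refl.
  by case/pdiv.
case/negP: pu; apply/mpoly_unitP; exists c => //.
by apply: contraNneq p0 => c0; rewrite pc c0 mpolyC0.
Qed.

Lemma grad_neq0 d f : (0 < d)%N -> f \is d.-homog -> f != 0 -> grad f != 0.
Proof.
move=> d0 hf f0; apply: contraNneq f0 => g0; have := dot_X_grad hf.
rewrite g0 dotE !mxE !mulr0 !addr0 => /esym/eqP.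
by rewrite mulf_eq0 (negPf (mpoly_natr_neq0 3 d0)).
Qed.

Definition row_pihomog k rho : 'rV[S]_3 := map_mx (pihomog mdeg k) rho.

Lemma row_pihomog_AR (d : nat) f (k : nat) rho : (0 < d)%N -> f \is d.-homog ->
  syz f rho -> AR f k (row_pihomog k rho).
Proof.
case: d => // d _ hf /syzE; rewrite /dot => h; split; last first.
  by move=> i; rewrite mxE; apply: pihomogP.
apply/syzE; rewrite /dot.
transitivity (pihomog mdeg (k + d) (\sum_(i < 3) rho 0 i * grad f 0 i)); last first.
  by rewrite h raddf0.
rewrite raddf_sum; apply: eq_bigr => i _ /=.
by rewrite pihomogM ?mxE //; apply: mderiv_homog.
Qed.

(** A common prime factor could be divided out, leaving a nonzero syzygy of degree below the least
    one. *)
Lemma mdr_coprime (d : nat) f (r : nat) rho : (0 < d)%N -> f \is d.-homog -> is_mdr f r -> AR f r rho ->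
  rho != 0 -> coprime_family [set x | exists i, x = rho 0 i].
Proof.
move=> d0 hf [_ hmin] [rsyz rhom] r0.
apply: (coprime_family_prime (@mpoly_ufd K 3)) => p ppr h.
have [p0 pu pdiv] := ppr.
pose sig : 'rV[S]_3 := \row_i xget 0 [set c | rho 0 i = c * p].
have sigE : rho = p *: sig.
  apply/rowP => i; rewrite !mxE mulrC.
  apply: (@xgetPex _ 0 [set c | rho 0 i = c * p]); apply: h; by exists i.
clearbody sig.
have ssyz : syz f sig.
  apply/syzE; apply: (mulfI p0); rewrite mulr0 -[RHS](syzE f rho).1 // sigE.
  by rewrite /dot big_distrr; apply: eq_bigr => i _; rewrite [in RHS]mxE -mulrA.
(* Instead of proving [sig] homogeneous, all its components below degree [r] are shown to vanish;
   its entries have no others. *)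
have sk k : (k < r)%N -> row_pihomog k sig = 0.
  by move=> kr; apply: (hmin k kr); exact: (row_pihomog_AR k d0 hf ssyz).
case/eqP: r0; rewrite sigE; apply/rowP => i; rewrite !mxE.
apply/eqP; rewrite mulf_eq0 (negPf p0) /=; apply/negPn/negP => si.
have := mpoly_nonunit_size p0 pu; have := msizeM p0 si.
have : rho 0 i = p * sig 0 i by rewrite sigE mxE.
move=> e; have ri : rho 0 i != 0 by rewrite e mulf_neq0.
rewrite -e; have hsz : msize (rho 0 i) = r.+1.
  have := rhom i => /= hr.
  have := dhomog_uniq ri hr (dhomog_msize hr).
  have := @mmeasure_poly_eq0 _ _ mdeg (rho 0 i); rewrite (negPf ri).
  by case: (msize _) => //= a _ ->.
rewrite hsz => h1 h2; case/eqP: si.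
have hs : (msize (sig 0%R i) <= r)%N by move: h1 h2; move: (msize _) (msize _) => x y; lia.
rewrite (pihomog_partitionE hs) big1 // => k _.
by have /(congr1 (fun A : 'rV[S]_3 => A 0 i)) := sk k (ltn_ord k); rewrite !mxE.
Qed.

End Gradient.

Lemma row_neq0_entry (D : nmodType) n (a : 'rV[D]_n) : a != 0 -> exists i, a 0 i != 0.
Proof.
move=> a0; apply: contrapT => na; case/eqP: a0; apply/rowP => i; rewrite [RHS]mxE.
by apply/eqP/negPn/negP => ai; apply: na; exists i.
Qed.

Lemma row_scaleI (D : idomainType) n (a : 'rV[D]_n) (w w' : D) :
  a != 0 -> w *: a = w' *: a -> w = w'.
Proof.
move=> /row_neq0_entry[i ai] /(congr1 (fun A : 'rV[D]_n => A 0 i)).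
by rewrite !mxE => /(mulIf ai).
Qed.

Lemma triple_cross_delta (D : idomainType) (a g : 'rV[D]_3) i :
  cross a (cross (delta_mx 0 i) g) = dot a g *: delta_mx 0 i - a 0 i *: g.
Proof.
apply/rowP => j; rewrite dotE.
by case: (ord3P i) => ->; case: (ord3P j) => ->; rewrite !crossE !mxE /=; ring.
Qed.

Section Bourbaki.
Variables (K : numClosedFieldType).
Local Notation S := {mpoly K[3]}.
Variables (d : nat) (f : S).
Hypotheses (d_gt0 : (0 < d)%N) (f_homog : f \is d.-homog) (f_neq0 : f != 0).
Hypothesis f_reduced : reduced_equation f.
Implicit Types (a b m rho : 'rV[S]_3) (w h : S).

Let g := grad f.
Let g_neq0 : g != 0 := grad_neq0 d_gt0 f_homog f_neq0.

Lemma grad_homog i : g 0 i \is d.-1.-homog.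
Proof. by rewrite mxE; case: d d_gt0 f_homog => // e _ hf; apply: mderiv_homog. Qed.

Lemma syz0 : syz f 0.
Proof. by apply/syzE; rewrite dotE !mxE !mul0r !addr0. Qed.

Lemma syzD a b : syz f a -> syz f b -> syz f (a + b).
Proof.
move=> /syzE ha /syzE hb; apply/syzE; rewrite -[RHS]addr0 -{1}ha -hb !dotE !mxE.
by ring.
Qed.

Lemma syzZ h a : syz f a -> syz f (h *: a).
Proof.
move=> /syzE ha; apply/syzE; rewrite -[RHS](mulr0 h) -ha !dotE !mxE.
by ring.
Qed.

Lemma syzN a : syz f a -> syz f (- a).
Proof. by rewrite -scaleN1r; apply: syzZ. Qed.

Lemma syzB a b : syz f a -> syz f b -> syz f (a - b).
Proof. by move=> ha hb; apply: syzD => //; apply: syzN. Qed.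

(* By Cramer's rule the cross product of two syzygies is a multiple of the
   gradient; [wedge a b] is the factor. *)
Definition wedge a b : S := xget 0 [set w | cross a b = w *: g].

Lemma wedge_spec a b : syz f a -> syz f b -> cross a b = wedge a b *: g.
Proof.
move=> /syzE ha /syzE hb.
apply: (@xgetPex _ 0 [set w | cross a b = w *: g]).
apply: (parallel_multiple g_neq0 (grad_coprime d_gt0 f_homog f_neq0 f_reduced)).
exact: cross_orthogonal.
Qed.

Lemma wedge_uniq a b w : cross a b = w *: g -> wedge a b = w.
Proof.
move=> e; apply: (row_scaleI g_neq0); rewrite -e; symmetry.
by apply: (@xgetPex _ 0 [set w | cross a b = w *: g]); exists w.
Qed.

Lemma wedgeDr a b c : syz f a -> syz f b -> syz f c ->
  wedge a (b + c) = wedge a b + wedge a c.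
Proof.
move=> ha hb hc; apply: wedge_uniq; rewrite scalerDl -!wedge_spec //.
by apply/rowP; apply: forall_ord3; rewrite [RHS]mxE !crossE !mxE; ring.
Qed.

Lemma wedgeZr h a b : syz f a -> syz f b -> wedge a (h *: b) = h * wedge a b.
Proof.
move=> ha hb; apply: wedge_uniq; rewrite -scalerA -!wedge_spec //.
by apply/rowP; apply: forall_ord3; rewrite [RHS]mxE !crossE !mxE; ring.
Qed.

Lemma wedgeC a b : syz f a -> syz f b -> wedge a b = - wedge b a.
Proof.
move=> ha hb; apply: wedge_uniq; rewrite scaleNr -!wedge_spec //.
by apply/rowP; apply: forall_ord3; rewrite [RHS]mxE !crossE; ring.
Qed.

Lemma wedge_aa a : wedge a a = 0.
Proof.
apply: wedge_uniq; rewrite scale0r.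
by apply/rowP; apply: forall_ord3; rewrite [RHS]mxE !crossE; ring.
Qed.

Lemma wedge_cramer m a b : syz f m -> syz f a -> syz f b ->
  wedge a b *: m = wedge m b *: a + wedge a m *: b.
Proof.
move=> hm ha hb; apply: (@cross_cramer _ m a b g) => //; try exact: wedge_spec.
exact/syzE.
Qed.

Lemma wedge_homog (j k : nat) a b : AR f j a -> AR f k b ->
  exists N, wedge a b \is N.-homog.
Proof.
move=> [ha sa] [hb sb]; have e := wedge_spec ha hb.
have [i gi] := row_neq0_entry g_neq0.
have hc : wedge a b * g 0 i \is (j + k).-homog.
  have -> : wedge a b * g 0 i = cross a b 0 i by rewrite e [RHS]mxE.
  have sM p q : a 0 p * b 0 q \is (j + k).-homog.
    by apply: dhomogM; [exact: (sa p) | exact: (sb q)].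
  by case: (ord3P i) => ->; rewrite crossE; apply: rpredB.
have [lt|le] := ltnP (j + k) d.-1.
  exists 0%N; rewrite (dhomog_div_lt gi (grad_homog i) hc lt); exact: rpred0.
exists (j + k - d.-1)%N; apply: (dhomog_div gi (grad_homog i)).
by rewrite subnK.
Qed.

Definition koszul (i : 'I_3) : 'rV[S]_3 := cross (delta_mx 0 i) g.

Lemma koszul_syz i : syz f (koszul i).
Proof. by apply/syzE; rewrite !dotE !crossE -/g; ring. Qed.

Lemma koszul_AR i : AR f d.-1 (koszul i).
Proof.
split=> [|j]; first exact: koszul_syz.
have h p q l : (delta_mx 0 i : 'rV[S]_3) p q * g 0 l \is d.-1.-homog.
  rewrite mxE; case: andP => _ /=; last by rewrite mul0r; apply: rpred0.
  rewrite mul1r; exact: grad_homog.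
by rewrite /S_ /koszul; case: (ord3P j) => ->; rewrite crossE; apply: rpredB; exact: h.
Qed.

(** By the triple product formula, a x (e_i x g) = (a.g) e_i - a_i g. So [v_] sends a Koszul syzygy
    to a constant multiple of an entry of [rho1]. *)
Lemma wedge_koszul a i : syz f a -> wedge a (koszul i) = - a 0 i.
Proof.
move=> /syzE ha; apply: wedge_uniq.
by rewrite /koszul triple_cross_delta ha scale0r sub0r scaleNr.
Qed.

End Bourbaki.

Lemma cross0_parallel (D : idomainType) (a b : 'rV[D]_3) : cross a b = 0 ->
  forall i j, b 0 i * a 0 j = b 0 j * a 0 i.
Proof.
move=> c0 i j; apply/eqP; rewrite -subr_eq0; apply/eqP.
suff [s [k ->]] : exists s k, b 0 i * a 0 j - b 0 j * a 0 i = s * cross a b 0 k.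
  by rewrite c0 mxE mulr0.
case: (ord3P i) => ->; case: (ord3P j) => ->.
- by exists 0, 0; rewrite subrr mul0r.
- by exists (-1), 2%:R; rewrite crossE; ring.
- by exists 1, 1; rewrite crossE; ring.
- by exists 1, 2%:R; rewrite crossE; ring.
- by exists 0, 0; rewrite subrr mul0r.
- by exists (-1), 0; rewrite crossE; ring.
- by exists (-1), 1; rewrite crossE; ring.
- by exists 1, 0; rewrite crossE; ring.
- by exists 0, 0; rewrite subrr mul0r.
Qed.

Lemma S_0 (K : fieldType) k : @S_ K k 0.
Proof. by case: k => k //=; apply: rpred0. Qed.

Lemma S_mul (K : fieldType) j k (p q : {mpoly K[3]}) :
  S_ j p -> S_ k q -> S_ (j + k) (p * q).
Proof.
case: j => j; last by move=> ->; rewrite mul0r => _; apply: S_0.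
case: k => k; last by move=> _ ->; rewrite mulr0; apply: S_0.
exact: dhomogM.
Qed.

Section BourbakiIdeal.
Variables (K : numClosedFieldType).
Local Notation S := {mpoly K[3]}.
Variables (d r : nat) (f : S).
Hypotheses (d_gt0 : (0 < d)%N) (f_homog : f \is d.-homog) (f_neq0 : f != 0).
Hypothesis f_reduced : reduced_equation f.
Hypothesis f_mdr : is_mdr f r.
Variable rho1 : 'rV[S]_3.
Hypotheses (rho1_AR : AR f r rho1) (rho1_neq0 : rho1 != 0).
Implicit Types (a b m rho : 'rV[S]_3) (w h : S).

Local Notation v := (v_ f rho1).
Local Notation B := (B_ f rho1).

Let rho1_syz : syz f rho1. Proof. by case: rho1_AR. Qed.

Lemma Delta_dot rho : Delta rho1 rho = dot (\row_(j < 3) 'X_j) (cross rho1 rho).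
Proof. by rewrite /Delta det3 dotE !crossE. Qed.

Lemma Delta_dot_r rho : Delta rho1 rho = dot rho (cross (\row_(j < 3) 'X_j) rho1).
Proof. by rewrite Delta_dot dot_cross_cyc dot_cross_cyc. Qed.

Lemma Delta_wedge rho : syz f rho ->
  Delta rho1 rho = d%:R * wedge f rho1 rho * f.
Proof.
move=> hr; rewrite Delta_dot (wedge_spec d_gt0 f_homog) //.
rewrite -mulrA mulrCA -(dot_X_grad f_homog) /dot big_distrr /=.
by apply: eq_bigr => i _; rewrite [X in _ * X]mxE mulrCA.
Qed.

Lemma v_uniq rho h : Delta rho1 rho = h * f -> v rho = h.
Proof.
move=> e; apply: (mulIf f_neq0); rewrite -e; symmetry.
by apply: (@xgetPex _ 0 [set h : S | Delta rho1 rho = h * f]); exists h.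
Qed.

Lemma v_wedge rho : syz f rho -> v rho = d%:R * wedge f rho1 rho.
Proof. by move=> hr; apply: v_uniq; apply: Delta_wedge. Qed.

Lemma v_spec rho : syz f rho -> Delta rho1 rho = v rho * f.
Proof. by move=> hr; rewrite v_wedge // Delta_wedge. Qed.

Lemma vD a b : syz f a -> syz f b -> v (a + b) = v a + v b.
Proof.
move=> ha hb; apply: v_uniq; transitivity (Delta rho1 a + Delta rho1 b); last first.
  by rewrite (v_spec ha) (v_spec hb) -mulrDl.
rewrite !Delta_dot_r -big_split /=.
by apply: eq_bigr => i _; rewrite [X in X * _]mxE mulrDl.
Qed.

Lemma vZ h a : syz f a -> v (h *: a) = h * v a.
Proof.
move=> ha; apply: v_uniq; rewrite -mulrA -(v_spec ha) !Delta_dot_r /dot big_distrr /=.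
by apply: eq_bigr => i _; rewrite [X in X * _]mxE mulrA.
Qed.

Lemma v0 : v 0 = 0.
Proof. by have := vZ 0 (syz0 f); rewrite scale0r mul0r. Qed.

Lemma vN a : syz f a -> v (- a) = - v a.
Proof. by move=> ha; rewrite -scaleN1r vZ // mulN1r. Qed.

Lemma vB a b : syz f a -> syz f b -> v (a - b) = v a - v b.
Proof. by move=> ha hb; rewrite vD ?vN //; apply: syzN. Qed.

Lemma v_rho1 : v rho1 = 0.
Proof. by rewrite v_wedge // (wedge_aa d_gt0 f_homog f_neq0) mulr0. Qed.

Lemma rho1_coprime : coprime_family [set x | exists i, x = rho1 0 i].
Proof. exact: (mdr_coprime d_gt0 f_homog f_mdr rho1_AR rho1_neq0). Qed.

Lemma v_eq0 rho : syz f rho -> v rho = 0 -> exists h, rho = h *: rho1.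
Proof.
move=> hr /eqP; rewrite v_wedge // mulf_eq0 (negPf (mpoly_natr_neq0 _ _ d_gt0)) /= => /eqP w0.
apply: (parallel_multiple rho1_neq0 rho1_coprime) => i j.
have := wedge_spec d_gt0 f_homog f_neq0 f_reduced rho1_syz hr; rewrite w0 scale0r.
move=> c0; exact: cross0_parallel.
Qed.

Lemma B_ideal : is_ideal B.
Proof.
split.
- by exists 0; [exact: syz0 | exact: v0].
- move=> _ _ [a ha <-] [b hb <-]; exists (a + b); [exact: syzD | exact: vD].
- move=> h _ [b hb <-]; exists (h *: b); [exact: syzZ | exact: vZ].
Qed.

Lemma B_unitM h (c : nat) : (0 < c)%N -> B (c%:R * h) -> B h.
Proof.
move=> c0 Bh; have [_ _ /(_ (c%:R)^-1 _ Bh)] := B_ideal.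
by rewrite mulKr // mpoly_natr_unit.
Qed.

Lemma B_rho1 i : B (rho1 0 i).
Proof.
apply: (B_unitM d_gt0); exists (- koszul f i); first exact/syzN/koszul_syz.
rewrite vN ?v_wedge; [|exact: koszul_syz..].
by rewrite (wedge_koszul d_gt0 f_homog) // mulrN opprK.
Qed.

Lemma B_coprime : coprime_family B.
Proof.
by apply: coprime_familyS rho1_coprime => _ [i ->]; apply: B_rho1.
Qed.

Lemma Delta_coef_homog i :
  cross (\row_(j < 3) 'X_j) rho1 0 i \is r.+1.-homog.
Proof.
have h p q : ((\row_(j < 3) 'X_j) : 'rV[S]_3) 0 p * rho1 0 q \is r.+1.-homog.
  rewrite -(add1n r) mxE; apply: dhomogM; [exact: dhomogXi | by case: rho1_AR => _; apply].
by case: (ord3P i) => ->; rewrite crossE; apply: rpredB; apply: h.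
Qed.

Lemma Delta_pihomog k rho :
  Delta rho1 (row_pihomog k rho) = pihomog mdeg (k + r.+1) (Delta rho1 rho).
Proof.
rewrite !Delta_dot_r raddf_sum; apply: eq_bigr => i _ /=.
by rewrite [X in X * _]mxE pihomogM //; apply: Delta_coef_homog.
Qed.

Lemma Delta_pihomog_lt k rho : (k < r.+1)%N -> pihomog mdeg k (Delta rho1 rho) = 0.
Proof.
move=> kr; rewrite !Delta_dot_r raddf_sum; apply: big1 => i _ /=.
by rewrite (pihomogM_lt _ (Delta_coef_homog i)).
Qed.

(** [Delta] raises degrees by [r.+1] and division by [f] lowers them by [d]. The equation between
    sums avoids truncated subtraction. *)
Lemma v_pihomog k e rho : syz f rho -> (k + r.+1 = e + d)%N ->
  v (row_pihomog k rho) = pihomog mdeg e (v rho).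
Proof.
move=> hr ke; apply: v_uniq; rewrite Delta_pihomog ke v_spec //.
exact: pihomogM.
Qed.

Lemma v_pihomog_lt e rho : syz f rho -> (e + d < r.+1)%N -> pihomog mdeg e (v rho) = 0.
Proof.
move=> hr er; apply: (mulIf f_neq0); rewrite mul0r -(pihomogM _ _ f_homog) -v_spec //.
exact: Delta_pihomog_lt.
Qed.

Lemma row_pihomog_id k rho : (forall i, rho 0 i \is k.-homog) -> row_pihomog k rho = rho.
Proof. by move=> h; apply/rowP => i; rewrite mxE pihomog_dE. Qed.

Lemma row_pihomog_syz k rho : syz f rho -> syz f (row_pihomog k rho).
Proof. by move=> hr; case: (row_pihomog_AR k d_gt0 f_homog hr). Qed.

Lemma v_homog k e rho : AR f (k : nat) rho -> (k + r.+1 = e + d)%N -> v rho \is e.-homog.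
Proof.
move=> [hr hk] ke; rewrite -(row_pihomog_id hk) (v_pihomog hr ke).
exact: pihomogP.
Qed.

Lemma v_homog_lt (k : nat) rho : AR f k rho -> (k + r.+1 < d)%N -> v rho = 0.
Proof.
move=> [hr hk] kd; have hD : v rho * f \is (k + r.+1).-homog.
  by rewrite -v_spec // -(row_pihomog_id hk) Delta_pihomog; apply: pihomogP.
exact: dhomog_div_lt f_neq0 f_homog hD kd.
Qed.

Lemma B_homog_lift (k e : nat) z : B z -> z \is e.-homog -> (k + r.+1 = e + d)%N ->
  exists2 rho, AR f k rho & v rho = z.
Proof.
move=> [rho hr <-] hz ke; exists (row_pihomog k rho); first exact: (row_pihomog_AR k d_gt0 f_homog hr).
by rewrite (v_pihomog hr ke) pihomog_dE.
Qed.

Lemma B_homog_lt (e : nat) z : B z -> z \is e.-homog -> (e + d < r.+1)%N -> z = 0.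
Proof.
by move=> [rho hr <-] hz /(v_pihomog_lt hr); rewrite pihomog_dE.
Qed.

Lemma B_homogeneous : homogeneous_ideal B.
Proof.
split=> [|_ e [rho hr <-]]; first exact: B_ideal.
have [lt|le] := ltnP (e + d) r.+1.
  by rewrite v_pihomog_lt //; case: B_ideal.
exists (row_pihomog (e + d - r.+1) rho); first exact: row_pihomog_syz.
by apply: v_pihomog => //; rewrite subnK.
Qed.

Lemma bourbaki_exact : graded_short_exact
    (gshift (@S_ K) (- r%:Z) : grading S^o) (AR f)
    (gshift (graded_part B) (r%:Z - d%:Z + 1) : grading S^o)
    (u_ rho1) v.
Proof.
have [rs rh] := rho1_AR; split.
- split.
  + move=> k x; rewrite /gshift => hx; split; first exact: syzZ.
    move=> i; rewrite /u_ mxE; have -> : k = - r%:Z + k + r%:Z by lia.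
    exact: S_mul.
  + by move=> k x y _ _; rewrite /u_ scalerDl.
  + by move=> j k h x _ _; rewrite /u_ scalerA.
- split.
  + move=> k x; rewrite /gshift => -[hs hk]; split; first by exists x.
    case: k hk => k hk; last first.
      have -> : x = 0 by apply/rowP => i; rewrite mxE; exact: hk.
      by rewrite v0; apply: S_0.
    have [lt|le] := ltnP (k + r.+1) d; first by rewrite (v_homog_lt (conj hs hk) lt); apply: S_0.
    have -> : r%:Z - d%:Z + 1 + k%:Z = (k + r.+1 - d)%N%:Z by lia.
    by apply: (@v_homog k) => //; rewrite subnK.
  + by move=> k x y [hx _] [hy _]; apply: vD.
  + by move=> j k h x _ [hx _]; apply: vZ.
- by move=> k x _ e; apply: (row_scaleI rho1_neq0); rewrite scale0r; exact: e.
- move=> k y [hy hk]; split=> [/(v_eq0 hy)[h e]|[h hh <-]]; last first.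
    by rewrite /u_ vZ // v_rho1 mulr0.
  (* Zero is treated apart: it is homogeneous of every degree [k], even below [r], where the source
     is zero. *)
  have [y0|y0] := eqVneq y 0.
    by exists 0; rewrite /gshift /u_ ?scale0r //; apply: S_0.
  exists h; last by rewrite /u_ e.
  case: k hk => k hk; last first.
    by case/eqP: y0; apply/rowP => i; rewrite mxE; exact: hk.
  have [lt|le] := ltnP k r.
    case/eqP: y0; exact: (f_mdr.2 k lt y (conj hy hk)).
  rewrite /gshift; have -> : - r%:Z + k%:Z = (k - r)%N%:Z by lia.
  have [i ri] := row_neq0_entry rho1_neq0.
  apply: (dhomog_div ri (rh i)); rewrite subnK //.
  by have := hk i; rewrite e mxE.
- move=> k z [Bz]; rewrite /gshift => hz.
  have [[e [ke ze]]|->] : (exists e : nat, r%:Z - d%:Z + 1 + k = e%:Z /\ z \is e.-homog) \/ z = 0.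
    by case: (r%:Z - d%:Z + 1 + k) hz => e he; [left; exists e | right].
  (* If [k] is negative, an element of [B] in the corresponding degree [e] is zero and is lifted by
     zero. *)
  case: k ke {hz} => k ke.
    by apply: (B_homog_lift Bz ze); lia.
  have z0 : z = 0 by apply: (B_homog_lt Bz ze); lia.
  exists 0; last by rewrite v0.
  by split=> [|i]; [exact: syz0 | rewrite mxE; exact: S_0].
  exists 0; last by rewrite v0.
  by split=> [|i]; [exact: syz0 | rewrite mxE; exact: S_0].
Qed.

End BourbakiIdeal.

(** * Saturation *)

Section Substitution.
Variable K : fieldType.
Local Notation S := {mpoly K[3]}.

Lemma divides_ideal (D : idomainType) (t : D) : is_ideal (divides t).
Proof.
by split=> [|a b ha hb|a b]; [exact: divides0 | exact: divides_add | exact: divides_mull].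
Qed.

Lemma subst_congr (I : set S) (u : 'I_3 -> S) (G : S) : is_ideal I ->
  (forall j, I ('X_j - u j)) -> I (G - (G \mPo [tuple u j | j < 3])).
Proof.
by move=> hI hu; rewrite -{1}[G]comp_mpoly_id; apply: comp_congr.
Qed.

Lemma subst_eq0 (I : set S) (u : 'I_3 -> S) (G : S) : is_ideal I ->
  (forall j, I ('X_j - u j)) -> G \mPo [tuple u j | j < 3] = 0 -> I G.
Proof. by move=> hI hu e; have := subst_congr G hI hu; rewrite e subr0. Qed.

Lemma subst_X (u : 'I_3 -> S) j : 'X_j \mPo [tuple u j | j < 3] = u j.
Proof. by rewrite comp_mpolyXU -tnth_nth tnth_mktuple. Qed.

(* Modulo t the substitution is the identity, so that its kernel is generated by t. *)
Lemma subst_prime (t : S) (u : 'I_3 -> S) a b :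
  (forall j, divides t ('X_j - u j)) -> t \mPo [tuple u j | j < 3] = 0 ->
  divides t (a * b) -> divides t a \/ divides t b.
Proof.
move=> hu ht [c /(congr1 (comp_mpoly [tuple u j | j < 3]))].
rewrite !rmorphM /= ht mulr0 => /eqP; rewrite mulf_eq0.
by case/orP => /eqP e; [left | right]; apply: (subst_eq0 (divides_ideal t) hu e).
Qed.

Lemma mpolyX_neq0 n (m : 'X_{1..n}) : ('X_[m] : {mpoly K[n]}) != 0.
Proof. by rewrite -msize_poly_eq0 msizeX. Qed.

Lemma X_prime (i : 'I_3) (a b : S) :
  divides 'X_i (a * b) -> divides 'X_i a \/ divides 'X_i b.
Proof.
apply: (@subst_prime _ (fun j => if j == i then 0 else 'X_j)) => [j|].
  by case: eqP => [->|_]; rewrite ?subr0 ?subrr; [exact: divides_refl | exact: divides0].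
by rewrite subst_X eqxx.
Qed.

Lemma X_ndivides_X (i j : 'I_3) : j != i -> ~ divides ('X_i : S) 'X_j.
Proof.
move=> ji [c] /(congr1 (comp_mpoly [tuple if k == i then 0 else 'X_k : S | k < 3])).
rewrite rmorphM /= !subst_X eqxx (negPf ji) mulr0 => /eqP.
by rewrite (negPf (mpolyX_neq0 _)).
Qed.

(** ['X_2%:R] is regular modulo the ideal of ['X_0] and ['X_1], which is the kernel of the
    substitution annihilating these two variables. *)
Lemma X_ideal_colon (a b c : S) : 'X_2%:R * c + 'X_0 * a + 'X_1 * b = 0 ->
  exists p q, c = 'X_1 * p - 'X_0 * q.
Proof.
move=> e; pose u (j : 'I_3) : S := if j == 2%:R then 'X_2%:R else 0.
have : c \mPo [tuple u j | j < 3] = 0.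
  move/(congr1 (comp_mpoly [tuple u j | j < 3])): e.
  rewrite !rmorphD !rmorphM /= !subst_X /u /= !mul0r !addr0 comp_mpoly0 => /eqP.
  by rewrite mulf_eq0 (negPf (mpolyX_neq0 _)) => /eqP.
pose I := [set x : S | exists p q, x = 'X_1 * p - 'X_0 * q].
apply: (@subst_eq0 I).
  split=> [|x y [p [q ->]] [p' [q' ->]]|x y [p [q ->]]].
  - by exists 0, 0; rewrite !mulr0 subrr.
  - by exists (p + p'), (q + q'); ring.
  - by exists (x * p), (x * q); ring.
apply: forall_ord3; rewrite /u /=.
- by exists 0, (-1); ring.
- by exists 1, 0; ring.
- by exists 0, 0; ring.
Qed.

End Substitution.

Lemma scale_sub_swap (A : comNzRingType) (V : lmodType A) (x y p q : A) (a b c : V) :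
  x *: a - y *: b = (x * p - y * q) *: c -> x *: (a - p *: c) = y *: (b - q *: c).
Proof.
move=> e; apply/eqP; rewrite -subr_eq0 !scalerBr !scalerA.
have -> : x *: a - (x * p) *: c - (y *: b - (y * q) *: c) =
  (x *: a - y *: b) - ((x * p) *: c - (y * q) *: c).
  by rewrite opprB [in RHS]opprB addrACA [RHS]addrACA; congr (_ + _); rewrite addrC.
by rewrite e scalerBl subrr.
Qed.

Lemma dotZ (D : idomainType) (h : D) (a b : 'rV[D]_3) : dot (h *: a) b = h * dot a b.
Proof. by rewrite /dot big_distrr; apply: eq_bigr => i _; rewrite [in LHS]mxE -mulrA. Qed.

Lemma syz_scale_inv (K : numClosedFieldType) (f p : {mpoly K[3]}) (a : 'rV_3) :
  p != 0 -> syz f (p *: a) -> syz f a.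
Proof.
move=> p0 /syzE; rewrite dotZ => /eqP; rewrite mulf_eq0 (negPf p0) => /eqP e.
exact/syzE.
Qed.

Section Saturation.
Variables (K : numClosedFieldType).
Local Notation S := {mpoly K[3]}.
Variables (d r : nat) (f : S).
Hypotheses (d_gt0 : (0 < d)%N) (f_homog : f \is d.-homog) (f_neq0 : f != 0).
Hypothesis f_reduced : reduced_equation f.
Hypothesis f_mdr : is_mdr f r.
Variable rho1 : 'rV[S]_3.
Hypotheses (rho1_AR : AR f r rho1) (rho1_neq0 : rho1 != 0).
Implicit Types (a b m rho : 'rV[S]_3) (w h : S).

Local Notation v := (v_ f rho1).
Local Notation B := (B_ f rho1).

Let rho1_syz : syz f rho1. Proof. by case: rho1_AR. Qed.

Lemma B_saturated_step g : (forall i : 'I_3, B ('X_i * g)) -> B g.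
Proof.
move=> h; have [a0 s0 e0] := h 0; have [a1 s1 e1] := h 1; have [a2 s2 e2] := h 2%:R.
have vZ' := vZ d_gt0 f_homog f_neq0 f_reduced rho1_AR.
have vB' := vB d_gt0 f_homog f_neq0 f_reduced rho1_AR.
have ker := v_eq0 d_gt0 f_homog f_neq0 f_reduced f_mdr rho1_AR rho1_neq0.
have comm i j (ai aj : 'rV[S]_3) : syz f ai -> syz f aj -> v ai = 'X_i * g -> v aj = 'X_j * g ->
    exists c, 'X_j *: ai - 'X_i *: aj = c *: rho1.
  move=> si sj ei ej; apply: ker; first by apply: syzB; apply: syzZ.
  by rewrite vB' ?vZ' ?ei ?ej //; [ring | exact: syzZ | exact: syzZ].
have [c ec] := comm _ _ _ _ s0 s1 e0 e1.
have [a ea] := comm _ _ _ _ s1 s2 e1 e2.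
have [b eb] := comm _ _ _ _ s2 s0 e2 e0.
(* In the sum of the three relations with coefficients ['X_2%:R], ['X_0], ['X_1] the lifts [a0],
   [a1], [a2] cancel, leaving a linear relation between the variables. *)
have [p [q cE]] : exists p q, c = 'X_1 * p - 'X_0 * q.
  apply: (@X_ideal_colon _ a b); apply: (row_scaleI rho1_neq0).
  rewrite scale0r !scalerDl -!scalerA -ec -ea -eb.
  by apply/rowP => j; rewrite !mxE; ring.
pose a0' := a0 - p *: rho1; pose a1' := a1 - q *: rho1.
have s0' : syz f a0' by apply: syzB => //; apply: syzZ.
have e' : 'X_1 *: a0' = 'X_0 *: a1'.
  by apply: scale_sub_swap; rewrite ec cE.
(* Two corrected lifts are enough: since ['X_1 *: a0' = 'X_0 *: a1'], the quotient of [a0'] by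
   ['X_0] exists, and it is the preimage of [g]. *)
have X0a i : divides 'X_0 (a0' 0 i).
  have X0a1 : divides ('X_0 : S) ('X_1 * a0' 0 i).
    exists (a1' 0 i); move/(congr1 (fun A : 'rV[S]_3 => A 0 i)): e'.
    by rewrite [LHS]mxE [RHS]mxE mulrC [RHS]mulrC.
  have [X01|//] := X_prime X0a1.
  by case: (X_ndivides_X (isT : 1 != 0 :> 'I_3) X01).
pose gam : 'rV[S]_3 := \row_i xget 0 [set x | a0' 0 i = x * 'X_0].
have gE : a0' = 'X_0 *: gam.
  apply/rowP => i; rewrite [RHS]mxE [in RHS]mxE mulrC.
  exact: (@xgetPex _ 0 [set x | a0' 0 i = x * 'X_0] (X0a i)).
have X0n := mpolyX_neq0 K U_(0 : 'I_3).
have sg : syz f gam.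
  by apply: (syz_scale_inv X0n); rewrite -gE.
have va0' : v a0' = 'X_0 * g.
  rewrite (vB' _ _ s0 (syzZ p rho1_syz)) e0 (vZ' _ _ rho1_syz).
  by rewrite (v_rho1 d_gt0 f_homog f_neq0 f_reduced rho1_AR) mulr0 subr0.
exists gam; first exact: sg.
by apply: (mulfI X0n); rewrite -(vZ' _ _ sg) -gE.
Qed.

Lemma B_saturated : saturated B.
Proof.
move=> g [n]; elim: n g => [|n IH] g h.
  by rewrite -[g]mul1r; apply: h; apply: dhomog1.
apply: IH => x hx; apply: B_saturated_step => i; rewrite mulrA; apply: h.
by rewrite -(add1n n); apply: dhomogM => //; apply: dhomogXi.
Qed.

End Saturation.

(** * Ideals with finitely many zeros *)

Section Elimination.
Variable K : numClosedFieldType.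

Lemma ord2P (i j : 'I_2) : i != j -> forall k, k = i \/ k = j.
Proof.
case: i j => [[|[|//]] hi] [[|[|//]] hj] // _ [[|[|//]] hk];
  by [left; apply: val_inj | right; apply: val_inj].
Qed.

Lemma minor_form_divides N (A : {mpoly K[2]}) (p : 'rV[K]_2) (i j : 'I_2) :
  i != j -> p 0 i != 0 -> A \is N.-homog -> A.@[p 0] = 0 ->
  divides (minor_form p i j) A.
Proof.
move=> ij pi hA A0; have := @point_congr K 2 p i N A _ (divides_ideal (minor_form p i j)).
move=> h; have {h} [|c ec] := h _ hA; last first.
  exists ((p 0 i ^+ N)^-1 *: c).
  by rewrite -scalerAl -ec A0 scale0r subr0 scalerA mulVf ?scale1r // expf_neq0.
by move=> k ki; case: (ord2P ij k) => e; [rewrite e eqxx in ki | rewrite e; exact: divides_refl].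
Qed.

Lemma form2_zero N (A : {mpoly K[2]}) : A \is N.+1.-homog ->
  exists2 p : 'rV[K]_2, p != 0 & A.@[p 0] = 0.
Proof.
move=> hA; pose e10 : 'rV[K]_2 := delta_mx 0 0.
have [A10|A10] := eqVneq A.@[e10 0] 0.
  exists e10 => //; apply/eqP => /rowP/(_ 0); rewrite !mxE => /eqP.
  by rewrite oner_eq0.
(* [P] is [A(t, 1)]. Its coefficient of index [N.+1] is [A(1, 0)], which is nonzero here, so [P] is
   not constant and has a root. *)
pose h (j : 'I_2) : {poly K} := if j == 0 then 'X else 1.
pose P := mmap (@polyC K) h A.
have o2 (F : 'I_2 -> nat) : (\sum_i F i = F 0%R + F 1%R)%N.
  by rewrite !big_ord_recr big_ord0 /= add0n; congr (F _ + F _)%N; apply: val_inj.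
have p2 (E : comNzRingType) (F : 'I_2 -> E) : \prod_i F i = F 0 * F 1.
  by rewrite !big_ord_recr big_ord0 /= mul1r; congr (F _ * F _); apply: val_inj.
have PE : P`_N.+1 = A.@[e10 0].
  rewrite /P mevalE /mmap coef_sum !big_seq; apply: eq_bigr => m mA.
  have := dhomog_mdeg hA mA; rewrite mdegE o2 => dm.
  rewrite coefCM /mmap1 !p2 /h /e10 !mxE /= !expr1n mulr1 mul1r coefXn expr0n.
  by congr (_ * _%:R); lia.
have [t /rootP Pt] : exists t, root P t.
  apply/closed_rootP; apply: contraNneq A10 => s1; rewrite -PE.
  by rewrite nth_default // s1.
have Pev : P.[t] = A.@[fun j => if j == 0 then t else 1].
  have := @mpoly_rmorph_eq K 2 _ (horner_eval t \o mmap (@polyC K) h)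
    (meval (fun j => if j == 0 then t else 1)).
  apply=> [c|i] /=; rewrite /horner_eval.
    by rewrite mmapC hornerC mevalC.
  by rewrite mmapX mmap1U mevalXU /h; case: eqP => _; rewrite ?hornerX ?hornerC.
exists (\row_j if j == 0 then t else 1).
  by apply/eqP => /rowP/(_ 1); rewrite !mxE /= => /eqP; rewrite oner_eq0.
by rewrite -Pt Pev; apply: meval_eq => j; rewrite mxE.
Qed.

Lemma form2_split N (A : {mpoly K[2]}) : A \is N.-homog -> A != 0 ->
  exists (c : K) (s : seq 'rV[K]_2), [/\ c != 0, {in s, forall l, l != 0} &
    A = c%:MP * \prod_(l <- s) (\sum_j l 0 j *: 'X_j)].
Proof.
elim: N A => [|N IH] A hA A0.
  have /msize_poly1P[c c0 ->] : msize A == 1%N.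
    have := dhomog_uniq A0 hA (dhomog_msize hA).
    have := @mmeasure_poly_eq0 _ _ mdeg A; rewrite (negPf A0).
    by case: (msize A) => [|[|k]].
  by exists c, [::]; rewrite big_nil mulr1.
have [p p0 Ap] := form2_zero hA.
have [i pi] := row_neq0_entry p0.
have [j ij] : exists j : 'I_2, i != j.
  by case: (i =P 0) => [->|/eqP i0]; [exists 1 | exists 0].
have [B eB] := minor_form_divides ij pi hA Ap.
have t0 : minor_form p i j != 0 by apply: contraNneq A0 => e; rewrite eB e mulr0.
have B0 : B != 0 by apply: contraNneq A0 => e; rewrite eB e mul0r.
have hB : B \is N.-homog.
  by apply: (dhomog_div t0 (minor_form_homog p i j)); rewrite addn1 -eB.
have [c [s [c0 hs eBs]]] := IH B hB B0.
pose l : 'rV[K]_2 := p 0 i *: delta_mx 0 j - p 0 j *: delta_mx 0 i.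
have el : \sum_k l 0 k *: 'X_k = minor_form p i j.
  rewrite (bigD1 i) //= (bigD1 j) ?(eq_sym j) //= big1 ?addr0 => [|k /andP[ki kj]].
    rewrite !mxE !eqxx (negPf ij) eq_sym (negPf ij) /=.
    by rewrite ?(mulr0, mulr1, sub0r, subr0) scaleNr addrC.
  by case: (ord2P ij k) => e; rewrite e eqxx in ki kj.
exists c, (l :: s); split=> //.
  move=> l'; rewrite inE => /orP[/eqP ->|]; last exact: hs.
  apply: contraNneq t0 => l0; rewrite -el l0 big1 // => k _.
  by rewrite mxE scale0r.
by rewrite big_cons el eB eBs; ring.
Qed.

Lemma lift_var_homog n (k : 'I_n.+1) N (p : {mpoly K[n]}) :
  p \is N.-homog -> lift_var k p \is N.-homog.
Proof.
move=> hp; rewrite [p]mpolyE rmorph_sum big_seq; apply: rpred_sum => m mp.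
rewrite -mul_mpolyC rmorphM /= lift_varC mul_mpolyC dhomogZ //.
rewrite -(dhomog_mdeg hp mp) mpolyXE_id rmorph_prod /= mdegE.
elim/big_rec2: _ => [|i x y _ hy]; first exact: dhomog1.
by rewrite rmorphXn /= lift_varX; apply: dhomogM => //; apply: dhomogXn.
Qed.

Lemma pihomog_lift_var n (k : 'I_n.+1) N (p : {mpoly K[n]}) :
  pihomog mdeg N (lift_var k p) = lift_var k (pihomog mdeg N p).
Proof.
have hm := leq_maxl (msize p) N.+1; have Nm : (N < maxn (msize p) N.+1)%N by rewrite leq_maxr.
rewrite {1}(pihomog_partitionE hm) (rmorph_sum (lift_var k)) linear_sum (bigD1 (Ordinal Nm)) //=.
rewrite big1 ?addr0 => [|j jN].
  by apply: pihomog_dE; apply: lift_var_homog; apply: pihomogP.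
apply: (@pihomog_ne0 _ _ _ j); first by rewrite -val_eqE /= in jN.
by apply: lift_var_homog; apply: pihomogP.
Qed.

Lemma mul_gcdp_ideal (D : idomainType) (I : set {poly D}) p q : is_ideal I ->
  I p -> I q -> exists2 c, c != 0 & I (c%:P * gcdp p q).
Proof.
move=> [I0 ID IM] Ip Iq.
have [u /eqpP[[c1 c2] /andP[/= c10 c20] e]] := Bezoutp p q.
exists c2 => //; rewrite mul_polyC -e -mul_polyC; apply: (IM).
by apply: ID; apply: IM.
Qed.

(** As polynomials in the variable of index [k], the [w i] have a gcd over the fraction field, and
    by Bezout a multiple of it by a nonzero polynomial in the two other variables lies in [I].
    Coprimality forces this gcd to have degree 0. *)
Lemma coprime_eliminate (I : set {mpoly K[3]}) (w : 'I_3 -> {mpoly K[3]}) k :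
  is_ideal I -> (forall i, I (w i)) -> coprime_family [set x | exists i, x = w i] ->
  exists2 c : {mpoly K[2]}, c != 0 & I (lift_var k c).
Proof.
move=> hI Iw wcop; have [I0 ID IM] := hI.
pose J : set {poly {mpoly K[2]}} := [set q | I (join_var k q)].
have hJ : is_ideal J.
  split; rewrite /J /=.
  - by rewrite rmorph0.
  - by move=> a b; rewrite rmorphD; apply: ID.
  - by move=> a b; rewrite rmorphM; apply: IM.
pose p i := split_var k (w i).
have Jp i : J (p i) by rewrite /J /= split_varK.
have [c1 c10 J1] := mul_gcdp_ideal hJ (Jp 0) (Jp 1).
set g1 := _ * _ in J1.
have [c2 c20 J2] := mul_gcdp_ideal hJ J1 (Jp 2%:R).
set g := gcdp g1 _ in J2.
have gdiv i : g %| p i.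
  have gg1 : g %| gcdp (p 0) (p 1).
    by apply: dvdp_trans (dvdp_gcdl _ _) _; rewrite /g1 mul_polyC dvdpZl.
  case: (ord3P i) => ->; last exact: dvdp_gcdr.
  - by apply: dvdp_trans gg1 _; apply: dvdp_gcdl.
  - by apply: dvdp_trans gg1 _; apply: dvdp_gcdr.
have g0 : g != 0.
  apply/negP => /eqP g0; have w0 i : w i = 0.
    have := gdiv i; rewrite g0 dvd0p => /eqP /(congr1 (join_var k)).
    by rewrite split_varK rmorph0.
  have [|c] := wcop 'X_0 1 (mpolyX_neq0 _ _).
    by move=> b [i ->]; rewrite w0 mulr0; apply: divides0.
  move/(congr1 (meval (fun _ => 0))); rewrite meval1 mevalM mevalXU mulr0 => /eqP.
  by rewrite oner_eq0.
have sg : (size g <= 1)%N.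
  have ex i : exists (c : {mpoly K[2]}) u, c != 0 /\ c%:P * p i = u * g.
    have /Pdiv.Idomain.dvdpP[[c u] /= c0 e] := gdiv i.
    by exists c, u; rewrite mul_polyC.
  have [a0 [u0 [a00 e0]]] := ex 0; have [a1 [u1 [a10 e1]]] := ex 1.
  have [a2 [u2 [a20 e2]]] := ex 2%:R.
  pose a := a0 * a1 * a2; have a_neq0 : a != 0 by rewrite !mulf_neq0.
  (* [a] clears the denominators of the three quotients of [p i] by [g], so [g] divides every
     [a * w i] and, by coprimality, [a] itself, which does not involve the variable of index [k]. *)
  have : divides (join_var k g) (lift_var k a).
    apply: wcop; first by rewrite -(rmorph0 (join_var k)) (can_eq (join_varK k)).
    move=> b [i ->]; rewrite -[w i](split_varK k) -join_varC -rmorphM.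
    suff [x ex'] : exists x, a%:P * p i = x * g.
      by rewrite -/(p i) ex'; exists (join_var k x); rewrite rmorphM.
    rewrite /a !polyCM; case: (ord3P i) => ->.
    - by exists (a1%:P * a2%:P * u0); rewrite -[RHS]mulrA -e0; ring.
    - by exists (a0%:P * a2%:P * u1); rewrite -[RHS]mulrA -e1; ring.
    - by exists (a0%:P * a1%:P * u2); rewrite -[RHS]mulrA -e2; ring.
  move=> [x] /(congr1 (split_var k)); rewrite split_lift (rmorphM (split_var k)) /= join_varK => e.
  have x0 : split_var k x != 0.
    by apply: contraNneq a_neq0 => x0; rewrite -polyC_eq0 e x0 mul0r.
  have := size_mul x0 g0; rewrite -e size_polyC a_neq0.
  by have := size_poly_gt0 (split_var k x); rewrite x0; move: (size _) (size _) => y z; lia.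
have [x ex] : exists x, g = x%:P by exists g`_0; apply: size1_polyC.
exists (c2 * x).
  by rewrite mulf_neq0 //; apply: contraNneq g0 => x0; rewrite ex x0.
by move: J2; rewrite /J /= ex -polyCM join_varC.
Qed.

Definition linear_form (l : 'rV[K]_3) : {mpoly K[3]} := \sum_j l 0 j *: 'X_j.

(* For a homogeneous ideal I this says, by elimination theory, that the zero set
   of I in the projective plane is finite. *)
Definition eliminable (I : set {mpoly K[3]}) := forall k : 'I_3,
  exists s : seq 'rV[K]_3, (forall l, l \in s -> l != 0 /\ l 0 k = 0) /\
    I (\prod_(l <- s) linear_form l).

(** A nonzero component of the eliminant is a form in the two other variables; over an algebraically
    closed field it splits into linear forms. *)
Lemma coprime_eliminable (I : set {mpoly K[3]}) (w : 'I_3 -> {mpoly K[3]}) :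
  homogeneous_ideal I -> (forall i, I (w i)) ->
  coprime_family [set x | exists i, x = w i] -> eliminable I.
Proof.
move=> [hI Ih] Iw wcop k; have [c c0 Ic] := coprime_eliminate k hI Iw wcop.
have [N cN] : exists N, pihomog mdeg N c != 0.
  apply: contrapT => h; case/eqP: c0; apply: pihomog_eq0 => N.
  by apply/eqP/negPn/negP => cN; apply: h; exists N.
have [a [s [a0 hs e]]] := form2_split (pihomogP mdeg N c) cN.
pose L (l : 'rV[K]_2) : 'rV[K]_3 := \row_j if unlift k j is Some i then l 0 i else 0.
exists (map L s); split.
  move=> _ /mapP[l ls ->]; split; last by rewrite mxE unlift_none.
  have [i li] := row_neq0_entry (hs l ls).
  by apply/eqP => /rowP/(_ (lift k i)); rewrite !mxE liftK => /eqP; apply/negP.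
have [I0 ID IM] := hI.
have -> : \prod_(l <- map L s) linear_form l = (a^-1)%:MP * lift_var k (pihomog mdeg N c).
  rewrite e rmorphM /= lift_varC mulrA -mpolyCM mulVf // mul1r rmorph_prod big_map.
  apply: eq_bigr => l _ /=; rewrite /linear_form (bigD1_ord k) //= mxE unlift_none scale0r add0r.
  rewrite rmorph_sum; apply: eq_bigr => j _ /=.
  by rewrite mxE liftK -!mul_mpolyC rmorphM /= lift_varC lift_varX.
by apply: IM; rewrite -pihomog_lift_var; apply: Ih.
Qed.

End Elimination.

(** * A projective Nullstellensatz for ideals with finitely many zeros *)

Section Nullstellensatz.
Variable K : numClosedFieldType.
Local Notation S := {mpoly K[3]}.
Implicit Types (I : set S) (p l : 'rV[K]_3).

(** For an ideal: its radical contains the irrelevant ideal. *)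
Definition pow_in I := exists n, forall j : 'I_3, I ('X_j ^+ n).

Definition ideal_adj I (a : S) : set S := [set x | exists y z, I y /\ x = y + z * a].

Lemma ideal_adj_ideal I a : is_ideal I -> is_ideal (ideal_adj I a).
Proof.
move=> [I0 ID IM]; split.
- by exists 0, 0; rewrite mul0r addr0.
- move=> _ _ [y [z [Iy ->]]] [y' [z' [Iy' ->]]]; exists (y + y'), (z + z').
  by split; [exact: ID | ring].
- move=> x _ [y [z [Iy ->]]]; exists (x * y), (x * z).
  by split; [exact: IM | ring].
Qed.

Lemma sub_ideal_adj I a : I `<=` ideal_adj I a.
Proof. by move=> x Ix; exists x, 0; rewrite mul0r addr0. Qed.

Lemma ideal_adj_mem I a : is_ideal I -> ideal_adj I a a.
Proof. by move=> [I0 _ _]; exists 0, 1; rewrite add0r mul1r. Qed.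

Lemma pow_in_mul I a b : is_ideal I -> pow_in (ideal_adj I a) ->
  pow_in (ideal_adj I b) -> pow_in (ideal_adj I (a * b)).
Proof.
move=> [I0 ID IM] [n hn] [m hm]; exists (n + m)%N => j; rewrite exprD.
have [y [z [Iy ->]]] := hn j; have [y' [z' [Iy' ->]]] := hm j.
exists (y * (y' + z' * b) + (z * a) * y'), (z * z'); split; last by ring.
by apply: ID; [rewrite mulrC|]; apply: IM.
Qed.

Lemma pow_in_prod I (s : seq S) : is_ideal I ->
  (forall a, a \in s -> pow_in (ideal_adj I a)) -> pow_in (ideal_adj I (\prod_(a <- s) a)).
Proof.
move=> hI; elim: s => [|a s IH] h.
  by rewrite big_nil; exists 0%N => j; rewrite expr0; apply: ideal_adj_mem.
rewrite big_cons; apply: pow_in_mul => //; first by apply: h; rewrite mem_head.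
by apply: IH => b bs; apply: h; rewrite inE bs orbT.
Qed.

Lemma not_pow_in_factor I (s : seq S) : is_ideal I -> I (\prod_(a <- s) a) ->
  ~ pow_in I -> exists2 a, a \in s & ~ pow_in (ideal_adj I a).
Proof.
move=> hI Is nI; apply: contrapT => h; apply: nI.
have [n hn] : pow_in (ideal_adj I (\prod_(a <- s) a)).
  apply: pow_in_prod => // a as_; apply: contrapT => na; apply: h; by exists a.
case: hI => I0 ID IM.
by exists n => j; have [y [z [Iy ->]]] := hn j; apply: ID => //; apply: IM.
Qed.

(** If all three were parallel, their common direction would have three zero coordinates. *)
Lemma independent_pair (l0 l1 l2 : 'rV[K]_3) :
  l0 != 0 -> l1 != 0 -> l2 != 0 -> l0 0 0 = 0 -> l1 0 1 = 0 -> l2 0 2%:R = 0 ->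
  [\/ cross l0 l1 != 0, cross l0 l2 != 0 | cross l1 l2 != 0].
Proof.
move=> n0 n1 n2 z0 z1 z2.
have [c01|] := eqVneq (cross l0 l1) 0; last by constructor 1.
have [c02|] := eqVneq (cross l0 l2) 0; last by constructor 2.
exfalso.
have e01 i : cross l0 l1 0 i = 0 by rewrite c01 mxE.
have e02 i : cross l0 l2 0 i = 0 by rewrite c02 mxE.
have := e01 0; have := e01 2%:R; have := e02 0; have := e02 1.
rewrite !crossE z0 z1 z2 !(mul0r, mulr0, sub0r, subr0).
move=> /eqP h4 /eqP; rewrite oppr_eq0 => h3 /eqP; rewrite oppr_eq0 => h2 /eqP h1.
have l01 : l0 0 1 = 0.
  apply/eqP/negPn/negP => l01; case/eqP: n1; apply/rowP; apply: forall_ord3.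
  - by move: h2; rewrite mulf_eq0 (negPf l01) mxE => /eqP.
  - by rewrite z1 mxE.
  - by move: h1; rewrite mulf_eq0 (negPf l01) mxE => /eqP.
have l02 : l0 0 2%:R != 0.
  apply/negP => /eqP l02; case/eqP: n0.
  by apply/rowP; apply: forall_ord3; rewrite mxE.
case/eqP: n2; apply/rowP; apply: forall_ord3; rewrite [RHS]mxE //.
- by move: h4; rewrite mulf_eq0 (negPf l02) => /eqP.
- by move: h3; rewrite mulf_eq0 (negPf l02) => /eqP.
Qed.

Lemma linear_formD (l l' : 'rV[K]_3) (a b : K) :
  linear_form (a *: l + b *: l') = a *: linear_form l + b *: linear_form l'.
Proof.
rewrite /linear_form !scaler_sumr -big_split /=; apply: eq_bigr => j _.
by rewrite !mxE scalerDl !scalerA.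
Qed.

Lemma linear_form_delta (j : 'I_3) : linear_form (delta_mx 0 j : 'rV[K]_3) = 'X_j.
Proof.
rewrite /linear_form (bigD1 j) //= big1 ?addr0 ?mxE ?eqxx ?scale1r // => i ij.
by rewrite mxE (negPf ij) andbF scale0r.
Qed.

Lemma minor_form_linear (p : 'rV[K]_3) i j :
  minor_form p i j = linear_form (p 0 i *: delta_mx 0 j - p 0 j *: delta_mx 0 i).
Proof. by rewrite -scaleNr linear_formD !linear_form_delta scaleNr. Qed.

(** For distinct [i], [j] the left side is, up to sign, the product of the third unit vector with
    [cross l l'], so this is the triple product formula. *)
Lemma minor_form_cross (l l' : 'rV[K]_3) i j : exists a b,
  cross l l' 0 i *: delta_mx 0 j - cross l l' 0 j *: delta_mx 0 i = a *: l + b *: l' :> 'rV[K]_3.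
Proof.
move: (cross0E l l') (cross1E l l') (cross2E l l'); move: (cross l l') => c e0 e1 e2.
have [->|ij] := eqVneq i j; first by exists 0, 0; rewrite !scale0r subrr addr0.
case: (ord3P i) (ord3P j) ij => -> [] -> // _.
- exists (l' 0 2%:R), (- l 0 2%:R); apply/rowP; apply: forall_ord3; rewrite !mxE ?e0 ?e1 ?e2 /=; ring.
- exists (- l' 0 1), (l 0 1); apply/rowP; apply: forall_ord3; rewrite !mxE ?e0 ?e1 ?e2 /=; ring.
- exists (- l' 0 2%:R), (l 0 2%:R); apply/rowP; apply: forall_ord3; rewrite !mxE ?e0 ?e1 ?e2 /=; ring.
- exists (l' 0 0), (- l 0 0); apply/rowP; apply: forall_ord3; rewrite !mxE ?e0 ?e1 ?e2 /=; ring.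
- exists (l' 0 1), (- l 0 1); apply/rowP; apply: forall_ord3; rewrite !mxE ?e0 ?e1 ?e2 /=; ring.
- exists (- l' 0 0), (l 0 0); apply/rowP; apply: forall_ord3; rewrite !mxE ?e0 ?e1 ?e2 /=; ring.
Qed.

Lemma point_of_linear_forms I (l : 'I_3 -> 'rV[K]_3) : is_ideal I ->
  (forall k, l k != 0 /\ l k 0 k = 0) -> (forall k, I (linear_form (l k))) ->
  exists2 p, p != 0 & forall i j, I (minor_form p i j).
Proof.
move=> [I0 ID IM] hl Il.
have ex k k' : cross (l k) (l k') != 0 ->
    exists2 p, p != 0 & forall i j, I (minor_form p i j).
  move=> c0; exists (cross (l k) (l k')) => // i j; rewrite minor_form_linear.
  have [a [b ->]] := minor_form_cross (l k) (l k') i j.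
  by rewrite linear_formD -!mul_mpolyC; apply: ID; apply: IM.
have [n0 z0] := hl 0; have [n1 z1] := hl 1; have [n2 z2] := hl 2%:R.
by case: (independent_pair n0 n1 n2 z0 z1 z2); apply: ex.
Qed.

Lemma point_ideal_pow I p i N (g : S) : is_ideal I ->
  (forall j k, I (minor_form p j k)) -> p 0 i != 0 ->
  g \is N.-homog -> I g -> g.@[p 0] != 0 -> forall j, I ('X_j ^+ N).
Proof.
move=> hI hp pi hg Ig gp; have [I0 ID IM] := hI.
have IZ (c : K) x : I x -> I (c *: x) by move=> Ix; rewrite -mul_mpolyC; apply: IM.
have IB x y : I x -> I y -> I (x - y).
  by move=> Ix Iy; apply: ID => //; rewrite -mulN1r; apply: IM.
have IX : I ('X_i ^+ N).
  have := point_congr hI (fun j _ => hp i j) hg => h.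
  have := IB _ _ (IZ (p 0 i ^+ N) _ Ig) h; rewrite opprB addrCA subrr addr0.
  by move/(IZ (g.@[p 0])^-1); rewrite scalerA mulVf // scale1r.
move=> j; have := point_congr hI (fun j _ => hp i j) (dhomogXn K j N) => h.
have := ID _ _ h (IZ ('X_j ^+ N).@[p 0] _ IX); rewrite subrK.
by move/(IZ (p 0 i ^+ N)^-1); rewrite scalerA mulVf ?scale1r // expf_neq0.
Qed.

Lemma eliminable_sub I J : I `<=` J -> eliminable I -> eliminable J.
Proof. by move=> IJ h k; have [s [hs Is]] := h k; exists s; split=> //; apply: IJ. Qed.

(** If [pow_in I] fails, a linear factor of each of the three eliminants can be adjoined in turn so
    that it still fails. The three factors cut out a point, and a form of [I] that does not vanish
    there gives a contradiction. *)
Lemma nullstellensatz I : is_ideal I -> eliminable I ->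
  (forall p, p != 0 -> exists N (g : S), [/\ g \is N.-homog, I g & g.@[p 0] != 0]) ->
  pow_in I.
Proof.
move=> hI eI hp; apply: contrapT => nI.
have step J k : is_ideal J -> eliminable J -> ~ pow_in J ->
    exists2 l : 'rV[K]_3, l != 0 /\ l 0 k = 0 & ~ pow_in (ideal_adj J (linear_form l)).
  move=> hJ eJ nJ; have [s [hs Js]] := eJ k.
  have [|a /mapP[l ls ->] na] := @not_pow_in_factor J (map (@linear_form K) s) hJ _ nJ.
    by rewrite big_map.
  by exists l => //; apply: hs.
have [l0 h0 n0] := step _ 0 hI eI nI; set I0 := ideal_adj _ _ in n0.
have hI0 : is_ideal I0 by apply: ideal_adj_ideal.
have s0 : I `<=` I0 by apply: sub_ideal_adj.
have [l1 h1 n1] := step _ 1 hI0 (eliminable_sub s0 eI) n0; set I1 := ideal_adj _ _ in n1.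
have hI1 : is_ideal I1 by apply: ideal_adj_ideal.
have s1 : I0 `<=` I1 by apply: sub_ideal_adj.
have e1 : eliminable I1 by apply: eliminable_sub s1 (eliminable_sub s0 eI).
have [l2 h2 n2] := step _ 2%:R hI1 e1 n1; set I2 := ideal_adj _ _ in n2.
have hI2 : is_ideal I2 by apply: ideal_adj_ideal.
have s2 : I1 `<=` I2 by apply: sub_ideal_adj.
have [||p p0 Ip] := @point_of_linear_forms I2
    (fun k => tnth [tuple l0; l1; l2] k) hI2.
- by apply: forall_ord3.
- apply: forall_ord3; [apply/s2/s1 | apply/s2 |]; exact: ideal_adj_mem.
have [i pi] := row_neq0_entry p0; have [N [g [hg Ig gp]]] := hp p p0.
apply: n2; exists N; apply: (point_ideal_pow hI2 Ip pi hg) => //.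
exact/s2/s1/s0.
Qed.

Lemma pow_in_forms I : is_ideal I -> pow_in I ->
  exists n, forall N (h : S), (n <= N)%N -> h \is N.-homog -> I h.
Proof.
move=> [I0 ID IM] [n hn]; exists (3 * n)%N => N h nN hh.
rewrite [h]mpolyE big_seq; elim/big_ind: _ => // m mh.
have dm := dhomog_mdeg hh mh.
(* Three exponents whose sum is at least [3 * n] cannot all be below [n]. *)
have [j mj] : exists j : 'I_3, (n <= m j)%N.
  apply: contrapT => nj; have lt j : (m j < n)%N.
    by rewrite ltnNge; apply/negP => ?; apply: nj; exists j.
  have := lt 0; have := lt 1; have := lt 2%:R; move: dm; rewrite mdegE sum3.
  by move: (m 0) (m 1) (m 2%:R) => x y z; rewrite /GRing.add /=; lia.
rewrite -mul_mpolyC; apply: (IM).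
have -> : m = (m - U_(j) *+ n + U_(j) *+ n)%MM.
  rewrite submK //; apply/mnm_lepP => k; rewrite mulmnE mnm1E.
  by case: eqP => [<-|_]; rewrite ?mul1n ?mul0n.
by rewrite mpolyXD -mpolyXn; apply: (IM).
Qed.

Lemma prime_ideal_prod (D : idomainType) (P : set D) (s : seq D) :
  prime_ideal P -> P (\prod_(a <- s) a) -> exists2 a, a \in s & P a.
Proof.
move=> [_ P1 PM]; elim: s => [|a s IH]; first by rewrite big_nil.
rewrite big_cons => /PM[Pa|/IH[b bs Pb]]; first by exists a; rewrite ?mem_head.
by exists b; rewrite // inE bs orbT.
Qed.

(** [P] contains a linear factor of each eliminant, and these factors meet in a point. Here [P] is
    an arbitrary prime, possibly the irrelevant ideal. *)
Lemma prime_over_eliminable I P : eliminable I -> prime_ideal P -> I `<=` P ->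
  exists2 p, p != 0 & forall i j, P (minor_form p i j).
Proof.
move=> eI hP IP; have ex k : exists l : 'rV[K]_3, (l != 0 /\ l 0 k = 0) /\ P (linear_form l).
  have [s [hs Is]] := eI k.
  have [||a /mapP[l ls ->] Pa] := @prime_ideal_prod _ P (map (@linear_form K) s) => //.
    by rewrite big_map; apply: IP.
  by exists l; split=> //; apply: hs.
have [l hl] := choice ex.
by apply: (@point_of_linear_forms P l); [case: hP | move=> k; case: (hl k)..].
Qed.

Lemma prime_exp (D : idomainType) (P : set D) a n : prime_ideal P -> P (a ^+ n) -> P a.
Proof.
move=> [_ P1 PM]; elim: n => [|n IH]; first by rewrite expr0.
by rewrite exprS => /PM[].
Qed.

Lemma prime_point_notin P p N (h : S) i : prime_ideal P -> ~ P 'X_i ->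
  p != 0 -> (forall j k, P (minor_form p j k)) ->
  h \is N.-homog -> h.@[p 0] != 0 -> ~ P h.
Proof.
move=> hP nP p0 Pp hh hp Ph; have [k pk] := row_neq0_entry p0; apply: nP.
have [hPi _ _] := hP.
by apply: (prime_exp hP); apply: (point_ideal_pow hPi Pp pk hh).
Qed.

End Nullstellensatz.

(** * Forms near a point *)

Section AtPoint.
Variable K : numClosedFieldType.
Local Notation S := {mpoly K[3]}.
Implicit Types (p : 'rV[K]_3) (g h : S).

Lemma ord3_other (i j : 'I_3) : exists k, k != i /\ k != j.
Proof.
case: (ord3P i) => ->; case: (ord3P j) => ->;
  by first [by exists 0 | by exists 1 | by exists 2%:R].
Qed.

Lemma minor_form_prime p i j a b : p 0 i != 0 -> j != i ->
  divides (minor_form p i j) (a * b) -> divides (minor_form p i j) a \/ divides (minor_form p i j) b.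
Proof.
move=> pi ji; apply: (@subst_prime _ _ (fun k => if k == j then (p 0 j / p 0 i) *: 'X_i else 'X_k)).
  move=> k; case: eqP => [->|_]; last by rewrite subrr; apply: divides0.
  exists (p 0 i)^-1%:MP; rewrite mul_mpolyC /minor_form scalerBr !scalerA mulVf //.
  by rewrite scale1r mulrC.
rewrite /minor_form comp_mpolyB !comp_mpolyZ !subst_X eqxx eq_sym (negPf ji).
by rewrite scalerA mulrCA divff // mulr1 subrr.
Qed.

Lemma meval_divides p h g : h.@[p 0] = 0 -> divides h g -> g.@[p 0] = 0.
Proof. by move=> h0 [c ->]; rewrite mevalM h0 mulr0. Qed.

Lemma minor_form_ndivides p i j k : p 0 i != 0 -> j != i -> k != i -> k != j ->
  ~ divides (minor_form p i j) (minor_form p i k).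
Proof.
move=> pi ji ki kj h; case/eqP: pi.
have := @meval_divides (delta_mx 0 k) _ _ _ h.
rewrite /minor_form !mevalB !mevalZ !mevalXU !mxE /= eqxx.
rewrite (eq_sym j) (eq_sym i) (negPf ki) (negPf kj) !mulr0 !subr0 mulr1.
by apply.
Qed.

(** The two minors generate the ideal of the point. Taking components makes [b] homogeneous, which
    feeds the induction of [contact_order]. *)
Lemma meval0_split p i j k N g : p 0 i != 0 -> j != i -> k != i -> k != j ->
  g \is N.+1.-homog -> g.@[p 0] = 0 ->
  exists a b, [/\ g = minor_form p i j * a + minor_form p i k * b & b \is N.-homog].
Proof.
move=> pi ji ki kj hg g0; set t := minor_form p i j; set s := minor_form p i k.
pose I := [set x : S | exists a b, x = t * a + s * b].
have hI : is_ideal I.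
  split=> [|_ _ [a [b ->]] [a' [b' ->]]|x _ [a [b ->]]].
  - by exists 0, 0; rewrite !mulr0 addr0.
  - by exists (a + a'), (b + b'); ring.
  - by exists (x * a), (x * b); ring.
have [] := @point_congr K 3 p i N.+1 g I hI _ hg.
  move=> l li; have [->|lj] := eqVneq l j; first by exists 1, 0; rewrite mulr1 mulr0 addr0.
  have -> : l = k.
    by move: li lj ji ki kj; case: (ord3P l) => ->; case: (ord3P i) => ->;
       case: (ord3P j) => ->; case: (ord3P k) => ->.
  by exists 0, 1; rewrite mulr0 mulr1 add0r.
move=> a [b]; rewrite g0 scale0r subr0 => e.
pose c := (p 0 i ^+ N.+1)^-1.
exists (c *: pihomog mdeg N a), (c *: pihomog mdeg N b); split; last first.
  by rewrite dhomogZ // pihomogP.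
have -> : g = c *: (p 0 i ^+ N.+1 *: g) by rewrite scalerA mulVf ?scale1r // expf_neq0.
rewrite -!scalerAr -scalerDr; congr (_ *: _).
rewrite -(pihomog_dE (dhomogZ (p 0 i ^+ N.+1) hg)) e raddfD /= ![_ * a]mulrC ![_ * b]mulrC.
rewrite ![_ * pihomog _ _ _]mulrC -(addn1 N).
by rewrite !pihomogM //; apply: minor_form_homog.
Qed.

(* n is the order of contact at p of g with the line of equation minor_form p i j. *)
Lemma contact_order p i j k N g : p 0 i != 0 -> j != i -> k != i -> k != j ->
  g \is N.-homog -> ~ divides (minor_form p i j) g ->
  exists n M h a, [/\ g = minor_form p i k ^+ n * h + minor_form p i j * a,
     h \is M.-homog & h.@[p 0] != 0].
Proof.
move=> pi ji ki kj; elim: N g => [|N IH] g hg tg.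
  have [g0|g0] := eqVneq g.@[p 0] 0; last first.
    by exists 0%N, 0%N, g, 0; rewrite expr0 mul1r mulr0 addr0.
  case: tg; suff -> : g = 0 by apply: divides0.
  have [->//|gn] := eqVneq g 0; have e := dhomog_uniq gn hg (dhomog_msize hg).
  have : (msize g <= 1)%N by move: e; case: (msize g) => // m /= <-.
  by move/msize1_polyC => ec; rewrite ec mevalC in g0; rewrite ec g0 mpolyC0.
have [g0|g0] := eqVneq g.@[p 0] 0; last first.
  by exists 0%N, N.+1, g, 0; rewrite expr0 mul1r mulr0 addr0.
have [a [b [e hb]]] := meval0_split pi ji ki kj hg g0.
have [|n [M [h [a' [eb hh hp]]]]] := IH b hb.
  move=> tb; apply: tg; rewrite e; apply: divides_add; last exact: divides_mull.
  exact/divides_mulr/divides_refl.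
exists n.+1, M, h, (a + minor_form p i k * a'); split=> //.
by rewrite e eb exprS; ring.
Qed.

(** In the eliminant of the third variable, a factor that vanishes at [p] involves only ['X_i] and
    ['X_j], hence is a multiple of [minor_form p i j]; the other factors go into [u]. *)
Lemma eliminable_point (I : set S) p i j : eliminable I -> p 0 i != 0 -> j != i ->
  exists N u a, [/\ u \is N.-homog, u.@[p 0] != 0 & I (u * minor_form p i j ^+ a)].
Proof.
move=> eI pi ji; have [k [ki kj]] := ord3_other i j.
have [s [hs Is]] := eI k.
suff [N [u [a [hu up e]]]] : exists N u a, [/\ u \is N.-homog, u.@[p 0] != 0 &
    \prod_(l <- s) linear_form l = u * minor_form p i j ^+ a].
  by exists N, u, a; rewrite -e.
elim: s hs {Is} => [|l s IH] hs.
  exists 0%N, 1, 0%N; rewrite big_nil expr0 mulr1 meval1 oner_eq0; split=> //.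
  exact: dhomog1.
have [N [u [a [hu up e]]]] : exists N u a, [/\ u \is N.-homog, u.@[p 0] != 0 &
    \prod_(l <- s) linear_form l = u * minor_form p i j ^+ a].
  by apply: IH => l' ls; apply: hs; rewrite inE ls orbT.
have [l0 lk] := hs l (mem_head _ _).
have le : linear_form l = l 0 i *: 'X_i + l 0 j *: 'X_j.
  rewrite /linear_form (bigD1 i) //= (bigD1 j) //= big1 ?addr0 // => m /andP[mi mj].
  have -> : m = k.
    by move: mi mj ji ki kj; case: (ord3P m) => ->; case: (ord3P i) => ->;
       case: (ord3P j) => ->; case: (ord3P k) => ->.
  by rewrite lk scale0r.
rewrite big_cons e; have [lp|lp] := eqVneq (linear_form l).@[p 0] 0; last first.
  exists (1 + N)%N, (linear_form l * u), a; rewrite mulrA mevalM mulf_neq0 //; split=> //.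
  by apply: dhomogM => //; rewrite le rpredD // dhomogZ // dhomogXi.
have lij : l 0 i = - (l 0 j / p 0 i * p 0 j).
  apply: (mulIf pi); apply/eqP; rewrite -subr_eq0 mulNr opprK mulrAC divfK //.
  by rewrite -lp le mevalD !mevalZ !mevalXU.
have lE : linear_form l = (l 0 j / p 0 i)%:MP * minor_form p i j.
  rewrite le mul_mpolyC /minor_form scalerBr !scalerA divfK // addrC lij scaleNr.
  by [].
exists N, ((l 0 j / p 0 i)%:MP * u), a.+1; split.
- by rewrite mul_mpolyC dhomogZ.
- rewrite mevalM mevalC mulf_neq0 // mulf_neq0 ?invr_eq0 //.
  apply: contraNneq l0 => lj; apply/eqP/rowP => m; rewrite mxE.
  have [->|mi] := eqVneq m i; first by rewrite lij lj !mul0r oppr0.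
  have [->//|mj] := eqVneq m j.
  have -> : m = k.
    by move: mi mj ji ki kj; case: (ord3P m) => ->; case: (ord3P i) => ->;
       case: (ord3P j) => ->; case: (ord3P k) => ->.
  by rewrite lk.
- by rewrite lE exprS; ring.
Qed.

End AtPoint.

(** * Local complete intersections *)

Lemma delta_cross (D : idomainType) (g : 'rV[D]_3) :
  [/\ cross (delta_mx 0 1) g 0 2%:R = - g 0 0, cross (delta_mx 0 2%:R) g 0 0 = - g 0 1
    & cross (delta_mx 0 0) g 0 1 = - g 0 2%:R].
Proof. by split; rewrite crossE !mxE /=; ring. Qed.

Lemma ideal2 (D : idomainType) (s t : D) : is_ideal [set x | exists b c, x = s * b + t * c].
Proof.
split=> [|_ _ [b [c ->]] [b' [c' ->]]|x _ [b [c ->]]].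
- by exists 0, 0; rewrite !mulr0 addr0.
- by exists (b + b'), (c + c'); ring.
- by exists (x * b), (x * c); ring.
Qed.

Lemma row_combination_split (D : idomainType) (m m1 m2 : 'rV[D]_3) (s h t a b c b' c' : D) :
  (s * h + t * a) *: m = (s * b + t * c) *: m1 + (s * b' + t * c') *: m2 ->
  s *: (h *: m - b *: m1 - b' *: m2) = t *: (c *: m1 + c' *: m2 - a *: m).
Proof.
move=> e; apply/rowP => l; move/(congr1 (fun A : 'rV[D]_3 => A 0 l)): e; rewrite !mxE.
move=> e; apply/eqP; rewrite -subr_eq0; apply/eqP.
transitivity ((s * h + t * a) * m 0 l - ((s * b + t * c) * m1 0 l + (s * b' + t * c') * m2 0 l)).
  by ring.
by rewrite e subrr.
Qed.

Section LocallyFree.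
Variables (K : numClosedFieldType).
Local Notation S := {mpoly K[3]}.
Variables (d : nat) (f : S).
Hypotheses (d_gt0 : (0 < d)%N) (f_homog : f \is d.-homog) (f_neq0 : f != 0).
Hypothesis f_reduced : reduced_equation f.
Implicit Types (m : 'rV[S]_3).

Definition jac : set S := [set x | exists c : 'rV[S]_3, x = dot c (grad f)].

Lemma jac_ideal : is_ideal jac.
Proof.
split.
- by exists 0; rewrite dotE !mxE !mul0r !addr0.
- by move=> _ _ [a ->] [b ->]; exists (a + b); rewrite !dotE !mxE; ring.
- by move=> x _ [a ->]; exists (x *: a); rewrite dotZ.
Qed.

Lemma jac_grad i : jac (grad f 0 i).
Proof.
exists (delta_mx 0 i); rewrite /dot (bigD1 i) //= big1 ?addr0.
  by rewrite [X in X * _]mxE !eqxx mul1r.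
by move=> j ji; rewrite [X in X * _]mxE (negPf ji) mul0r.
Qed.

Lemma jac_homogeneous : homogeneous_ideal jac.
Proof.
split=> [|_ e [c ->]]; first exact: jac_ideal.
rewrite raddf_sum /=; have [J0 JD JM] := jac_ideal.
elim/big_ind: _ => // i _; have hg := grad_homog d_gt0 f_homog i.
have [le|lt] := leqP d.-1 e; last by rewrite (pihomogM_lt _ hg).
by rewrite -(subnK le) pihomogM //; apply: JM; apply: jac_grad.
Qed.

Lemma jac_eliminable : eliminable jac.
Proof.
apply: (@coprime_eliminable _ _ (grad f 0)); first exact: jac_homogeneous.
  exact: jac_grad.
exact: grad_coprime d_gt0 f_homog f_neq0 f_reduced.
Qed.

Lemma syz_ind (P : 'rV[S]_3 -> Prop) :
  P 0 -> (forall a b, syz f a -> syz f b -> P a -> P b -> P (a + b)) ->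
  (forall (k : nat) a, AR f k a -> P a) -> forall a, syz f a -> P a.
Proof.
move=> P0 PD PA a ha.
pose M := maxn (msize (a 0%R 0%R)) (maxn (msize (a 0%R 1%R)) (msize (a 0%R 2%:R))).
have hM i : (msize (a 0%R i) <= M)%N.
  by rewrite /M !leq_max; case: (ord3P i) => ->; rewrite leqnn ?orbT.
have -> : a = \sum_(k < M) row_pihomog k a.
  apply/rowP => i; rewrite summxE [LHS](pihomog_partitionE (hM i)).
  by apply: eq_bigr => k _; rewrite mxE.
suff : P (\sum_(k < M) row_pihomog k a) /\ syz f (\sum_(k < M) row_pihomog k a) by case.
elim/big_ind: _ => [|x y [Px sx] [Py sy]|k _].
- by split=> //; apply: syz0.
- by split; [exact: PD | exact: syzD].
- have h := row_pihomog_AR k d_gt0 f_homog ha.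
  by split; [apply: PA h | case: h].
Qed.

Local Notation wedge := (wedge f).

Let wD := wedgeDr d_gt0 f_homog f_neq0 f_reduced.
Let wZ := wedgeZr d_gt0 f_homog f_neq0 f_reduced.
Let wC := wedgeC d_gt0 f_homog f_neq0 f_reduced.

Let wDl a b c : syz f a -> syz f b -> syz f c -> wedge (a + b) c = wedge a c + wedge b c.
Proof.
by move=> ha hb hc; rewrite wC ?wD ?(wC ha) ?(wC hb) ?opprD //; apply: syzD.
Qed.

Let wZl h a b : syz f a -> syz f b -> wedge (h *: a) b = h * wedge a b.
Proof.
by move=> ha hb; rewrite wC ?wZ ?(wC ha) ?mulrN //; apply: syzZ.
Qed.

Lemma wedge_ideal (I : set S) : is_ideal I ->
  (forall (j k : nat) m n, AR f j m -> AR f k n -> I (wedge m n)) ->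
  forall m n, syz f m -> syz f n -> I (wedge m n).
Proof.
move=> [I0 ID IM] h m n hm hn; have s0 := syz0 f.
have z a : wedge a 0 = 0.
  by apply: (wedge_uniq d_gt0 f_homog f_neq0); rewrite scale0r; apply/rowP;
     apply: forall_ord3; rewrite crossE !mxE; ring.
move: m hm; apply: syz_ind => [|a b ha hb Ia Ib|k a ha].
- by rewrite wC // z oppr0.
- by rewrite wDl //; apply: ID.
move: n hn; apply: syz_ind => [|b c hb hc Ib Ic|l b hb].
- by rewrite z.
- by have [sa _] := ha; rewrite wD //; apply: ID.
- exact: h ha hb.
Qed.

(** Places the Jacobian ideal, whose zeros are known to be finite, inside the ideal generated by all
    wedges of syzygies. *)
Lemma grad_wedge_koszul l : exists l1 l2, wedge (koszul f l1) (koszul f l2) = grad f 0 l.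
Proof.
have h l1 l2 : wedge (koszul f l1) (koszul f l2) = - koszul f l1 0 l2.
  by rewrite (wedge_koszul d_gt0 f_homog f_neq0) //; apply: koszul_syz.
have [h0 h1 h2] := delta_cross (grad f).
case: (ord3P l) => ->.
- by exists 1, 2%:R; rewrite h /koszul h0 opprK.
- by exists 2%:R, 0; rewrite h /koszul h1 opprK.
- by exists 0, 1; rewrite h /koszul h2 opprK.
Qed.

(* Near p the syzygy module is free, with basis m1, m2. *)
Lemma locally_free (p : 'rV[K]_3) : p != 0 ->
  exists (k1 k2 : nat) m1 m2 N, [/\ AR f k1 m1, AR f k2 m2,
    wedge m1 m2 \is N.-homog & (wedge m1 m2).@[p 0] != 0].
Proof.
move=> p0; have [i pi] := row_neq0_entry p0.
have [j [ji _]] := ord3_other i i; have [k [ki kj]] := ord3_other i j.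
set t := minor_form p i j; set s := minor_form p i k.
have tp : t.@[p 0] = 0 by apply: minor_form_point.
have tprime a b := @minor_form_prime K p i j a b pi ji.
have ts : ~ divides t s by apply: minor_form_ndivides.
have tsn (n : nat) : ~ divides t (s ^+ n).
  elim: n => [|n IH]; last by rewrite exprS => /tprime[].
  by move/(meval_divides tp)/eqP; rewrite expr0 meval1 oner_eq0.
have t0 : t != 0.
  apply/negP => /eqP /(congr1 (meval ((delta_mx 0 j : 'rV[K]_3) 0))).
  rewrite /t /minor_form mevalB !mevalZ !mevalXU !mxE /= eqxx (eq_sym i) (negPf ji).
  by rewrite mulr0 subr0 mulr1 meval0 => /eqP; rewrite (negPf pi).
have nt h : h.@[p 0] != 0 -> ~ divides t h.
  by move=> hp /(meval_divides tp) e; rewrite e eqxx in hp.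
(* [n] is the order of contact at [p] of the wedge with the line [t = 0]. A pair of least order is
   chosen and shown to have a wedge that does not vanish at [p]. *)
pose Q (n : nat) := exists (k1 k2 : nat) m1 m2 M h a, [/\ AR f k1 m1, AR f k2 m2,
  wedge m1 m2 = s ^+ n * h + t * a, h \is M.-homog & h.@[p 0] != 0].
have exQ : exists n, `[< Q n >].
  have [l tl] : exists l, ~ divides t (grad f 0 l).
    apply: contrapT => h; have := grad_coprime d_gt0 f_homog f_neq0 f_reduced t0.
    move=> /(_ 1)[|c e].
      by move=> b [l ->]; rewrite mul1r; apply: contrapT => hl; apply: h; exists l.
    by apply: (nt 1); [rewrite meval1 oner_eq0 | exists c].
  have [l1 [l2 e]] := grad_wedge_koszul l.
  have [k1A k2A] := (koszul_AR d_gt0 f_homog l1, koszul_AR d_gt0 f_homog l2).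
  have hl := grad_homog d_gt0 f_homog l.
  have [n [M [h [a [eh hh hp]]]]] := contact_order pi ji ki kj hl tl.
  exists n; apply/asboolP; exists d.-1, d.-1, (koszul f l1), (koszul f l2), M, h, a.
  by rewrite e.
pose n := ex_minn exQ.
have [/asboolP [k1 [k2 [m1 [m2 [M [h [a [A1 A2 ew hh hp]]]]]]]] nmin] :
    `[< Q n >] /\ forall n', `[< Q n' >] -> (n <= n')%N.
  by rewrite /n; case: ex_minnP.
have [s1 s2] : syz f m1 /\ syz f m2 by case: A1; case: A2.
set q := wedge m1 m2 in ew.
(* By minimality of [n] every wedge is a multiple of [s ^+ n] modulo [t]; homogeneous pairs suffice
   because this is an ideal condition. *)
have wst m m' : syz f m -> syz f m' -> exists b c, wedge m m' = s ^+ n * b + t * c.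
  apply: (@wedge_ideal [set x | exists b c, x = s ^+ n * b + t * c]).
    exact: ideal2.
  move=> j1 j2 x y Ax Ay; have [N hw] := wedge_homog d_gt0 f_homog f_neq0 f_reduced Ax Ay.
  have [[c ->]|tw] := pselect (divides t (wedge x y)).
    by exists 0, c; rewrite mulr0 add0r mulrC.
  have [n' [M' [h' [a' [e' hh' hp']]]]] := contact_order pi ji ki kj hw tw.
  have le : (n <= n')%N.
    by apply: nmin; apply/asboolP; exists j1, j2, x, y, M', h', a'.
  by exists (s ^+ (n' - n) * h'), a'; rewrite e' mulrA -exprD subnKC.
(* Cramer's rule read modulo [t]: the factor [s ^+ n] cancels because [t] is prime and does not
   divide [s]. So [m1] and [m2] generate modulo [t] once [h] is inverted. *)
have div m : syz f m -> exists b b' m', syz f m' /\ h *: m = b *: m1 + b' *: m2 + t *: m'.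
  move=> sm; have := wedge_cramer d_gt0 f_homog f_neq0 f_reduced sm s1 s2.
  have [b [c ->]] := wst _ _ sm s2; have [b' [c' ->]] := wst _ _ s1 sm.
  rewrite -/q ew => e; exists b, b'.
  pose x := h *: m - b *: m1 - b' *: m2.
  have ex : s ^+ n *: x = t *: (c *: m1 + c' *: m2 - a *: m).
    exact: row_combination_split.
  have tx l : divides t (x 0 l).
    have : divides t (s ^+ n * x 0 l).
      exists ((c *: m1 + c' *: m2 - a *: m) 0 l).
      by move/(congr1 (fun A : 'rV[S]_3 => A 0 l)): ex; rewrite [LHS]mxE [RHS]mxE mulrC [RHS]mulrC.
    by case/tprime => // /tsn.
  pose m' : 'rV[S]_3 := \row_l xget 0 [set y | x 0 l = y * t].
  have xE : x = t *: m'.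
    apply/rowP => l; rewrite [RHS]mxE [in RHS]mxE mulrC.
    exact: (@xgetPex _ 0 [set y | x 0 l = y * t] (tx l)).
  exists m'; split.
    apply: (syz_scale_inv t0); rewrite -xE.
    by apply: syzB; [apply: syzB|]; apply: syzZ.
  by rewrite -xE /x -[_ - _ - _]addrA -opprD [RHS]addrC subrK.
(* As in Nakayama's lemma, [div] is iterated on both arguments: each round costs a factor [h ^+ 2]
   and gains a power of [t] modulo the multiples of [q]. *)
have expand j' : forall m m', syz f m -> syz f m' ->
    exists x y, h ^+ (2 * j') * wedge m m' = x * q + t ^+ j' * y.
  elim: j' => [|j' IH] m m' sm sm'.
    by exists 0, (wedge m m'); rewrite muln0 !expr0 mul0r add0r.
  have [b [c [o [so eo]]]] := div m sm; have [b' [c' [o' [so' eo']]]] := div m' sm'.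
  have [sm1 sm1'] : syz f (b *: m1 + c *: m2) /\ syz f (b' *: m1 + c' *: m2).
    by split; apply: syzD; apply: syzZ.
  have waa a' := wedge_aa d_gt0 f_homog f_neq0 a'.
  have [shm sto'] := (syzZ h sm, syzZ t so').
  have e : h ^+ 2 * wedge m m' = (b * c' - c * b') * q +
      t * (wedge (h *: m) o' + wedge o (b' *: m1 + c' *: m2)).
    have -> : h ^+ 2 * wedge m m' = wedge (h *: m) (h *: m').
      by rewrite wZl ?wZ //; [ring | exact: syzZ].
    rewrite eo' wD // (wZ _ shm so') {1}eo (wDl sm1 (syzZ t so) sm1').
    rewrite (wZl t so sm1') (wDl (syzZ b s1) (syzZ c s2) sm1').
    rewrite (wZl b s1 sm1') (wZl c s2 sm1').
    rewrite (wD s1 (syzZ b' s1) (syzZ c' s2)) (wD s2 (syzZ b' s1) (syzZ c' s2)).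
    rewrite (wZ _ s1 s1) (wZ _ s1 s2) (wZ _ s2 s1) (wZ _ s2 s2).
    by rewrite !waa (wC s2 s1) -/q; ring.
  have [x1 [y1 E1]] := IH _ _ shm so'; have [x2 [y2 E2]] := IH _ _ so sm1'.
  exists (h ^+ (2 * j') * (b * c' - c * b') + t * (x1 + x2)), (y1 + y2).
  have -> : (2 * j'.+1 = 2 * j' + 2)%N by rewrite mulnS addnC.
  rewrite exprD -mulrA e exprS.
  transitivity (h ^+ (2 * j') * (b * c' - c * b') * q +
    t * (h ^+ (2 * j') * wedge (h *: m) o' +
         h ^+ (2 * j') * wedge o (b' *: m1 + c' *: m2))); first by ring.
  by rewrite E1 E2; ring.
have [N [u [e [hu up [c Je]]]]] := eliminable_point jac_eliminable pi ji.
(* The exponent [e.+1] is one more than the power of [t] in [Je]: after [t ^+ e] is cancelled, the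
   error term still vanishes at [p], whereas [h] and [u] do not. *)
have [x [y Ex]] : exists x y, h ^+ (2 * e.+1) * (u * t ^+ e) = x * q + t ^+ e.+1 * y.
  have ex l : exists x y, h ^+ (2 * e.+1) * grad f 0 l = x * q + t ^+ e.+1 * y.
    have [l1 [l2 <-]] := grad_wedge_koszul l.
    by apply: expand; apply: koszul_syz.
  rewrite -/t in Je; rewrite Je dotE.
  have [x0 [y0 E0]] := ex 0; have [x1 [y1 E1]] := ex 1; have [x2 [y2 E2]] := ex 2%:R.
  exists (c 0 0 * x0 + c 0 1 * x1 + c 0 2%:R * x2), (c 0 0 * y0 + c 0 1 * y1 + c 0 2%:R * y2).
  transitivity (c 0 0 * (h ^+ (2 * e.+1) * grad f 0 0) + c 0 1 * (h ^+ (2 * e.+1) * grad f 0 1)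
     + c 0 2%:R * (h ^+ (2 * e.+1) * grad f 0 2%:R)); first by ring.
  by rewrite E0 E1 E2; ring.
have tq : ~ divides t q.
  move=> tq; have : divides t (s ^+ n * h).
    have -> : s ^+ n * h = q - t * a by rewrite ew addrK.
    apply: divides_add => //; apply/divides_opp/divides_mulr/divides_refl.
  by case/tprime => [/tsn|/(nt _ hp)].
have cancel_t k' : forall z x, t ^+ k' * z = x * q -> exists x, z = x * q.
  elim: k' => [|k' IH] z x' ez; first by exists x'; rewrite -ez expr0 mul1r.
  have : divides t (x' * q) by rewrite -ez exprS -mulrA; apply/divides_mulr/divides_refl.
  case/tprime => // -[x'' ex]; apply: (IH _ x''); apply: (mulfI t0).
  by rewrite mulrA -exprS ez ex -/t; ring.
have [x' ex'] : exists x', h ^+ (2 * e.+1) * u - t * y = x' * q.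
  apply: (cancel_t e _ x); rewrite mulrBr; apply/eqP; rewrite subr_eq.
  apply/eqP; rewrite -[RHS]/(_ + _); transitivity (h ^+ (2 * e.+1) * (u * t ^+ e)); first by ring.
  by rewrite Ex exprS; ring.
have [N' hw] := wedge_homog d_gt0 f_homog f_neq0 f_reduced A1 A2.
exists k1, k2, m1, m2, N'; split=> //; apply/negP => /eqP q0.
move/(congr1 (meval (p 0))): ex'; rewrite mevalB !mevalM q0 tp mulr0 mul0r subr0 rmorphXn /=.
by move/eqP; rewrite mulf_eq0 expf_eq0 (negPf hp) (negPf up) andbF.
Qed.

End LocallyFree.

Section FractionIdentities.
Variable F : fieldType.
Implicit Types (a b h k u v w x y : F).

Lemma frac_scale b h k u v x y : h != 0 -> k != 0 -> h * b = x * u + y * v ->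
  b / k = x / (h * k) * u + y / (h * k) * v.
Proof.
move=> n1 n2 e; have -> : b / k = (h * b) / (h * k) by field; rewrite n1 n2.
by rewrite e; field; rewrite n1 n2.
Qed.

Lemma frac_comb a a' k k' u v : k != 0 -> k' != 0 ->
  a / k * u + a' / k' * v = (a * k' * u + a' * k * v) / (k * k').
Proof. by move=> n1 n2; field; rewrite n1 n2. Qed.

Lemma frac_cross a b k k' u v : k != 0 -> k' != 0 ->
  v * (a / k) = b / k' * u -> a * k' * v = b * k * u.
Proof.
move=> n1 n2 e; have -> : a * k' * v = v * (a / k) * (k * k') by field.
by rewrite e; field.
Qed.

Lemma frac_divide a h k k' u w : h != 0 -> k != 0 -> k' != 0 ->
  a * k' * h = w * u -> a / k = w / (k * k' * h) * u.
Proof.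
move=> n1 n2 n3 e.
have -> : a / k = a * k' * h / (k * k' * h) by field; rewrite n1 n2 n3.
by rewrite e; field; rewrite n1 n2 n3.
Qed.

End FractionIdentities.

Section CompleteIntersection.
Variable D : idomainType.
Local Notation "x %:F" := (@tofrac _ x).
Implicit Types (I P : set D).

Lemma prime_ideal_neq0 P h : prime_ideal P -> ~ P h -> h != 0.
Proof. by move=> [[P0 _ _] _ _] nh; apply/eqP => h0; apply: nh; rewrite h0. Qed.

Lemma prime_idealNM P h k : prime_ideal P -> ~ P h -> ~ P k -> ~ P (h * k).
Proof. by move=> [_ _ PM] nh nk /PM[]. Qed.

Lemma gen1 (E : idomainType) (A : set E) (g x : E) :
  gen A [:: g] x <-> exists2 c, A c & x = c * g.
Proof.
split=> [[c [Ac ->]]|[c Ac ->]].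
  by exists (c 0%N) => //; rewrite big_ord_recl big_ord0 addr0.
by exists (fun _ => c); split=> //; rewrite big_ord_recl big_ord0 addr0.
Qed.

Lemma gen2 (E : idomainType) (A : set E) (g1 g2 x : E) :
  gen A [:: g1; g2] x <-> exists c1 c2, [/\ A c1, A c2 & x = c1 * g1 + c2 * g2].
Proof.
split=> [[c [Ac ->]]|[c1 [c2 [A1 A2 ->]]]].
  by exists (c 0%N), (c 1%N); split=> //; rewrite !big_ord_recl big_ord0 addr0.
exists (fun j => if j == 0%N then c1 else c2); split=> [j|]; first by case: ifP.
by rewrite !big_ord_recl big_ord0 addr0.
Qed.

(** Since [h] is a unit at [P], [g1] and [g2] generate the localization of [I]; coprimality of [I]
    makes them a regular sequence. *)
Lemma ci_at_two I P h g1 g2 b0 : is_ideal I -> prime_ideal P -> I `<=` P ->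
  coprime_family I -> I b0 -> b0 != 0 -> ~ P h -> I g1 -> I g2 ->
  (forall b, I b -> exists x y, h * b = x * g1 + y * g2) -> ci_at 2 I P.
Proof.
move=> [I0 ID IM] hP IP cI Ib0 b00 nh Ig1 Ig2 hI.
have [[P0 PD PM] P1 _] := hP.
have h0 := prime_ideal_neq0 hP nh.
have F0 k : ~ P k -> k%:F != 0 by move=> nk; rewrite tofrac_eq0 (prime_ideal_neq0 hP nk).
have locE : loc_ideal P I = gen (loc P) [:: g1%:F; g2%:F].
  apply/seteqP; split=> [_ [b [k [Ib nk ->]]]|_ /gen2[_ [_ [[a [k [nk ->]]] [a' [k' [nk' ->]]] ->]]]].
    have [x [y e]] := hI b Ib; apply/gen2.
    exists (x%:F / (h * k)%:F), (y%:F / (h * k)%:F).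
    have nhk := prime_idealNM hP nh nk.
    split; [by exists x, (h * k) | by exists y, (h * k) |].
    have := congr1 (@tofrac D) e; rewrite tofracD !tofracM.
    exact: frac_scale (F0 _ nh) (F0 _ nk).
  exists (a * k' * g1 + a' * k * g2), (k * k'); split.
  - by apply: ID; apply: IM.
  - exact: prime_idealNM.
  - by rewrite tofracD !tofracM; apply: frac_comb; apply: F0.
(* Otherwise [g2] divides [h * b] for every [b] in [I], hence divides [h] by coprimality, and [h]
   would lie in [P]. *)
have g10 : g1 != 0.
  apply/eqP => g10; apply: nh; have [x [y e]] := hI _ Ib0.
  have g20 : g2 != 0.
    apply: contraNneq (mulf_neq0 h0 b00) => g20.
    by rewrite e g10 g20 !mulr0 addr0.
  suff [c ->] : divides g2 h by apply/PM/IP.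
  apply: cI => // b Ib; have [x' [y' ->]] := hI b Ib.
  by rewrite g10 mulr0 add0r; apply/divides_mull/divides_refl.
exists [:: g1%:F; g2%:F]; split=> //; split.
- move=> [|[|//]] _ /=; [exists g1, 1 | exists g2, 1]; by rewrite tofrac1 divr1.
- move=> [|[|//]] _ a /= Aa.
    move=> [c [_]]; rewrite big_ord0 => /eqP.
    rewrite mulf_eq0 tofrac_eq0 (negPf g10) /= => /eqP ->.
    exists (fun _ => 0); split; last by rewrite big_ord0.
    by move=> j; exists 0, 1; rewrite tofrac0 mul0r.
  case: Aa => a' [k [nk ->]] /gen1[_ [b' [k' [nk' ->]]] e].
  have [F1 F2] := (F0 _ nk, F0 _ nk').
  have e' : (a' * k') * g2 = (b' * k) * g1.
    apply/eqP; rewrite -tofrac_eq; apply/eqP; rewrite !tofracM.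
    exact: frac_cross F1 F2 e.
  (* For [b] in [I], [h * b] is a combination of [g1] and [g2]; multiplied by [a' * k'] its second
     term is also a multiple of [g1], by [e']. Coprimality then removes [b]. *)
  have [w ew] : divides g1 (a' * k' * h).
    apply: cI => // b Ib; have [x [y eb]] := hI b Ib.
    exists (x * (a' * k') + y * (b' * k)); rewrite -mulrA eb.
    by rewrite mulrDr mulrCA [_ * (y * g2)]mulrCA e'; ring.
  apply/gen1; exists (w%:F / (k * k' * h)%:F).
    exists w, (k * k' * h); split=> //; apply: prime_idealNM => //; exact: prime_idealNM.
  have := congr1 (@tofrac D) ew; rewrite !tofracM.
  exact: frac_divide (F0 _ nh) F1 F2.
- rewrite -locE => -[b [k [Ib nk e]]]; have k0 := F0 _ nk; apply: nk.
  suff -> : k = b by apply: IP.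
  apply/eqP; rewrite -tofrac_eq; apply/eqP.
  by rewrite -[LHS]mul1r e divfK.
Qed.

End CompleteIntersection.

(** * Passage to the affine charts *)

Section AffineCharts.
Variable K : numClosedFieldType.
Local Notation S := {mpoly K[3]}.
Local Notation A2 := {mpoly K[2]}.

(** A divisibility in the chart lifts to forms after multiplication by a power of ['X_i]. One power
    serves the three entries, and it becomes 1 again in the chart. *)
Lemma dehom_coprime (i : 'I_3) (w : 'I_3 -> S) N : (forall j, w j \is N.-homog) ->
  coprime_family [set x | exists j, x = w j] ->
  coprime_family [set x | exists j, x = dehom i (w j)].
Proof.
move=> hw cw g e g0 h.
have [nG /(_ nG (leqnn _))[G hG eG]] := dehom_surj i g.
have [nE /(_ nE (leqnn _))[E hE eE]] := dehom_surj i e.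
have G0 : G != 0 by apply: contraNneq g0 => G0; rewrite -eG G0 rmorph0.
have ex j : exists M, divides G ('X_i ^+ M * (E * w j)).
  have [c ec] := h _ (ex_intro _ j erefl).
  have [nC /(_ nC (leqnn _))[C hC eC]] := dehom_surj i c.
  exists (nC + nG)%N; have := @dehom_homog_eq K i _ _ (E * w j) (C * G) (dhomogM hE (hw j)) (dhomogM hC hG).
  rewrite !rmorphM /= eE eC eG => /(_ ec) ->.
  by apply/divides_mull/divides_mull/divides_refl.
have [M hM] : exists M, forall j, divides G ('X_i ^+ M * (E * w j)).
  have [M0 h0] := ex 0; have [M1 h1] := ex 1; have [M2 h2] := ex 2%:R.
  exists (M0 + M1 + M2)%N; apply: forall_ord3; rewrite 2!exprD.
  - by rewrite -!mulrA mulrCA; apply: divides_mull; rewrite mulrCA; apply: divides_mull.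
  - by rewrite -!mulrA; apply: divides_mull; rewrite mulrCA; apply: divides_mull.
  - by rewrite -!mulrA; apply: divides_mull; apply: divides_mull.
have [c ec] : divides G ('X_i ^+ M * E).
  by apply: cw => // _ [j ->]; rewrite -mulrA.
exists (dehom i c); move/(congr1 (dehom i)): ec.
by rewrite !rmorphM rmorphXn /= dehomXi expr1n mul1r eE eG.
Qed.

Lemma V_ideal (I : set S) i : is_ideal I -> is_ideal (V_ I i).
Proof.
move=> [I0 ID IM]; split.
- by exists 0; rewrite ?rmorph0.
- by move=> _ _ [a Ia <-] [b Ib <-]; exists (a + b); [exact: ID | rewrite rmorphD].
- move=> a _ [b Ib <-]; exists (lift_var i a * b); first exact: IM.
  by rewrite rmorphM /= dehom_lift_var.
Qed.

Lemma dehom_prime i (P : set A2) : prime_ideal P ->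
  prime_ideal [set G : S | P (dehom i G)] /\ ~ P (dehom i 'X_i).
Proof.
move=> [[P0 PD PM] P1 Pp]; split; last by rewrite dehomXi.
split=> /=.
- split=> /= [|a b|a b]; rewrite ?rmorph0 ?rmorphD ?rmorphM //; [exact: PD | exact: PM].
- by rewrite rmorph1.
- by move=> a b; rewrite rmorphM => /Pp.
Qed.

Lemma prime_point_chart i (P : set S) (p : 'rV[K]_3) : prime_ideal P -> ~ P 'X_i ->
  p != 0 -> (forall j k, P (minor_form p j k)) -> p 0 i != 0.
Proof.
move=> hP nP p0 Pp; apply/eqP => pi; have [k pk] := row_neq0_entry p0.
apply: nP; have [[_ _ PM] _ _] := hP.
have := PM (p 0 k)^-1%:MP _ (Pp k i).
rewrite /minor_form pi scale0r subr0 mul_mpolyC scalerA mulVf //.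
by rewrite scale1r.
Qed.

Lemma max_ideal_sub (P : set A2) (q : 'I_2 -> K) : is_ideal P ->
  (forall j, P ('X_j - (q j)%:MP)) -> max_ideal q `<=` P.
Proof.
move=> hP h g; rewrite /max_ideal /= => gq.
have := @comp_congr K 2 2 P g (fun j => 'X_j) (fun j => (q j)%:MP) hP h.
by rewrite comp_mpoly_id comp_const gq mpolyC0 subr0.
Qed.

Lemma prime_over_chart (I : set S) i (P : set A2) : eliminable I -> prime_ideal P ->
  V_ I i `<=` P -> exists p : 'rV[K]_3, [/\ p != 0, p 0 i != 0,
    forall j k, P (dehom i (minor_form p j k)) & max_ideal (aff i p) `<=` P].
Proof.
move=> eI hP IP; have [hP' nX] := dehom_prime i hP.
have [p p0 hp] := prime_over_eliminable eI hP' (fun x Ix => IP _ (ex_intro2 _ _ x Ix erefl)).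
have pi := prime_point_chart hP' nX p0 hp.
exists p; split=> //; have [hPi _ _] := hP; apply: max_ideal_sub => // j.
have := hp i (lift i j); rewrite /= /minor_form rmorphB /= !dehomZ dehomX dehomXi => h.
have [_ _ /(_ (p 0 i)^-1%:MP _ h)] := hPi.
by rewrite mul_mpolyC scalerBr !scalerA mulVf // scale1r mulrC -alg_mpolyC.
Qed.

(** Every prime over the chart ideal contains the maximal ideal of a point, so no prime lies
    strictly above it. *)
Lemma eliminable_dim0 (I : set S) : eliminable I -> scheme_dim_le (V_ I) 0.
Proof.
move=> eI i P hP lt; have [[pr0 I0] [pr1 _]] := (hP ord0, hP ord_max).
have [p [_ _ _ mP]] := prime_over_chart eI pr0 I0.
have [P01 P10] := lt ord0 ord_max isT; apply: P10 => g Pg.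
have [[_ PD PM] P1 _] := pr1.
have [g0|g0] := eqVneq g.@[aff i p] 0; first exact: mP.
exfalso; apply: P1; have : P ord_max (g.@[aff i p])%:MP.
  have -> : (g.@[aff i p])%:MP = g + (-1) * (g - (g.@[aff i p])%:MP) by ring.
  apply: PD => //; apply: PM; apply: P01; apply: mP.
  by rewrite /max_ideal /= mevalB mevalC subrr.
by move/(PM (g.@[aff i p])^-1%:MP); rewrite -mpolyCM mulVf.
Qed.

End AffineCharts.

Section LocalCompleteIntersection.
Variables (K : numClosedFieldType).
Local Notation S := {mpoly K[3]}.
Variables (d r : nat) (f : S).
Hypotheses (d_gt0 : (0 < d)%N) (f_homog : f \is d.-homog) (f_neq0 : f != 0).
Hypothesis f_reduced : reduced_equation f.
Hypothesis f_mdr : is_mdr f r.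
Variable rho1 : 'rV[S]_3.
Hypotheses (rho1_AR : AR f r rho1) (rho1_neq0 : rho1 != 0).
Implicit Types (a b m rho : 'rV[S]_3) (w h : S).

Local Notation v := (v_ f rho1).
Local Notation B := (B_ f rho1).

Let rho1_syz : syz f rho1. Proof. by case: rho1_AR. Qed.

Lemma B_eliminable : eliminable B.
Proof.
apply: (@coprime_eliminable _ _ (rho1 0)).
- exact: (B_homogeneous d_gt0 f_homog f_neq0 f_reduced rho1_AR).
- exact: (B_rho1 d_gt0 f_homog f_neq0 f_reduced rho1_AR).
- exact: (rho1_coprime d_gt0 f_homog f_mdr rho1_AR rho1_neq0).
Qed.

(** Apply [v_] to Cramer's rule for a local basis [m1], [m2] of the syzygies; [h] is its wedge. *)
Lemma B_locally_two_generated (p : 'rV[K]_3) : p != 0 -> exists N (h b1 b2 : S),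
  [/\ h \is N.-homog, h.@[p 0] != 0, B b1, B b2 &
    forall b : S, B b -> exists x y, h * b = x * b1 + y * b2].
Proof.
move=> p0; have [k1 [k2 [m1 [m2 [N [[s1 _] [s2 _] hw wp]]]]]] :=
  locally_free d_gt0 f_homog f_neq0 f_reduced p0.
exists N, (wedge f m1 m2), (v m1), (v m2); split=> //; [by exists m1 | by exists m2 |].
move=> _ [m sm <-]; have e := wedge_cramer d_gt0 f_homog f_neq0 f_reduced sm s1 s2.
exists (wedge f m m2), (wedge f m1 m).
have vZ' := vZ d_gt0 f_homog f_neq0 f_reduced rho1_AR.
have := congr1 v e; rewrite (vZ' _ _ sm).
rewrite (vD d_gt0 f_homog f_neq0 f_reduced rho1_AR (syzZ _ s1) (syzZ _ s2)).
by rewrite (vZ' _ _ s1) (vZ' _ _ s2).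
Qed.

Lemma B_nonzero : exists2 i, B (rho1 0 i) & rho1 0 i != 0.
Proof.
have [i ri] := row_neq0_entry rho1_neq0; exists i => //.
exact: (B_rho1 d_gt0 f_homog f_neq0 f_reduced rho1_AR i).
Qed.

Lemma B_lci : ideal_lci 2 B.
Proof.
move=> P hP BP [i nX]; have [p p0 hp] := prime_over_eliminable B_eliminable hP BP.
have [N [h [b1 [b2 [hh hhp B1 B2 hB]]]]] := B_locally_two_generated p0.
have [j Bj rj] := B_nonzero.
apply: (@ci_at_two _ B P h b1 b2 (rho1 0 j)) => //.
- exact: (B_ideal d_gt0 f_homog f_neq0 f_reduced rho1_AR).
- exact: (B_coprime d_gt0 f_homog f_neq0 f_reduced f_mdr rho1_AR rho1_neq0).
- exact: (prime_point_notin hP nX p0 hp hh hhp).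
Qed.

Lemma Z_lci : scheme_lci 2 (V_ B).
Proof.
move=> i P hP ZP; have [p [p0 pi hp _]] := prime_over_chart B_eliminable hP ZP.
have [hP' nX] := dehom_prime i hP.
have [N [h [b1 [b2 [hh hhp B1 B2 hB]]]]] := B_locally_two_generated p0.
have [j Bj rj] := B_nonzero; have [_ rh] := rho1_AR.
apply: (@ci_at_two _ (V_ B i) P (dehom i h) (dehom i b1) (dehom i b2) (dehom i (rho1 0 j))) => //.
- exact/V_ideal/(B_ideal d_gt0 f_homog f_neq0 f_reduced rho1_AR).
- apply: (@coprime_familyS _ [set x | exists j, x = dehom i (rho1 0 j)]).
    move=> _ [k ->]; exists (rho1 0 k) => //.
    exact: (B_rho1 d_gt0 f_homog f_neq0 f_reduced rho1_AR k).
  apply: (@dehom_coprime _ _ _ r); first exact: rh.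
  exact: (rho1_coprime d_gt0 f_homog f_mdr rho1_AR rho1_neq0).
- by exists (rho1 0 j).
- by apply: contraNneq rj => /(dehom_homog_eq0 (rh j)) ->.
- exact: (prime_point_notin hP' nX p0 hp hh hhp).
- by exists b1.
- by exists b2.
- move=> _ [b Bb <-]; have [x [y e]] := hB b Bb.
  by exists (dehom i x), (dehom i y); rewrite -!rmorphM e rmorphD.
Qed.

End LocalCompleteIntersection.

(** * Degrees *)

Local Notation qdim V W n := (is_dim (fun c x => c *: x) V W n).

(** * Dimensions of quotients of vector spaces *)

Section DimensionTheory.
Variable K : fieldType.

Definition subsp (E : lmodType K) (V : set E) :=
  V 0 /\ forall a x y, V x -> V y -> V (a *: x + y).

(** Linearity on [V] alone, because [v_], defined by choice, is controlled only on syzygies. *)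
Definition linear_on (E F : lmodType K) (V : set E) (f : E -> F) :=
  forall a x y, V x -> V y -> f (a *: x + y) = a *: f x + f y.

Definition dim_map (E : lmodType K) (V W : set E) n (phi : E -> 'rV[K]_n) :=
  [/\ linear_on V phi, forall c, exists2 x, V x & phi x = c
    & forall x, V x -> (phi x = 0 <-> W x)].

Section Basics.
Variable E : lmodType K.
Implicit Types (V W U : set E).

Lemma subspD V x y : subsp V -> V x -> V y -> V (x + y).
Proof. by move=> [_ h] Vx Vy; rewrite -[x]scale1r; apply: h. Qed.

Lemma subspZ V a x : subsp V -> V x -> V (a *: x).
Proof. by move=> [V0 h] Vx; rewrite -[_ *: _]addr0; apply: h. Qed.

Lemma subspB V x y : subsp V -> V x -> V y -> V (x - y).
Proof. by move=> hV Vx Vy; apply: subspD => //; rewrite -scaleN1r; apply: subspZ. Qed.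

Lemma subsp_sum V (I : Type) (r : seq I) (P : pred I) (F : I -> E) : subsp V ->
  (forall i, P i -> V (F i)) -> V (\sum_(i <- r | P i) F i).
Proof.
move=> hV h; elim/big_ind: _ => //; first by case: hV.
by move=> *; apply: subspD.
Qed.

Lemma subspI V W : subsp V -> subsp W -> subsp (V `&` W).
Proof.
move=> [V0 hV] [W0 hW]; split=> // a x y [Vx Wx] [Vy Wy].
by split; [apply: hV | apply: hW].
Qed.

Lemma linear_on0 (F : lmodType K) V (f : E -> F) : subsp V -> linear_on V f -> f 0 = 0.
Proof.
move=> [V0 _] /(_ (-1) 0 0 V0 V0); rewrite scaler0 addr0 => e.
by rewrite e scaleN1r addNr.
Qed.

Lemma linear_onB (F : lmodType K) V (f : E -> F) x y : subsp V -> linear_on V f ->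
  V x -> V y -> f (x - y) = f x - f y.
Proof. by move=> hV hf Vx Vy; rewrite addrC -scaleN1r hf // scaleN1r addrC. Qed.

Lemma linear_onD (F : lmodType K) V (f : E -> F) x y : subsp V -> linear_on V f ->
  V x -> V y -> f (x + y) = f x + f y.
Proof. by move=> hV hf Vx Vy; rewrite -[x]scale1r hf // !scale1r. Qed.

Lemma linear_on_comb (F : lmodType K) V (f : E -> F) n (c : 'I_n -> K) (e : 'I_n -> E) :
  subsp V -> linear_on V f -> (forall i, V (e i)) ->
  V (\sum_i c i *: e i) /\ f (\sum_i c i *: e i) = \sum_i c i *: f (e i).
Proof.
move=> hV hf he; elim/big_ind2: _ => [|x a y b [Vx <-] [Vy <-]|i _].
- by split; [case: hV | apply: linear_on0 hV hf].
- by split; [exact: subspD | exact: linear_onD hV hf _ _].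
- split; first exact: subspZ.
  by rewrite -[c i *: e i]addr0 hf // ?(linear_on0 hV hf) ?addr0 //; case: hV.
Qed.

End Basics.

Section Dimension.
Variable E : lmodType K.
Implicit Types (V W U : set E).

(** Trades a basis of the quotient for a coordinate map onto ['rV[K]_n] with kernel [W], to which
    matrix rank applies. *)
Lemma is_dimP V W n : subsp V -> subsp W ->
  qdim V W n <-> exists phi : E -> 'rV[K]_n, dim_map V W phi.
Proof.
move=> hV hW; split=> [[e [Ve he]]|[phi [lin sur ker]]].
  have ex x : exists c : 'rV[K]_n, V x -> W (x - \sum_i c 0 i *: e i).
    have [Vx|nVx] := pselect (V x); last by exists 0.
    by have [c [hc _]] := he x Vx; exists c.
  have [phi hphi] := choice ex.
  have uni x (c : 'rV[K]_n) : V x -> W (x - \sum_i c 0 i *: e i) -> phi x = c.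
    move=> Vx hc; have [c' [_ u]] := he x Vx.
    by rewrite -(u _ (hphi x Vx)) -(u _ hc).
  exists phi; split.
  - move=> a x y Vx Vy; apply: uni; first by case: hV => _; apply.
    have [_ hW'] := hW; have := hW' a _ _ (hphi x Vx) (hphi y Vy).
    congr W; rewrite scalerBr addrACA -opprD; congr (_ - _).
    rewrite scaler_sumr -big_split /=; apply: eq_bigr => i _.
    by rewrite !mxE scalerDl scalerA.
  - move=> c; exists (\sum_i c 0 i *: e i).
      by apply: subsp_sum => // i _; apply: subspZ.
    apply: uni; last by rewrite subrr; case: hW.
    by apply: subsp_sum => // i _; apply: subspZ.
  - move=> x Vx; split=> [e0|Wx].
      have := hphi x Vx; rewrite e0 big1 ?subr0 // => i _.
      by rewrite mxE scale0r.
    by apply: uni => //; rewrite big1 ?subr0 // => i _; rewrite mxE scale0r.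
have ex i : exists x, V x /\ phi x = delta_mx 0 i.
  by have [x Vx ex] := sur (delta_mx 0 i); exists x.
have [e he] := choice ex.
have Ve i : V (e i) by case: (he i).
have comb (c : 'rV[K]_n) : V (\sum_i c 0 i *: e i) /\ phi (\sum_i c 0 i *: e i) = c.
  have [Vs ->] := linear_on_comb (fun i => c 0 i) hV lin Ve; split=> //.
  by rewrite [RHS]row_sum_delta; apply: eq_bigr => i _; case: (he i) => _ ->.
exists e; split=> // x Vx; exists (phi x); split.
  have [Vs es] := comb (phi x).
  apply/(ker _ (subspB hV Vx Vs)); by rewrite (linear_onB hV lin) // es subrr.
move=> c hc; have [Vs es] := comb c.
move/(ker _ (subspB hV Vx Vs)): hc; rewrite (linear_onB hV lin) // es => /eqP.
by rewrite subr_eq0 => /eqP.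
Qed.

Lemma dim_uniq V W n m : subsp V -> subsp W -> qdim V W n -> qdim V W m -> n = m.
Proof.
move=> hV hW.
suff h n' m' : qdim V W n' -> qdim V W m' -> (n' <= m')%N.
  by move=> h1 h2; apply/eqP; rewrite eqn_leq (h _ _ h1 h2) (h _ _ h2 h1).
move=> /(is_dimP _ hV hW)[phi [lin sur ker]] /(is_dimP _ hV hW)[psi [lin' sur' ker']].
have ex i : exists x, V x /\ phi x = delta_mx 0 i.
  by have [x Vx ex] := sur (delta_mx 0 i); exists x.
have [e he] := choice ex; have Ve i : V (e i) by case: (he i).
pose A : 'M[K]_(n', m') := \matrix_i psi (e i).
have : row_free A.
  apply/row_freeP; apply/row_freeP; rewrite -kermx_eq0; apply/rowV0P => c /sub_kermxP cA.
  have [Vs es] := linear_on_comb (fun i => c 0 i) hV lin' Ve.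
  have psi0 : psi (\sum_i c 0 i *: e i) = 0.
    rewrite es; transitivity (c *m A); last exact: cA.
    by rewrite mulmx_sum_row; apply: eq_bigr => i _; rewrite rowK.
  have /(ker _ Vs) := (ker' _ Vs).1 psi0.
  have [_ ->] := linear_on_comb (fun i => c 0 i) hV lin Ve.
  by rewrite [c]row_sum_delta => {2}<-; apply: eq_bigr => i _; case: (he i) => _ ->;
     rewrite -row_sum_delta.
by move=> fA; rewrite -(eqP fA); apply: rank_leq_col.
Qed.

Lemma dim_add V U W a b : subsp V -> subsp U -> subsp W -> U `<=` V -> W `<=` U ->
  qdim V U a -> qdim U W b -> qdim V W (a + b).
Proof.
move=> hV hU hW UV WU /(is_dimP _ hV hU)[al [lin sur ker]] /(is_dimP _ hU hW)[be [lin' sur' ker']].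
have ex i : exists x, V x /\ al x = delta_mx 0 i.
  by have [x Vx ex] := sur (delta_mx 0 i); exists x.
have [e he] := choice ex; have Ve i : V (e i) by case: (he i).
pose s (c : 'rV[K]_a) := \sum_i c 0 i *: e i.
have Vs c : V (s c) by have [] := linear_on_comb (fun i => c 0 i) hV lin Ve.
have als c : al (s c) = c.
  have [_ ->] := linear_on_comb (fun i => c 0 i) hV lin Ve.
  by rewrite [RHS]row_sum_delta; apply: eq_bigr => i _; case: (he i) => _ ->.
have slin k c c' : s (k *: c + c') = k *: s c + s c'.
  rewrite /s scaler_sumr -big_split /=; apply: eq_bigr => i _.
  by rewrite !mxE scalerDl scalerA.
have Ux x : V x -> U (x - s (al x)).
  move=> Vx; apply/(ker _ (subspB hV Vx (Vs _))).
  by rewrite (linear_onB hV lin) // als subrr.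
have s0 : s 0 = 0 by rewrite /s big1 // => i _; rewrite mxE scale0r.
apply/(is_dimP _ hV hW); exists (fun x => row_mx (al x) (be (x - s (al x)))); split.
- move=> k x y Vx Vy; rewrite lin // slin opprD addrACA -scalerBr lin' //; try exact: Ux.
  by rewrite scale_row_mx add_row_mx.
- move=> c; have [u Uu eu] := sur' (rsubmx c).
  have Vu := UV _ Uu; exists (s (lsubmx c) + u); first exact: subspD.
  have -> : al (s (lsubmx c) + u) = lsubmx c.
    by rewrite (linear_onD hV lin) // als ((ker _ Vu).2 Uu) addr0.
  by rewrite addrC addKr eu hsubmxK.
- move=> x Vx; split=> [/eqP|Wx].
    rewrite -[0]row_mx0 => /eqP /eq_row_mx[a0]; rewrite a0 s0 subr0.
    by apply: (ker' _ _).1; apply/(ker _ Vx).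
  have /(ker _ Vx) a0 := WU _ Wx.
  by rewrite a0 s0 subr0 ((ker' _ (WU _ Wx)).2 Wx) row_mx0.
Qed.

(** A free family of rows has at most [N] members; one of largest size in [T] spans [T]. *)
Lemma rV_subspace_matrix N (T : set 'rV[K]_N) : subsp T ->
  exists m (A : 'M[K]_(m, N)), row_free A /\ forall c, T c <-> (c <= A)%MS.
Proof.
move=> hT.
pose P m := `[< exists A : 'M[K]_(m, N), row_free A /\ forall i, T (row i A) >].
have P0 : exists m, P m.
  by exists 0%N; apply/asboolP; exists 0; split=> [|[]//]; rewrite /row_free mxrank0.
have Pm m : P m -> (m <= N)%N.
  by move=> /asboolP[A [fA _]]; rewrite -(eqP fA); apply: rank_leq_col.
pose m := ex_maxn P0 Pm.
have [/asboolP [A [fA TA]] mmax] : P m /\ forall m', P m' -> (m' <= m)%N.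
  by rewrite /m; case: ex_maxnP.
exists m, A; split=> // c; split=> [Tc|/submxP[D ->]]; last first.
  rewrite mulmx_sum_row; apply: subsp_sum => // i _; exact: subspZ.
apply: contrapT => /negP nc.
have : P (m + 1)%N.
  apply/asboolP; exists (col_mx A c); split.
    have d : (A :&: c)%MS = 0.
      apply/eqP; rewrite -submx0; apply/rV_subP => x; rewrite sub_capmx => /andP[xA /sub_rVP[k xk]].
      have [k0|k0] := eqVneq k 0; first by rewrite xk k0 scale0r sub0mx.
      case/negP: nc; have -> : c = k^-1 *: x by rewrite xk scalerA mulVf // scale1r.
      exact: scalemx_sub.
    rewrite /row_free -addsmxE (mxrank_disjoint_sum d) (eqP fA) rank_rV.
    by have [c0|] := eqVneq c 0; [move: nc; rewrite c0 sub0mx | rewrite eqxx].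
  move=> i; case: (split_ordP i) => j ->; first by rewrite rowKu.
  by rewrite rowKd; have -> : row j c = c by apply/rowP => l; rewrite mxE ord1.
by move/mmax; rewrite addn1 ltnn.
Qed.

(** In coordinates [U] becomes the row space of a matrix [A], and the quotient by it is read off the
    cokernel of [A]. *)
Lemma dim_sub V U W N : subsp V -> subsp U -> subsp W -> U `<=` V -> W `<=` U ->
  qdim V W N -> exists a b, [/\ qdim V U a, qdim U W b & N = (a + b)%N].
Proof.
move=> hV hU hW UV WU dVW; have [phi [lin sur ker]] := (is_dimP _ hV hW).1 dVW.
pose T : set 'rV[K]_N := [set c | exists2 x, U x & phi x = c].
have hT : subsp T.
  split; first by exists 0; [case: hU | apply: linear_on0 hV lin].
  move=> k _ _ [x Ux <-] [y Uy <-]; exists (k *: x + y); first by case: hU => _; apply.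
  by rewrite lin //; apply: UV.
have [m [A [fA TA]]] := rV_subspace_matrix hT.
have UT x : V x -> (U x <-> (phi x <= A)%MS).
  move=> Vx; rewrite -TA; split=> [Ux|[y Uy e]]; first by exists x.
  have -> : x = (x - y) + y by rewrite subrK.
  apply: subspD => //; apply: WU; apply/(ker _ (subspB hV Vx (UV _ Uy))).
  by rewrite (linear_onB hV lin) ?e ?subrr //; apply: UV.
have dU : qdim U W m.
  apply/(is_dimP _ hU hW); exists (fun x => phi x *m pinvmx A); split.
  - by move=> k x y Ux Uy; rewrite lin ?mulmxDl ?scalemxAl //; apply: UV.
  - move=> c; have [x Ux ex] : T (c *m A) by apply/TA; apply: submxMl.
    by exists x => //; rewrite ex -mulmxA mulmxVp // mulmx1.
  - move=> x Ux; rewrite -(ker _ (UV _ Ux)); split=> [e|->]; last by rewrite mul0mx.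
    by rewrite -(mulmxKpV ((UT _ (UV _ Ux)).1 Ux)) e mul0mx.
pose C := col_base (cokermx A).
have dV : qdim V U (\rank (cokermx A)).
  apply/(is_dimP _ hV hU); exists (fun x => phi x *m C); split.
  - by move=> k x y Vx Vy; rewrite lin ?mulmxDl ?scalemxAl.
  - move=> c; have /row_fullP[D eD] := col_base_full (cokermx A).
    have [x Vx ex] := sur (c *m D); exists x => //.
    by rewrite ex -mulmxA eD mulmx1.
  - move=> x Vx; rewrite (UT _ Vx) submxE.
    have eC : cokermx A = C *m row_base (cokermx A) by rewrite mulmx_base.
    split=> [e|/eqP e]; first by rewrite eC mulmxA e mul0mx.
    have /row_freeP[D eD] := row_base_free (cokermx A).
    by rewrite -[LHS]mulmx1 -eD mulmxA -[_ *m C *m _]mulmxA -eC e mul0mx.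
exists (\rank (cokermx A)), m; split=> //.
exact: dim_uniq hV hW dVW (dim_add hV hU hW UV WU dV dU).
Qed.

Lemma dim_0 V W : V `<=` W -> subsp V -> subsp W -> qdim V W 0.
Proof.
move=> VW hV hW; apply/(is_dimP _ hV hW); exists (fun _ => 0); split.
- by move=> *; rewrite scaler0 addr0.
- by move=> c; exists 0; [case: hV | apply/rowP => -[]].
- by move=> x /VW.
Qed.

Lemma dim0_sub V W : subsp V -> subsp W -> qdim V W 0 -> V `<=` W.
Proof.
move=> hV hW /(is_dimP _ hV hW)[phi [_ _ ker]] x Vx.
by apply/(ker _ Vx)/rowP => -[].
Qed.

Lemma dim_eq V W W' n : subsp V -> subsp W -> subsp W' ->
  (forall x, V x -> (W x <-> W' x)) -> qdim V W n -> qdim V W' n.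
Proof.
move=> hV hW hW' h /(is_dimP _ hV hW)[phi [lin sur ker]].
apply/(is_dimP _ hV hW'); exists phi; split=> // x Vx.
by rewrite ker //; apply: h.
Qed.

End Dimension.

Section DimensionMaps.
Variables E F : lmodType K.
Variables (V W : set E) (V' W' : set F) (f : E -> F).
Hypotheses (hV : subsp V) (hW : subsp W) (hV' : subsp V') (hW' : subsp W').
Hypotheses (lin : linear_on V f) (fV : forall x, V x -> V' (f x)).
Hypothesis fW : forall x, V x -> (W x <-> W' (f x)).

(** By [fW] the map [f] induces an injection of [V / W] into [V' / W']; the hypothesis stated here
    makes it onto. *)
Lemma dim_pullback n : (forall y, V' y -> exists2 x, V x & W' (y - f x)) ->
  qdim V' W' n -> qdim V W n.
Proof.
move=> fsur /(is_dimP _ hV' hW')[phi [plin sur ker]].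
apply/(is_dimP _ hV hW); exists (phi \o f); split.
- by move=> a x y Vx Vy; rewrite /= lin // plin //; apply: fV.
- move=> c; have [y V'y <-] := sur c; have [x Vx e] := fsur y V'y.
  exists x => //=; symmetry; apply/eqP; rewrite -subr_eq0; apply/eqP.
  rewrite -(linear_onB hV' plin) //; last exact: fV.
  by apply/ker => //; apply: subspB => //; apply: fV.
- by move=> x Vx; rewrite fW //= ker //; apply: fV.
Qed.

Lemma dim_pushforward n : (forall y, V' y -> exists2 x, V x & W' (y - f x)) ->
  qdim V W n -> qdim V' W' n.
Proof.
move=> fsur /(is_dimP _ hV hW)[phi [plin sur ker]].
have ex y : exists x, V' y -> V x /\ W' (y - f x).
  have [V'y|nV] := pselect (V' y); last by exists 0.
  by have [x Vx e] := fsur y V'y; exists x.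
have [g hg] := choice ex.
have fB x y : V x -> V y -> f (x - y) = f x - f y by apply: linear_onB.
have key x y : V x -> V y -> W' (f x - f y) -> phi x = phi y.
  move=> Vx Vy; have Vxy := subspB hV Vx Vy; rewrite -fB // => /(fW Vxy).2 /(ker _ Vxy).2.
  by rewrite (linear_onB hV plin) // => /eqP; rewrite subr_eq0 => /eqP.
apply/(is_dimP _ hV' hW'); exists (phi \o g); split.
- move=> a x y V'x V'y /=.
  have [Vx ex'] := hg _ V'x; have [Vy ey] := hg _ V'y.
  have V'xy : V' (a *: x + y) by case: hV' => _; apply.
  have [Vxy exy] := hg _ V'xy.
  rewrite -plin //; apply: key => //; first by case: hV => _; apply.
  rewrite lin //.
  have -> : f (g (a *: x + y)) - (a *: f (g x) + f (g y)) =
    (a *: (x - f (g x)) + (y - f (g y))) - (a *: x + y - f (g (a *: x + y))).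
    by rewrite scalerBr [in RHS]addrACA -opprD [in RHS]opprB [RHS]addrC addrA subrK.
  by apply: (subspB hW') => //; case: hW' => _; apply.
- move=> c; have [x Vx <-] := sur c; exists (f x); first exact: fV.
  have [Vg eg] := hg _ (fV Vx); apply: key => //=.
  by rewrite -opprB -scaleN1r; apply: subspZ.
- move=> y V'y /=; have [Vg eg] := hg _ V'y; rewrite ker // fW //.
  split=> h.
    have -> : y = (y - f (g y)) + f (g y) by rewrite subrK.
    exact: subspD.
  have -> : f (g y) = y - (y - f (g y)) by rewrite opprB addrC subrK.
  exact: subspB.
Qed.

End DimensionMaps.

Lemma dim_inj_surj (E F : lmodType K) (V W : set E) (V' W' : set F) (f : E -> F) n :
  subsp V -> subsp W -> subsp V' -> subsp W' ->
  linear_on V f -> (forall x, V x -> V' (f x)) -> (forall x, V x -> (W x <-> W' (f x))) ->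
  W' `<=` V' -> qdim V W n -> qdim V' W' n ->
  forall y, V' y -> exists2 x, V x & W' (y - f x).
Proof.
move=> hV hW hV' hW' lin fV fW WV' dV dV'; pose U := [set y | V' y /\ exists2 x, V x & W' (y - f x)].
have f0 : f 0 = 0 by apply: linear_on0 hV lin.
have hU : subsp U.
  split; first by split; [case: hV' | exists 0; [case: hV | rewrite f0 subr0; case: hW']].
  move=> a y y' [V'y [x Vx e]] [V'y' [x' Vx' e']]; split; first by case: hV' => _; apply.
  exists (a *: x + x'); first by case: hV => _; apply.
  rewrite lin // opprD addrACA -scalerBr; by case: hW' => _; apply.
have WU : W' `<=` U.
  move=> y Wy; split; first exact: WV'.
  by exists 0; [case: hV | rewrite f0 subr0].
have [a [b [dVU dUW e]]] := dim_sub hV' hU hW' (fun y (h : U y) => h.1) WU dV'.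
have dU : qdim U W' n.
  apply: (@dim_pushforward _ _ V W U W' f) => //; last by move=> y [].
  by move=> x Vx; split; [exact: fV | exists x => //; rewrite subrr; case: hW'].
have eb := dim_uniq hU hW' dU dUW.
have a0 : a = 0%N by lia.
move=> y V'y; rewrite a0 in dVU.
by have [] := dim0_sub hV' hU dVU V'y.
Qed.

End DimensionTheory.

(** * Finite zero sets *)

Section ZeroSet.
Variable K : numClosedFieldType.
Local Notation S := {mpoly K[3]}.
Implicit Types (p : 'rV[K]_3) (I : set S).

Definition zeros I : set 'rV[K]_3 := [set p | proj_points p /\
  forall N (g : S), g \is N.-homog -> I g -> g.@[p 0] = 0].

Lemma proj_point_neq0 p : proj_points p -> p != 0.
Proof.
by move=> [i [pi _]]; apply/eqP => p0; move: pi; rewrite p0 mxE => /eqP; rewrite eq_sym oner_eq0.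
Qed.

Lemma proj_normalize p : p != 0 -> exists2 c, c != 0 & proj_points (c *: p).
Proof.
move=> p0; have [i [pi imin]] : exists i : 'I_3, p 0 i != 0 /\
    forall j : 'I_3, (j < i)%N -> p 0 j = 0.
  have [p00|n0] := eqVneq (p 0 0) 0; last by exists 0.
  have [p01|n1] := eqVneq (p 0 1) 0; last first.
    by exists 1; split=> // j; case: (ord3P j) => ->.
  exists 2%:R; split; last by move=> j; case: (ord3P j) => ->.
  apply: contraNneq p0 => p02; apply/eqP/rowP; apply: forall_ord3; by rewrite mxE.
exists (p 0 i)^-1; first by rewrite invr_eq0.
exists i; rewrite mxE mulVf //; split=> // j /imin ji.
by rewrite mxE ji mulr0.
Qed.

Lemma proj_point_uniq p q : proj_points p -> proj_points q ->
  (forall i j, p 0 i * q 0 j = p 0 j * q 0 i) -> p = q.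
Proof.
move=> [i [pi pmin]] [j [qj qmin]] h.
have ij : i = j.
  have := oner_eq0 K; case: (ltngtP (i : nat) (j : nat)) => [lt|lt|/ord_inj //] /eqP e; exfalso; apply: e.
    by have := h i j; rewrite pi qj (qmin _ lt) mulr0 mul1r.
  by have := h i j; rewrite pi qj (pmin _ lt) mul0r mul1r.
apply/rowP => k; have := h i k; rewrite pi mul1r => ->.
by rewrite ij qj mulr1.
Qed.

Lemma meval_scale N (g : S) c p : g \is N.-homog -> g.@[(c *: p) 0] = c ^+ N * g.@[p 0].
Proof.
by move=> hg; rewrite -(meval_homog _ _ hg); apply: meval_eq => j; rewrite mxE.
Qed.

Lemma not_zero_witness I p : p != 0 ->
  (forall c, c != 0 -> ~ zeros I (c *: p)) ->
  exists N (g : S), [/\ g \is N.-homog, I g & g.@[p 0] != 0].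
Proof.
move=> p0 nz; have [c c0 cp] := proj_normalize p0; apply: contrapT => h.
apply: (nz c c0); split=> // N g hg Ig; rewrite (meval_scale _ _ hg).
apply/eqP; rewrite mulf_eq0; apply/orP; right; apply/negPn/negP => gp.
by apply: h; exists N, g.
Qed.

Lemma linear_form_meval (l : 'rV[K]_3) p : (linear_form l).@[p 0] = dot l p.
Proof.
rewrite /linear_form /dot raddf_sum /=; apply: eq_bigr => j _.
by rewrite mevalZ mevalXU.
Qed.

Lemma linear_form_homog (l : 'rV[K]_3) : linear_form l \is 1.-homog.
Proof. by apply: rpred_sum => j _; rewrite dhomogZ // dhomogXi. Qed.

Lemma prod_linear_homog (s : seq 'rV[K]_3) :
  \prod_(l <- s) linear_form l \is (size s).-homog.
Proof.
elim: s => [|l s IH]; first by rewrite big_nil; exact: dhomog1.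
by rewrite big_cons /= -(add1n (size s)); apply: dhomogM => //; exact: linear_form_homog.
Qed.

(** A zero annihilates a factor of each eliminant, and two of these three factors are independent:
    it is the normalized cross product of two members of a finite list. *)
Lemma zeros_finite I : eliminable I -> exists z : seq 'rV[K]_3,
  uniq z /\ forall p, p \in z <-> zeros I p.
Proof.
move=> eI; have [s0 [hs0 I0]] := eI 0; have [s1 [hs1 I1]] := eI 1.
have [s2 [hs2 I2]] := eI 2%:R.
have root s p : I (\prod_(l <- s) linear_form l) -> zeros I p -> exists2 l, l \in s & dot l p = 0.
  move=> Is [pp /(_ _ _ (prod_linear_homog s) Is)].
  rewrite rmorph_prod /=; elim: s {Is} => [|l s IH].
    by rewrite big_nil => /eqP; rewrite oner_eq0.
  rewrite big_cons => /eqP; rewrite mulf_eq0 => /orP[/eqP e|/eqP /IH[l' ls e]].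
    by exists l; rewrite ?mem_head // -linear_form_meval.
  by exists l' => //; rewrite inE ls orbT.
pose cand := [seq cross l l' | l <- s0 ++ s1 ++ s2, l' <- s0 ++ s1 ++ s2].
pose nrm (c : 'rV[K]_3) := xget 0 [set q | proj_points q /\ exists a, q = a *: c].
have zc p : zeros I p -> p \in map nrm cand.
  move=> zp; have [l0 m0 e0] := root _ _ I0 zp.
  have [l1 m1 e1] := root _ _ I1 zp; have [l2 m2 e2] := root _ _ I2 zp.
  have [[n0 z0] [n1 z1] [n2 z2]] := And3 (hs0 _ m0) (hs1 _ m1) (hs2 _ m2).
  have par l l' : dot l p = 0 -> dot l' p = 0 -> cross l l' != 0 -> p = nrm (cross l l').
    move=> e e' c0; have [a a0 ap] := proj_normalize c0.
    have hn : [set q | proj_points q /\ exists a, q = a *: cross l l'] (nrm (cross l l')).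
      by apply: xgetPex; exists (a *: cross l l'); split=> //; exists a.
    case: hn => [pn [b eb]]; apply: proj_point_uniq => //; first by case: zp.
    move=> i j; rewrite eb; move: (cross l l') (cross_orthogonal e e' i j) => c h; rewrite !mxE.
    rewrite [LHS]mulrCA [RHS]mulrCA; congr (_ * _).
    by rewrite mulrC -h mulrC.
  have mem0 : l0 \in s0 ++ s1 ++ s2 by rewrite !mem_cat m0.
  have mem1 : l1 \in s0 ++ s1 ++ s2 by rewrite !mem_cat m1 orbT.
  have mem2 : l2 \in s0 ++ s1 ++ s2 by rewrite !mem_cat m2 !orbT.
  case: (independent_pair n0 n1 n2 z0 z1 z2) => c0.
  - by rewrite (par _ _ e0 e1 c0); apply/map_f/allpairs_f.
  - by rewrite (par _ _ e0 e2 c0); apply/map_f/allpairs_f.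
  - by rewrite (par _ _ e1 e2 c0); apply/map_f/allpairs_f.
exists (undup [seq p <- map nrm cand | `[< zeros I p >]]); split; first exact: undup_uniq.
move=> p; rewrite mem_undup mem_filter; split=> [/andP[/asboolP]//|zp].
by rewrite zc // andbT; apply/asboolP.
Qed.

(** Among the forms with coefficients 1, x, x^2 each point excludes only the roots of a nonzero
    polynomial in [x], and [K] is infinite. *)
Lemma linear_form_avoiding (z : seq 'rV[K]_3) : (forall p, p \in z -> p != 0) ->
  exists l : 'rV[K]_3, forall p, p \in z -> (linear_form l).@[p 0] != 0.
Proof.
move=> hz; pose Q : {poly K} := \prod_(p <- z) \poly_(i < 3) p 0 (inord i).
have Q0 : Q != 0.
  rewrite /Q prodf_seq_neq0; apply/allP => p /hz p0; apply/implyP => _.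
  have [i pi] := row_neq0_entry p0; apply: contraNneq pi => /(congr1 (fun q : {poly K} => q`_i)).
  by rewrite coef_poly ltn_ord coef0 inord_val => ->.
have [x Qx] : exists x, Q.[x] != 0.
  apply: contrapT => h; pose rs : seq K := [seq i%:R | i <- iota 0 (size Q)].
  have rQ : all (root Q) rs.
    by apply/allP => y _; apply/rootP/eqP/negPn/negP => Qy; apply: h; exists y.
  have urs : uniq rs.
    by rewrite map_inj_uniq ?iota_uniq // => a b /eqP; rewrite eqr_nat => /eqP.
  by have := max_poly_roots Q0 rQ urs; rewrite size_map size_iota ltnn.
exists (\row_j x ^+ j) => p pz; apply: contraNneq Qx; rewrite linear_form_meval => e.
rewrite /Q horner_prod (big_rem p) //= horner_poly.
suff -> : \sum_(i < 3) p 0 (inord i) * x ^+ i = 0 by rewrite mul0r.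
transitivity (dot (\row_j x ^+ j) p); last exact: e.
by apply: eq_bigr => i _; rewrite inord_val [RHS]mulrC mxE.
Qed.

End ZeroSet.

Section Forms.
Variable K : fieldType.
Local Notation S := {mpoly K[3]}.

Definition forms k : set S := [set g | g \is k.-homog].

Lemma forms_subsp k : subsp (forms k).
Proof.
split=> [|a x y hx hy]; first exact: dhomog0.
by rewrite /forms /= rpredD // dhomogZ.
Qed.

Lemma ideal_subsp (I : set S) : is_ideal I -> subsp I.
Proof.
by move=> [I0 ID IM]; split=> // a x y Ix Iy; apply: ID => //; rewrite -mul_mpolyC; apply: IM.
Qed.

Lemma set0_subsp (E : lmodType K) : subsp [set 0 : E].
Proof. by split=> // a x y -> ->; rewrite scaler0 addr0. Qed.

Lemma forms_dim k : qdim (forms k) [set 0] 'C(k + 2, k).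
Proof.
apply/(is_dimP _ (forms_subsp k) (set0_subsp _)).
have [f flin [g fK gK]] := @dhomog_vecaxiom 2 K k.
have inK (x : S) : forms k x -> val (indhomog k x : dhomog 3 K k) = x.
  by move=> hx; rewrite /indhomog insubdK.
exists (fun x => f (indhomog k x)); split.
- move=> a x y hx hy; rewrite -flin; congr (f _); apply: val_inj.
  have [_ /(_ a x y hx hy) hxy] := forms_subsp k.
  transitivity (a *: val (indhomog k x : dhomog 3 K k) + val (indhomog k y : dhomog 3 K k)).
    by rewrite !inK.
  by [].
- move=> c; exists (val (g c)); first exact: dhomog_is_dhomog.
  rewrite -[RHS]gK; congr (f _); apply: val_inj; rewrite inK //.
  exact: dhomog_is_dhomog.
- move=> x hx; have f0 : f 0 = 0.
    by have := flin (-1) 0 0; rewrite scaler0 addr0 scaleN1r addNr.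
  split=> [e|->].
    have : indhomog k x = 0 :> dhomog 3 K k by apply: (can_inj fK); rewrite e f0.
    by move/(congr1 val); rewrite inK.
  by rewrite -[RHS]f0; congr (f _); apply: val_inj; rewrite inK //; apply: dhomog0.
Qed.

Lemma sub_dim_exists k (W : set S) : subsp W ->
  exists2 n, qdim (forms k) W n & qdim (forms k `&` W) [set 0] ('C(k + 2, k) - n).
Proof.
move=> hW; have hU := subspI (forms_subsp k) hW.
have [||a [b [da db e]]] := @dim_sub _ _ (forms k) (forms k `&` W) [set 0] _
    (forms_subsp k) hU (set0_subsp _) _ _ (forms_dim k).
- by move=> x [].
- by move=> _ ->; split; [case: (forms_subsp k) | case: hW].
exists a; last by rewrite e addKn.
apply: (dim_eq (forms_subsp k) hU hW) da => x hx; split=> [[]//|Wx]; by split.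
Qed.

End Forms.

(** * Contracted localizations and Hilbert functions *)

Section Primary.
Variable K : numClosedFieldType.
Local Notation S := {mpoly K[3]}.
Variable I : set S.
Hypotheses (hI : homogeneous_ideal I) (eI : eliminable I).

Let I0 : I 0. Proof. by case: hI => -[]. Qed.
Let ID a b : I a -> I b -> I (a + b). Proof. by case: hI => -[_ h _] _; apply: h. Qed.
Let IM a b : I b -> I (a * b). Proof. by case: hI => -[_ _ h] _; apply: h. Qed.

(* The contraction to S of the localization of I at p. *)
Definition primary (p : 'rV[K]_3) : set S :=
  [set g | exists M h, [/\ h \is M.-homog, h.@[p 0] != 0 & I (h * g)]].

Lemma primary_ideal p : is_ideal (primary p).
Proof.
split.
- exists 0%N, 1; rewrite mulr0 meval1 oner_eq0; split=> //; exact: dhomog1.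
- move=> a b [M [h [hh hp Ia]]] [M' [h' [hh' hp' Ib]]].
  exists (M + M')%N, (h * h'); rewrite mevalM mulf_neq0 //; split=> //.
    exact: dhomogM.
  rewrite mulrDr; apply: ID; last by rewrite -mulrA; apply: IM.
  by rewrite [h * h']mulrC -mulrA; apply: IM.
- move=> a b [M [h [hh hp Ib]]]; exists M, h; split=> //.
  by rewrite mulrCA; apply: IM.
Qed.

Lemma sub_primary p : I `<=` primary p.
Proof.
by move=> g Ig; exists 0%N, 1; rewrite mul1r meval1 oner_eq0; split=> //; exact: dhomog1.
Qed.

Lemma primary_cancel (p : 'rV[K]_3) M (h g : S) : h \is M.-homog -> h.@[p 0] != 0 ->
  primary p (h * g) -> primary p g.
Proof.
move=> hh hp [M' [h' [hh' hp' Ig]]]; exists (M' + M)%N, (h' * h).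
by rewrite mevalM mulf_neq0 // -mulrA; split=> //; apply: dhomogM.
Qed.

Lemma primary_not_zero (p : 'rV[K]_3) : proj_points p -> ~ zeros I p -> primary p = setT.
Proof.
move=> pp nz; apply/seteqP; split=> // g _; apply: contrapT => ng; apply: nz; split=> //.
move=> N h hh Ih; apply/eqP/negPn/negP => hp; apply: ng; exists N, h; split=> //.
by rewrite mulrC; apply: IM.
Qed.

Lemma minor_form_primary (p : 'rV[K]_3) i j : p 0 i != 0 -> j != i ->
  exists a, primary p (minor_form p i j ^+ a).
Proof.
move=> pi ji; have [N [u [a [hu up Iu]]]] := eliminable_point eI pi ji.
by exists a, N, u.
Qed.

(** Powers of the linear forms through [q] eventually lie in [primary q], and one of these forms
    avoids [p]. *)
Lemma primary_separate (p q : 'rV[K]_3) : proj_points p -> proj_points q -> p != q ->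
  exists M e, [/\ e \is M.-homog, e.@[p 0] != 0 & primary q e].
Proof.
move=> pp pq npq; have [i qi] := row_neq0_entry (proj_point_neq0 pq).
have [j nj] : exists j, (minor_form q i j).@[p 0] != 0.
  apply: contrapT => h; case/eqP: npq; apply: proj_point_uniq => // k l.
  have e m : q 0 i * p 0 m = q 0 m * p 0 i.
    apply/eqP; rewrite -subr_eq0; apply/negPn/negP => nm; apply: h; exists m.
    by rewrite /minor_form mevalB !mevalZ !mevalXU.
  apply: (mulfI qi); rewrite !mulrA !e; ring.
have ji : j != i.
  by apply: contraNneq nj => ->; rewrite /minor_form subrr meval0.
have [a ha] := minor_form_primary qi ji.
exists (1 * a)%N, (minor_form q i j ^+ a); split=> //.
  by apply: dhomogMn; apply: minor_form_homog.
by rewrite rmorphXn /= expf_neq0.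
Qed.

Lemma primary_separate_seq (p : 'rV[K]_3) (s : seq 'rV[K]_3) : proj_points p ->
  (forall q, q \in s -> proj_points q) -> p \notin s ->
  exists M e, [/\ e \is M.-homog, e.@[p 0] != 0 & forall q, q \in s -> primary q e].
Proof.
move=> pp; elim: s => [|q s IH] hs ps.
  by exists 0%N, 1; rewrite meval1 oner_eq0; split=> //; apply: dhomog1.
have [pq ps'] : p != q /\ p \notin s by move: ps; rewrite inE negb_or => /andP[].
have [M [e [he ep hq]]] := primary_separate pp (hs q (mem_head _ _)) pq.
have [|M' [e' [he' ep' hs']]] := IH _ ps'.
  by move=> q' q's; apply: hs; rewrite inE q's orbT.
exists (M + M')%N, (e * e'); rewrite mevalM mulf_neq0 //; split=> //.
  exact: dhomogM.
move=> q'; rewrite inE => /orP[/eqP ->|/hs' h].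
  by have [_ _ h] := primary_ideal q; rewrite mulrC; apply: h.
by have [_ _ h'] := primary_ideal q'; apply: h'.
Qed.

End Primary.

Section HilbertFunction.
Variable K : numClosedFieldType.
Local Notation S := {mpoly K[3]}.
Variable I : set S.
Hypotheses (hI : homogeneous_ideal I) (eI : eliminable I).

Let iI : is_ideal I. Proof. by case: hI. Qed.
Let I0 : I 0. Proof. by case: hI => -[]. Qed.
Let ID a b : I a -> I b -> I (a + b). Proof. by case: hI => -[_ h _] _; apply: h. Qed.
Let IM a b : I b -> I (a * b). Proof. by case: hI => -[_ _ h] _; apply: h. Qed.
Let Ih g k : I g -> I (pihomog mdeg k g). Proof. by case: hI => _; apply. Qed.

Local Notation W := (primary I).

Let sI : subsp I := ideal_subsp iI.
Let sW p : subsp (W p) := ideal_subsp (primary_ideal hI p).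
Let sF k := @forms_subsp K k.

Lemma zeros_scale (p : 'rV[K]_3) N (h : S) (c : K) : p != 0 -> c != 0 -> h \is N.-homog ->
  h.@[(c *: p) 0] != 0 -> h.@[p 0] != 0.
Proof.
by move=> p0 c0 hh; rewrite (meval_scale _ _ hh) mulf_eq0 expf_eq0 (negPf c0) andbF.
Qed.

(** [I] together with a linear form [l] that avoids its zeros contains all forms of large degree, so
    multiplication by [l] is onto between consecutive graded pieces of the quotient. Their
    dimensions then decrease to a constant, from which point multiplication by [l] is injective
    too. *)
Lemma hilbert_stable : exists (l : S) k0, [/\ l \is 1.-homog,
  forall p, zeros I p -> l.@[p 0] != 0,
  forall k g, (k0 <= k)%N -> g \is k.+1.-homog ->
    exists2 x, x \is k.-homog & I (g - l * x)
  & exists N, forall k, (k0 <= k)%N -> qdim (forms k) I N /\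
     forall g, g \is k.-homog -> I (l * g) -> I g].
Proof.
have [z [uz hz]] := zeros_finite eI.
have [p /hz [/proj_point_neq0 //]|lam hlam] := @linear_form_avoiding K z.
set l := linear_form lam in hlam; have hl : l \is 1.-homog by apply: linear_form_homog.
have lz p : zeros I p -> l.@[p 0] != 0 by move=> /hz; apply: hlam.
have iJ := ideal_adj_ideal l iI.
have [|n0 hn0] := pow_in_forms iJ.
  apply: nullstellensatz => //; first exact: eliminable_sub (@sub_ideal_adj _ I l) eI.
  move=> p p0; have [[c [c0 cz]]|nz] := pselect (exists c, c != 0 /\ zeros I (c *: p)).
    exists 1%N, l; split=> //; first exact: ideal_adj_mem.
    exact: zeros_scale p0 c0 hl (lz _ cz).
  have [|N [g [hg Ig gp]]] := @not_zero_witness _ I p p0.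
    by move=> c c0 cz; apply: nz; exists c.
  by exists N, g; split=> //; apply: sub_ideal_adj.
have surj k g : (n0 <= k)%N -> g \is k.+1.-homog -> exists2 x, x \is k.-homog & I (g - l * x).
  move=> nk hg; have [y [w [Iy e]]] := hn0 k.+1 g (leqW nk) hg.
  exists (pihomog mdeg k w); first exact: pihomogP.
  rewrite -(pihomog_dE hg) e raddfD /= -(addn1 k) (pihomogM _ _ hl) [l * _]mulrC addrK.
  exact: Ih.
have nex k : exists n, `[< qdim (forms k) I n >].
  by have [n dn _] := sub_dim_exists k sI; exists n; apply/asboolP.
pose nn k := xchoose (nex k).
have hnn k : qdim (forms k) I (nn k) by apply/asboolP; exact: (xchooseP (nex k)).
pose U k : set S := [set g | g \is k.-homog /\ I (l * g)].
have sU k : subsp (U k).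
  split; first by split; [exact: dhomog0 | rewrite mulr0].
  move=> a x y [hx Ix] [hy Iy]; split; first by rewrite rpredD // dhomogZ.
  by rewrite mulrDr -scalerAr; case: sI => _; apply.
have dU k : (n0 <= k)%N -> exists b, qdim (U k) (forms k `&` I) b /\ nn k = (nn k.+1 + b)%N.
  move=> nk.
  have d1 : qdim (forms k) (U k) (nn k.+1).
    apply: (@dim_pullback _ _ _ (forms k) (U k) (forms k.+1) I (fun x => l * x)) => //.
    - by move=> a x y _ _; rewrite mulrDr scalerAr.
    - by move=> x hx; rewrite /forms /= -(add1n k); apply: dhomogM.
    - by move=> x hx; split=> [[]|].
    - by move=> y hy; exact: surj.
  have sIk := subspI (sF k) sI.
  have [|||a [b [da db e]]] := @dim_sub _ _ (forms k) (U k) (forms k `&` I) (nn k) (sF k) (sU k) sIk.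
  - by move=> x [].
  - by move=> x [hx Ix]; split=> //; apply: IM.
  - by apply: (dim_eq (sF k) sI sIk) (hnn k) => x hx; split=> [|[]].
  by exists b; split; last by rewrite e (dim_uniq (sF k) (sU k) da d1).
have [k0 [nk0 kmin]] : exists k0, (n0 <= k0)%N /\ forall k, (n0 <= k)%N -> (nn k0 <= nn k)%N.
  have ex : exists m, `[< exists k, (n0 <= k)%N /\ nn k = m >].
    by exists (nn n0); apply/asboolP; exists n0.
  have := ex_minnP ex => -[m /asboolP[k [nk <-]] mmin].
  by exists k; split=> // k' nk'; apply: mmin; apply/asboolP; exists k'.
have const k : (k0 <= k)%N -> nn k = nn k0.
  move=> /subnK <-; elim: (k - k0)%N => [//|j IH].
  have nk : (n0 <= j + k0)%N by apply: leq_trans nk0 (leq_addl _ _).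
  have [b [_ e]] := dU _ nk; have := kmin _ (leqW nk); rewrite addSn; lia.
exists l, k0; split=> //; first by move=> k g kk; apply: surj; apply: leq_trans nk0 kk.
exists (nn k0) => k kk; split; first by rewrite -(const k kk).
move=> g hg Ig; have [b [db e]] := dU k (leq_trans nk0 kk).
have b0 : b = 0%N by have := const _ (leqW kk); have := const _ kk; lia.
rewrite b0 in db.
by have [] := dim0_sub (sU k) (subspI (sF k) sI) db (conj hg Ig).
Qed.

(** Multiplication by [l] is onto already modulo [I], and injective modulo [primary I p] because [l]
    does not vanish at [p]. *)
Lemma primary_dim : exists k0 (w : 'rV[K]_3 -> nat), forall p, zeros I p ->
  forall k, (k0 <= k)%N -> qdim (forms k) (W p) (w p).
Proof.
have [l [k0 [hl lz surj _]]] := hilbert_stable; exists k0.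
have ex p : exists w, qdim (forms k0) (W p) w.
  by have [w dw _] := sub_dim_exists k0 (sW p); exists w.
have [w hw] := choice ex; exists w => p zp k /subnK <-.
elim: (k - k0)%N => [//|j IH]; have kj : (k0 <= j + k0)%N by rewrite leq_addl.
apply: (@dim_pushforward _ _ _ _ _ (forms (j + k0).+1) (W p) (fun x => l * x)) IH => //.
- by move=> a x y _ _; rewrite mulrDr scalerAr.
- by move=> x hx; rewrite /forms /= -(add1n (j + k0)); apply: dhomogM.
- move=> x hx; split=> [Wx|]; last exact: primary_cancel hl (lz p zp).
  by have [_ _ h] := primary_ideal hI p; apply: h.
- move=> y hy; have [x hx e] := surj _ _ kj hy; exists x => //.
  exact: sub_primary.
Qed.

(** Multiplication by [e] is injective modulo [primary I p] between spaces of equal dimension. The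
    bound [k0] depends neither on [p] nor on [e]. *)
Lemma primary_mul_surj : exists k0, forall p M (e : S), zeros I p ->
  e \is M.-homog -> e.@[p 0] != 0 -> forall k y, (k0 <= k)%N -> y \is (M + k).-homog ->
  exists2 x, x \is k.-homog & W p (y - e * x).
Proof.
have [k0 [w hw]] := primary_dim; exists k0 => p M e zp he ep k y kk hy.
have s' := subspI (sF (M + k)) (sW p).
have fM x : x \is k.-homog -> e * x \is (M + k).-homog by apply: dhomogM.
suff [x hx [_ Wx]] : exists2 x, forms k x & (forms (M + k) `&` W p) (y - e * x) by exists x.
apply: (@dim_inj_surj _ _ _ (forms k) (W p) (forms (M + k))
  (forms (M + k) `&` W p) (fun x => e * x) (w p)) => //.
- by move=> a x x' _ _; rewrite mulrDr scalerAr.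
- move=> x hx; split=> [Wx|[_]]; last exact: primary_cancel he ep.
  by split; [exact: fM | have [_ _ h] := primary_ideal hI p; apply: h].
- exact: (hw p zp k kk).
- apply: (dim_eq (sF _) (sW p) s') (hw p zp (M + k)%N _) => [x hx|]; first by split=> [|[]].
  by apply: leq_trans kk (leq_addl _ _).
Qed.

(** The ideal of all [h] with [h * g] in [I] has a form that does not vanish at each given zero; by
    the Nullstellensatz it contains a power of [l], which cancels in large degrees. *)
Lemma primary_inter : exists k0, forall k g, (k0 <= k)%N -> g \is k.-homog ->
  (forall p, zeros I p -> W p g) -> I g.
Proof.
have [l [k0 [hl lz surj [N hN]]]] := hilbert_stable; exists k0 => k g kk hg hW.
pose J : set S := [set h | I (h * g)].
have IJ : I `<=` J by move=> h Ih'; rewrite /J /= mulrC; apply: IM.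
have iJ : is_ideal J.
  split; rewrite /J /= ?mul0r //.
  - by move=> a b; rewrite mulrDl; apply: ID.
  - by move=> a b h; rewrite -mulrA; apply: IM.
have [|n hn] := pow_in_forms iJ.
  apply: nullstellensatz => //; first exact: eliminable_sub IJ eI.
  move=> p p0; have [[c [c0 cz]]|nz] := pselect (exists c, c != 0 /\ zeros I (c *: p)).
    have [M [h [hh hp Jh]]] := hW _ cz.
    by exists M, h; split=> //; apply: zeros_scale p0 c0 hh hp.
  have [|M [h [hh Ih' hp]]] := @not_zero_witness _ I p p0.
    by move=> c c0 cz; apply: nz; exists c.
  by exists M, h; split=> //; apply: IJ.
have : I (l ^+ n * g) by apply: (hn n) => //; have := dhomogMn n hl; rewrite mul1n.
elim: n {hn} => [|n IH]; first by rewrite expr0 mul1r.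
rewrite exprS -mulrA => h; apply: IH.
have [_ inj] := hN (n + k)%N (leq_trans kk (leq_addl _ _)).
by apply: inj => //; apply: dhomogM => //; have := dhomogMn n hl; rewrite mul1n.
Qed.

(** A Chinese remainder theorem: [key] adds one zero [p] at a time, reaching every class at [p] by
    multiples of a form [e] that lies in the other contractions and does not vanish at [p]. *)
Lemma hilbert_points : exists z N k0 (w : 'rV[K]_3 -> nat),
  [/\ uniq z, forall p, p \in z <-> zeros I p,
      forall k, (k0 <= k)%N -> qdim (forms k) I N,
      forall p, p \in z -> forall k, (k0 <= k)%N -> qdim (forms k) (W p) (w p)
    & N = (\sum_(p <- z) w p)%N].
Proof.
have [z [uz hz]] := zeros_finite eI.
have [l0 [k1 [_ _ _ [N hN]]]] := hilbert_stable.
have [k2 [w hw]] := primary_dim; have [k3 hmul] := primary_mul_surj.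
have [k4 hint] := primary_inter.
pose Q (s : seq 'rV[K]_3) : set S := [set g | forall p, p \in s -> W p g].
have sQ s : subsp (Q s).
  split=> [p _|a x y hx hy p ps]; first by case: (sW p).
  by have [_ h] := sW p; apply: h; [apply: hx | apply: hy].
have key s : uniq s -> {subset s <= z} ->
    exists k0, forall k, (k0 <= k)%N -> qdim (forms k) (Q s) (\sum_(p <- s) w p)%N.
  elim: s => [|p s IH] us sz.
    exists 0%N => k _; rewrite big_nil; apply: dim_0 => //.
  have /andP[ps us'] := us.
  have [|k5 h5] := IH us'; first by move=> q qs; apply: sz; rewrite inE qs orbT.
  have zp : zeros I p by apply/hz/sz; rewrite mem_head.
  have [pp _] := zp.
  have [|M [e [he ep eW]]] := @primary_separate_seq _ I hI eI p s pp _ ps.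
    by move=> q qs; have /hz[] : q \in z by apply: sz; rewrite inE qs orbT.
  exists (M + k3 + k5 + k2)%N => k kk.
  have sU := subspI (sF k) (sQ s).
  have sUW := subspI sU (sW p).
  have d1 : qdim (forms k) (forms k `&` Q s) (\sum_(q <- s) w q)%N.
    apply: (dim_eq (sF k) (sQ s) sU) (h5 k _) => [x hx|]; first by split=> [|[]].
    by apply: leq_trans kk; rewrite -addnA addnCA leq_addr.
  have d2 : qdim (forms k `&` Q s) (W p) (w p).
    apply: (@dim_pullback _ _ _ (forms k `&` Q s) (W p) (forms k) (W p) id) => //.
    - by move=> x [].
    - move=> y hy; have Mk : (M <= k)%N.
        by apply: leq_trans kk; rewrite -!addnA leq_addr.
      have [||x hx Wx] := hmul p M e zp he ep (k - M)%N y.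
      + by rewrite leq_subRL //; apply: leq_trans kk; rewrite -[X in (_ <= X)%N]addnA leq_addr.
      + by rewrite subnKC.
      + exists (e * x) => //; split; first by rewrite -(subnKC Mk); apply: dhomogM.
        move=> q qs; rewrite mulrC; have [_ _ h] := primary_ideal hI q.
        exact/h/eW.
    - by apply: (hw p zp k); apply: leq_trans kk; rewrite leq_addl.
  have d2' : qdim (forms k `&` Q s) (forms k `&` Q s `&` W p) (w p).
    by apply: (dim_eq sU (sW p) sUW) d2 => x hx; split=> [|[]].
  rewrite big_cons addnC.
  have d3 := dim_add (sF k) sU sUW (fun x h => h.1) (fun x h => h.1) d1 d2'.
  apply: (dim_eq (sF k) sUW (sQ _)) d3 => x hx; split=> [[[_ hs] hp] q|h].
    by rewrite inE => /orP[/eqP -> //|/hs].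
  split; last by apply: h; rewrite mem_head.
  by split=> // q qs; apply: h; rewrite inE qs orbT.
have [k5 h5] := key z uz (fun _ => id).
pose k0 := (k1 + k2 + k4 + k5)%N.
have [l1 l2 l4 l5] : [/\ (k1 <= k0)%N, (k2 <= k0)%N, (k4 <= k0)%N & (k5 <= k0)%N].
  by rewrite /k0; split; lia.
exists z, N, k0, w; split=> //.
- by move=> k kk; have [] := hN k (leq_trans l1 kk).
- by move=> p /hz zp k kk; apply: (hw p zp k); apply: leq_trans kk.
- have [d1 _] := hN k0 l1; apply: (dim_uniq (sF k0) sI d1).
  apply: (dim_eq (sF k0) (sQ z) sI) (h5 k0 l5) => x hx; split=> [hQ|Ix p pz].
    by apply: (hint k0) => // p /hz; apply: hQ.
  exact: sub_primary.
Qed.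

End HilbertFunction.

Local Notation "x %:F" := (@tofrac _ x).

(** * Lengths of local rings *)

Section FractionModule.
Variable K : fieldType.
Local Notation A2 := {mpoly K[2]}.

(** A copy of the fraction field carrying the scalar action of [local_dim], so that the results on
    dimensions apply. *)
Definition frac_lmod := {fraction A2}.

HB.instance Definition _ := GRing.Field.on frac_lmod.

Definition frac_scale_op (c : K) (x : frac_lmod) : frac_lmod := (c%:MP)%:F * x.

Lemma frac_scaleA a b v : frac_scale_op a (frac_scale_op b v) = frac_scale_op (a * b) v.
Proof. by rewrite /frac_scale_op mulrA -tofracM -mpolyCM. Qed.

Lemma frac_scale1 : left_id 1 frac_scale_op.
Proof. by move=> v; rewrite /frac_scale_op mpolyC1 tofrac1 mul1r. Qed.

Lemma frac_scaleDr : right_distributive frac_scale_op +%R.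
Proof. by move=> a u v; rewrite /frac_scale_op mulrDr. Qed.

Lemma frac_scaleDl v : {morph frac_scale_op^~ v : a b / a + b}.
Proof. by move=> a b; rewrite /frac_scale_op mpolyCD tofracD mulrDl. Qed.

HB.instance Definition _ := GRing.Zmodule_isLmodule.Build K frac_lmod
  frac_scaleA frac_scale1 frac_scaleDr frac_scaleDl.

Lemma frac_lmod_scaleE (c : K) (x : frac_lmod) : c *: x = (c%:MP)%:F * x :> {fraction A2}.
Proof. by []. Qed.

Variable P : set A2.
Hypothesis hP : prime_ideal P.

Let F0 k : ~ P k -> k%:F != 0.
Proof. by move=> nk; rewrite tofrac_eq0 (prime_ideal_neq0 hP nk). Qed.

Lemma loc_ideal_subsp (I : set A2) : is_ideal I ->
  subsp (loc_ideal P I : set frac_lmod).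
Proof.
move=> [I0 ID IM]; split.
  exists 0, 1; rewrite tofrac0 mul0r; split=> //; by case: hP.
move=> a _ _ [g [h [Ig nh ->]]] [g' [h' [Ig' nh' ->]]].
exists (g * h' * a%:MP + g' * h * 1), (h * h'); split.
- by apply: ID; rewrite mulrC; apply: (IM); rewrite mulrC; apply: (IM).
- exact: prime_idealNM.
- rewrite frac_lmod_scaleE tofracD !tofracM tofrac1.
  by rewrite -(frac_comb _ _ _ _ (F0 nh) (F0 nh')) mulr1 mulrC.
Qed.

Lemma loc_subsp : subsp (loc P : set frac_lmod).
Proof.
have -> : (loc P : set frac_lmod) = loc_ideal P setT.
  apply/seteqP; split=> [x [g [h [nh e]]]|x [g [h [_ nh e]]]]; by exists g, h.
by apply: loc_ideal_subsp.
Qed.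

Lemma local_dimE (I : set A2) (q : 'I_2 -> K) n : P = max_ideal q -> is_ideal I ->
  is_dim (fun c x => c *: x) (loc P : set frac_lmod) (loc_ideal P I) n -> local_dim I q = n.
Proof.
move=> eP iI dn; rewrite /local_dim /dimq -eP.
have h := @xgetPex nat 0%N [set n | is_dim
  (fun (c : K) (x : {fraction A2}) => (c%:MP)%:F * x) (loc P) (loc_ideal P I) n].
apply: (dim_uniq loc_subsp (loc_ideal_subsp iI) _ dn).
by apply: h; exists n.
Qed.

End FractionModule.

Section LocalDimension.
Variable K : numClosedFieldType.
Local Notation S := {mpoly K[3]}.
Local Notation A2 := {mpoly K[2]}.

Lemma max_ideal_prime (q : 'I_2 -> K) : prime_ideal (max_ideal q : set A2).
Proof.
split; rewrite /max_ideal /=.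
- split=> /= [|a b ha hb|a b hb]; first exact: meval0.
    by rewrite mevalD ha hb addr0.
  by rewrite mevalM hb mulr0.
- by rewrite meval1 => /eqP; rewrite oner_eq0.
- by move=> a b; rewrite mevalM => /eqP; rewrite mulf_eq0 => /orP[] /eqP; [left|right].
Qed.

Lemma chart_neq0 (p : 'rV[K]_3) : p != 0 -> p 0 (chart p) != 0.
Proof.
move=> /row_neq0_entry[i pi]; rewrite /chart; case: pickP => //= h.
by have := h i; rewrite pi.
Qed.

Variable I : set S.
Hypotheses (hI : homogeneous_ideal I) (eI : eliminable I).
Variables (p : 'rV[K]_3) (i : 'I_3).
Hypotheses (pi : p 0 i != 0).

Let iI : is_ideal I. Proof. by case: hI. Qed.
Local Notation q := (aff i p).
Local Notation m := (max_ideal q).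

Lemma dehom_notin N (h : S) : h \is N.-homog -> (~ m (dehom i h)) <-> h.@[p 0] != 0.
Proof.
move=> hh; rewrite (dehom_meval pi hh) mulf_eq0 expf_eq0 (negPf pi) andbF /max_ideal /=.
by split=> [/eqP|/eqP].
Qed.

(** Returning from the chart to forms costs a homogenized denominator and a power of ['X_i], neither
    of which vanishes at [p]. *)
Lemma primary_loc N (x : S) : x \is N.-homog ->
  primary I p x <-> loc_ideal m (V_ I i) (dehom i x)%:F.
Proof.
move=> hx; have [I0 ID IM] := iI; split=> [[M [h [hh hp Ih]]]|[g [h [[g0 Ig0 eg] nh e]]]].
  have nh := (dehom_notin hh).2 hp.
  have h0 : dehom i h != 0 by apply: prime_ideal_neq0 (max_ideal_prime q) nh.
  exists (dehom i (h * x)), (dehom i h); split=> //; first by exists (h * x).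
  by rewrite rmorphM tofracM mulrAC divff ?mul1r // tofrac_eq0.
have h0 : h != 0 by apply: prime_ideal_neq0 (max_ideal_prime q) nh.
have e' : h * dehom i x = dehom i g0.
  apply/eqP; rewrite -tofrac_eq tofracM e eg mulrCA divff ?mulr1 //.
  by rewrite tofrac_eq0.
have [nH /(_ nH (leqnn _))[H hH eH]] := dehom_surj i h.
have Hp : H.@[p 0] != 0 by apply/(dehom_notin hH); rewrite eH.
pose G := homogenize i (msize g0) g0.
have IG : I G by apply: homogenize_ideal.
have hG : G \is (msize g0).-homog by apply: homogenize_homog.
have eG : dehom i (H * x) = dehom i G by rewrite rmorphM /= eH e' dehom_homogenize.
have := dehom_homog_eq (dhomogM hH hx) hG eG => e2.
exists (msize g0 + nH)%N, ('X_i ^+ msize g0 * H); split.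
- by apply: dhomogM => //; apply: dhomogXn.
- by rewrite mevalM rmorphXn /= mevalXU mulf_neq0 ?expf_neq0.
- by rewrite -mulrA e2; apply: IM.
Qed.

Lemma local_dim_primary w k0 : zeros I p ->
  (forall k, (k0 <= k)%N -> qdim (forms k) (primary I p) w) ->
  local_dim (V_ I i) q = w.
Proof.
move=> zp hw; have [k1 hmul] := primary_mul_surj hI eI.
pose k := (k0 + k1)%N; have hm := max_ideal_prime q.
have iV : is_ideal (V_ I i) by apply: V_ideal.
apply: (local_dimE hm erefl iV).
have dk : qdim (forms k) (primary I p) w by apply: hw; rewrite leq_addr.
apply: (@dim_pushforward K S (frac_lmod K) (forms k) (primary I p) (loc m)
  (loc_ideal m (V_ I i)) (fun x => (dehom i x)%:F)) dk.
- exact: forms_subsp.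
- exact/ideal_subsp/primary_ideal.
- exact: loc_subsp hm.
- exact: loc_ideal_subsp.
- move=> a x y _ _; rewrite -mul_mpolyC rmorphD rmorphM /= dehomC tofracD tofracM.
  by [].
- move=> x hx; exists (dehom i x), 1; split; last by rewrite tofrac1 divr1.
  by case: hm.
- by move=> x hx; apply: primary_loc hx.
move=> y [g [h [nh ->]]].
have [nG hG] := dehom_surj i g; have [nH hH] := dehom_surj i h.
(* [h] and [g] are homogenized in degrees that differ by [k]; solving [G = H * x] modulo
   [primary I p] yields a form [x] of degree [k] that represents [g / h]. *)
have [H HH eH] := hH (nG + nH)%N (leq_addl _ _).
have [G GG eG] := hG (nG + nH + k)%N (leq_trans (leq_addr nH nG) (leq_addr _ _)).
have Hp : H.@[p 0] != 0 by apply/(dehom_notin HH); rewrite eH.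
have [||x hx] := hmul p _ H zp HH Hp k G; [by rewrite leq_addl | by [] |].
have hGH : G - H * x \is (nG + nH + k).-homog by rewrite rpredB //; apply: dhomogM.
move/(primary_loc hGH) => [g' [h' [Ig' nh' e]]]; exists x => //.
exists g', (h' * h); split=> //; first exact: prime_idealNM.
have hF : h%:F != 0 by rewrite tofrac_eq0 (prime_ideal_neq0 hm nh).
rewrite tofracM invfM mulrA -e rmorphB rmorphM /= eG eH tofracB tofracM.
by rewrite mulrBl [h%:F * _]mulrC mulfK.
Qed.

Lemma local_dim_not_zero : proj_points p -> ~ zeros I p -> local_dim (V_ I i) q = 0%N.
Proof.
move=> pp nz; have hm := max_ideal_prime q; have iV : is_ideal (V_ I i) by apply: V_ideal.
have Wp := primary_not_zero hI pp nz.
apply: (local_dimE hm erefl iV); apply: dim_0.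
- move=> y [g [h [nh ->]]].
  have : primary I p 1 by rewrite Wp.
  move/(primary_loc (dhomog1 _ _)); rewrite rmorph1 tofrac1 => -[g' [h' [[g0 Ig0 eg] nh' e]]].
  exists (g' * g), (h' * h); split.
  + exists (g0 * lift_var i g); last by rewrite rmorphM /= eg dehom_lift_var.
    by have [_ _ IM] := iI; rewrite mulrC; apply: IM.
  + exact: prime_idealNM.
  + by rewrite !tofracM invfM mulrACA -e mul1r.
- exact: loc_subsp hm.
- exact: loc_ideal_subsp.
Qed.

End LocalDimension.

Section DegreeOfScheme.
Variable K : numClosedFieldType.
Local Notation S := {mpoly K[3]}.

(** The set [D] is left free because the degree of a scheme sums over all points and the Tjurina
    number over the points of the curve. *)
Lemma hilbert_degree (I : set S) : homogeneous_ideal I -> eliminable I ->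
  exists N k0, (forall k, (k0 <= k)%N -> qdim (forms k) I N) /\
    forall D : set 'rV[K]_3, zeros I `<=` D -> D `<=` @proj_points K ->
      (\sum_(p \in D) local_dim (V_ I (chart p)) (aff (chart p) p))%N = N.
Proof.
move=> hI eI; have [z [N [k0 [w [uz hz hN hw Nw]]]]] := hilbert_points hI eI.
exists N, k0; split=> // D zD Dp.
rewrite Nw; transitivity (\sum_(p \in [set` z]) local_dim (V_ I (chart p)) (aff (chart p) p))%N.
  symmetry; apply: fsbig_widen => [p /hz /zD //|p [Dp' /= nz]].
  apply: local_dim_not_zero => //; [exact/chart_neq0/proj_point_neq0/Dp | exact: Dp |].
  by move/hz.
rewrite -fsbig_seq //; rewrite [LHS]big_seq [RHS]big_seq; apply: eq_bigr => p pz.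
have zp := (hz p).1 pz; have [pp _] := zp.
apply: (@local_dim_primary _ I hI eI p _ _ (w p) k0) => //.
  exact/chart_neq0/proj_point_neq0.
exact: hw.
Qed.

End DegreeOfScheme.

(** * The Jacobian ideal and the Tjurina number *)

Section Jacobian.
Variables (K : numClosedFieldType).
Local Notation S := {mpoly K[3]}.
Variables (d : nat) (f : S).
Hypotheses (d_gt0 : (0 < d)%N) (f_homog : f \is d.-homog) (f_neq0 : f != 0).
Hypothesis f_reduced : reduced_equation f.

Lemma submm n (m : 'X_{1..n}) : (m - m = 0)%MM.
Proof. by apply/mnmP => j; rewrite mnmBE subnn mnm0E. Qed.

Lemma mderiv_dehom (i : 'I_3) (g : S) j : (dehom i g)^`M(j) = dehom i g^`M(lift i j).
Proof.
elim/mpoly_ring_ind: g => [c|k|p q hp hq|p q hp hq].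
- by rewrite dehomC !mderivC rmorph0.
- case: (unliftP i k) => [l|] ->.
    rewrite dehomX !mderivX !mnm1E dehomZ; case: (eqVneq l j) => [->|lj].
      by rewrite eqxx !scale1r !submm !mpolyX0 rmorph1.
    by rewrite (inj_eq lift_inj) (negPf lj) !scale0r.
  by rewrite dehomXi -mpolyC1 mderivC mderivX mnm1E (negPf (neq_lift _ _)) scale0r rmorph0.
- by rewrite rmorphD !mderivD hp hq rmorphD.
- by rewrite rmorphM !mderivM hp hq rmorphD !rmorphM.
Qed.

Lemma jac_f : jac f f.
Proof.
have [_ _ JM] := jac_ideal f.
suff h : jac f (d%:R * f) by have := JM (d%:R)^-1 _ h; rewrite mulKr // mpoly_natr_unit.
rewrite -(euler f_homog).
by exists (\row_j 'X_j); rewrite /dot; apply: eq_bigr => i _; rewrite !mxE.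
Qed.

(** Euler's formula is used in both directions: it puts [f] in the Jacobian ideal and, in the chart,
    expresses the derivative along ['X_i] through [f] and the two others. *)
Lemma jac_chart i : let g := dehom i f in
  gen setT [:: g; g^`M(0); g^`M(1)] = V_ (jac f) i.
Proof.
move=> g; have iV : is_ideal (V_ (jac f) i) by apply/V_ideal/jac_ideal.
have [V0 VD VM] := iV.
have dV j : V_ (jac f) i g^`M(j).
  rewrite mderiv_dehom; exists f^`M(lift i j) => //.
  by have := jac_grad f (lift i j); rewrite mxE.
apply/seteqP; split=> [x [c [_ ->]]|_ [_ [c ->] <-]].
  rewrite /= !big_ord_recl big_ord0 addr0; apply: (VD); [|apply: (VD)]; apply: (VM); last exact: dV.
  - by exists f => //; apply: jac_f.
  - exact: dV.
pose G : set {mpoly K[2]} := gen setT [:: g; g^`M(0); g^`M(1)].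
have iG : is_ideal G.
  split.
  - by exists (fun _ => 0); split=> //; rewrite big1 // => j _; rewrite mul0r.
  - move=> _ _ [a [_ ->]] [b [_ ->]]; exists (fun j => a j + b j); split=> //.
    by rewrite -big_split; apply: eq_bigr => j _; rewrite mulrDl.
  - move=> a _ [b [_ ->]]; exists (fun j => a * b j); split=> //.
    by rewrite big_distrr; apply: eq_bigr => j _; rewrite -mulrA.
have [G0 GD GM] := iG.
have memG (j : nat) : (j < 3)%N -> G [:: g; g^`M(0); g^`M(1)]`_j.
  move=> lt; exists (fun l => (l == j)%:R); split=> //=.
  rewrite (bigD1 (Ordinal lt)) //= eqxx mul1r big1 ?addr0 // => l.
  by rewrite -val_eqE /= => /negPf ->; rewrite mul0r.
have Gl j : G (dehom i f^`M(lift i j)).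
  rewrite -mderiv_dehom; case: j => [[|[|//]] hj].
    have -> : Ordinal hj = (0 : 'I_2) by apply: ord_inj.
    exact: (memG 1%N isT).
  have -> : Ordinal hj = (1 : 'I_2) by apply: ord_inj.
  exact: (memG 2%N isT).
have Gi : G (dehom i f^`M(i)).
  have := congr1 (dehom i) (euler f_homog).
  rewrite (bigD1_ord i) //= rmorphD rmorphM /= dehomXi mul1r.
  set s := dehom i (\sum_(_ < _) _) => e.
  have -> : dehom i f^`M(i) = dehom i (d%:R * f) + (-1) * s by rewrite -e; ring.
  apply: (GD); first by rewrite rmorphM; apply: (GM); apply: (memG 0%N).
  apply: (GM); rewrite /s (rmorph_sum (@dehom K i)) /=; elim/big_ind: _ => // j _.
  by rewrite rmorphM; apply: (GM); apply: Gl.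
rewrite -/G /dot (rmorph_sum (@dehom K i)) /=; elim/big_ind: _ => // j _; rewrite rmorphM mxE.
by apply: (GM); case: (unliftP i j) => [l|] ->; [exact: Gl | exact: Gi].
Qed.

Lemma tjurina_hilbert : exists k0, forall k, (k0 <= k)%N ->
  qdim (forms k) (jac f) (tjurina f).
Proof.
have [N [k0 [hN hD]]] := hilbert_degree (jac_homogeneous d_gt0 f_homog)
  (jac_eliminable d_gt0 f_homog f_neq0 f_reduced).
exists k0 => k kk; suff -> : tjurina f = N by apply: hN.
rewrite -(hD (@proj_points K `&` [set p | f.@[p 0] = 0])).
- apply: eq_fsbigr => p _; rewrite /tjurina_at.
  by have := jac_chart (chart p) => /= ->.
- by move=> p [pp h]; split=> //=; apply: (h d) => //; apply: jac_f.
- by move=> p [].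
Qed.

End Jacobian.

(** * The degree formula *)

Section FormDimension.
Variable K : fieldType.
Local Notation S := {mpoly K[3]}.

Lemma forms_codim k (W : set S) n : subsp W -> qdim (forms k) W n ->
  exists2 b, qdim (forms k `&` W) [set 0] b & 'C(k + 2, k) = (n + b)%N.
Proof.
move=> hW dn; have hU := subspI (forms_subsp K k) hW.
have [||a [b [da db e]]] := @dim_sub _ _ (forms k) (forms k `&` W) [set 0] _
    (forms_subsp K k) hU (set0_subsp _) _ _ (forms_dim K k).
- by move=> x [].
- by move=> _ ->; split; [case: (forms_subsp K k) | case: hW].
exists b => //; rewrite e; congr (_ + _)%N.
apply: (dim_uniq (forms_subsp K k) hW) dn.
apply: (dim_eq (forms_subsp K k) hU hW) da => x hx; split=> [[]//|Wx]; by split.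
Qed.

Lemma bin_form_dim k : ('C(k + 2, k) * 2 = (k + 2) * (k + 1))%N.
Proof.
have -> : 'C(k + 2, k) = 'C(k + 2, 2) by rewrite -[RHS]bin_sub ?leq_addl // addnK.
by have := bin_ffact (k + 2) 2; rewrite !addn2 !ffactnS ffactn0 /= muln1 addn1 => <-.
Qed.

End FormDimension.

(** The four binomial coefficients enter doubled, as products. With [d = d'.+1] and [k = r + d + j],
    their degrees are [k], [k + d'], [k - r] and the target degree [r + r + j + 1] of [v_].
    Eliminating [a] makes [j] cancel. *)
Lemma degree_arith (d' r j a N t ck cj cr ce : nat) :
 (ck * 2 = (r + d'.+1 + j + 2) * (r + d'.+1 + j + 1))%N ->
 (cj * 2 = (r + d'.+1 + j + d' + 2) * (r + d'.+1 + j + d' + 1))%N ->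
 (cr * 2 = (d'.+1 + j + 2) * (d'.+1 + j + 1))%N ->
 (ce * 2 = (r + r + j + 1 + 2) * (r + r + j + 1 + 1))%N ->
 (ck + (ck + ck) + t = cj + a)%N -> (a + N = cr + ce)%N ->
 N%:Z = tau_max d'.+1 r - t%:Z.
Proof.
rewrite /tau_max => *. 
have -> : ((d'.+1)%:Z - 1) = d'%:Z by lia.
rewrite expr2.
lia.
Qed.

Section DegreeFormula.
Variables (K : numClosedFieldType).
Local Notation S := {mpoly K[3]}.
Variables (d r : nat) (f : S).
Hypotheses (d_gt0 : (0 < d)%N) (f_homog : f \is d.-homog) (f_neq0 : f != 0).
Hypothesis f_reduced : reduced_equation f.
Hypothesis f_mdr : is_mdr f r.
Variable rho1 : 'rV[S]_3.
Hypotheses (rho1_AR : AR f r rho1) (rho1_neq0 : rho1 != 0).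
Implicit Types (a b m rho : 'rV[S]_3) (w h : S).

Local Notation v := (v_ f rho1).
Local Notation B := (B_ f rho1).

Let rho1_syz : syz f rho1. Proof. by case: rho1_AR. Qed.

Local Notation E3 := (S * S * S)%type.

(** Dimensions are taken over [K], while rows over [S] are scaled by [S]; triples carry the action
    of [K]. *)
Let row3 (t : E3) : 'rV[S]_3 := \row_j tnth [tuple t.1.1; t.1.2; t.2] j.

Let row3E t : [/\ row3 t 0 0 = t.1.1, row3 t 0 1 = t.1.2 & row3 t 0 2%:R = t.2].
Proof. by split; rewrite mxE. Qed.

Let row3_lin (c : K) t t' : row3 (c *: t + t') = c%:MP *: row3 t + row3 t'.
Proof.
apply/rowP => j; rewrite !mxE; case: t t' => [[t0 t1] t2] [[t0' t1'] t2'].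
by case: (ord3P j) => ->; rewrite mul_mpolyC.
Qed.

Let row3_inj : injective row3.
Proof.
move=> [[a0 a1] a2] [[b0 b1] b2] e.
have [/= x0 x1 x2] := row3E (a0, a1, a2); have [/= y0 y1 y2] := row3E (b0, b1, b2).
by move: x0 x1 x2; rewrite e y0 y1 y2 => -> -> ->.
Qed.

Let row3_surj rho : exists t, row3 t = rho.
Proof.
exists (rho 0 0, rho 0 1, rho 0 2%:R); apply/rowP => j; rewrite mxE.
by case: (ord3P j) => ->.
Qed.

Let forms3 k : set E3 := [set t | forall i, row3 t 0 i \is k.-homog].
Let AR3 k : set E3 := [set t | AR f (Posz k) (row3 t)].

Let forms3_subsp k : subsp (forms3 k).
Proof.
split=> [i|c x y hx hy i].
  by rewrite mxE; case: (ord3P i) => ->; apply: dhomog0.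
have -> : row3 (c *: x + y) 0 i = c *: row3 x 0 i + row3 y 0 i.
  by rewrite row3_lin -mul_mpolyC [LHS]mxE [X in X + _ = _]mxE.
by apply: rpredD; [apply: dhomogZ; apply: hx | apply: hy].
Qed.

Let AR3_subsp k : subsp (AR3 k).
Proof.
have [h0 hl] := forms3_subsp k; split.
  split; last exact: h0.
  have -> : row3 0 = 0 by apply/rowP => i; rewrite !mxE; case: (ord3P i) => ->.
  exact: syz0.
move=> c x y [sx hx] [sy hy]; split; last exact: hl.
by rewrite row3_lin; apply: syzD => //; apply: syzZ.
Qed.

Let zero3_subsp : subsp [set 0 : E3]. Proof. exact: set0_subsp. Qed.

Let forms3_dim k : qdim (forms3 k) [set 0] ('C(k + 2, k) + ('C(k + 2, k) + 'C(k + 2, k)))%N.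
Proof.
have sF := @forms_subsp K k; have s0 := set0_subsp (K := K) S.
have [phi [lin sur ker]] := (is_dimP _ sF s0).1 (forms_dim K k).
apply/(is_dimP _ (forms3_subsp k) zero3_subsp).
exists (fun t => row_mx (phi t.1.1) (row_mx (phi t.1.2) (phi t.2))).
have comp t : forms3 k t -> [/\ forms k t.1.1, forms k t.1.2 & forms k t.2].
  by move=> ht; have [e0 e1 e2] := row3E t; split; rewrite /forms /= -?e0 -?e1 -?e2.
split.
- move=> c x y /comp[x0 x1 x2] /comp[y0 y1 y2] /=.
  by rewrite !lin // !scale_row_mx !add_row_mx.
- move=> c; have [x0 h0 e0] := sur (lsubmx c).
  have [x1 h1 e1] := sur (lsubmx (rsubmx c)); have [x2 h2 e2] := sur (rsubmx (rsubmx c)).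
  exists (x0, x1, x2); last by rewrite /= e0 e1 e2 !hsubmxK.
  by move=> i; rewrite mxE; case: (ord3P i) => ->.
- move=> t /comp[t0 t1 t2]; split=> [|-> /=].
    rewrite -[0]row_mx0 => /eq_row_mx[e0]; rewrite -[0 in RHS]row_mx0 => /eq_row_mx[e1 e2].
    case: t t0 t1 t2 e0 e1 e2 => [[a b] c] /= t0 t1 t2 /(ker _ t0) -> /(ker _ t1) -> /(ker _ t2) ->.
    by [].
  by rewrite ((ker 0 _).2 erefl) ?row_mx0 //; case: sF.
Qed.

(** The product with the gradient maps triples of degree [k] onto the part of the Jacobian ideal of
    degree [k + d.-1], with kernel [AR3 k]. *)
Lemma AR_dim_jac k t : qdim (forms (k + d.-1)) (jac f) t ->
  exists2 a, qdim (AR3 k) [set 0] a &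
    ('C(k + 2, k) + ('C(k + 2, k) + 'C(k + 2, k)) + t = 'C(k + d.-1 + 2, k + d.-1) + a)%N.
Proof.
move=> dt; have iJ := jac_ideal f; have sJ := ideal_subsp iJ.
have [b db eb] := forms_codim sJ dt.
have s' := subspI (@forms_subsp K (k + d.-1)) sJ.
have gh i := grad_homog d_gt0 f_homog i.
have dW : qdim (forms3 k) (AR3 k) b.
  apply: (@dim_pullback _ _ _ (forms3 k) (AR3 k) (forms (k + d.-1) `&` jac f) [set 0]
    (fun t => dot (row3 t) (grad f))) db => //.
  - exact: set0_subsp.
  - move=> c x y hx hy; rewrite row3_lin -mul_mpolyC !dotE.
    move: (row3 x) (row3 y) (grad f) => u w g; rewrite !mxE; ring.
  - move=> x hx; split; last by exists (row3 x).
    by apply: rpred_sum => i _; apply: dhomogM; [exact: hx | exact: gh].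
  - by move=> x hx; split=> [[/syzE]//|h]; split; [exact/syzE | exact: hx].
  - move=> y [hy [c ec]]; have [x ex] := row3_surj (row_pihomog k c).
    exists x; first by move=> i; rewrite ex mxE; apply: pihomogP.
    rewrite /= ex; apply/eqP; rewrite subr_eq0; apply/eqP.
    rewrite -(pihomog_dE hy) ec raddf_sum; apply: eq_bigr => i _ /=.
    by rewrite [in RHS]mxE (pihomogM _ _ (gh i)).
have [||a' [a [da' da e]]] := @dim_sub _ _ (forms3 k) (AR3 k) [set 0] _
    (forms3_subsp k) (AR3_subsp k) zero3_subsp _ _ (forms3_dim k).
- by move=> x [].
- by move=> _ ->; case: (AR3_subsp k).
exists a => //; rewrite e eb (dim_uniq (forms3_subsp k) (AR3_subsp k) da' dW).
by rewrite addnAC [(b + t)%N]addnC.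
Qed.

(** Degree [k] of the exact sequence, with [e] the target degree of [v_]; [mu] identifies the kernel
    with the forms of degree [k - r]. *)
Lemma AR_dim_B k e n (a : nat) : (k + r.+1 = e + d)%N -> (r <= k)%N -> qdim (forms e) B n ->
  qdim (AR3 k) [set 0] a -> (a + n = 'C(k - r + 2, k - r) + 'C(e + 2, e))%N.
Proof.
move=> ke rk dn da.
have iB := B_ideal d_gt0 f_homog f_neq0 f_reduced rho1_AR; have sB := ideal_subsp iB.
have vD' := vD d_gt0 f_homog f_neq0 f_reduced rho1_AR.
have vZ' := vZ d_gt0 f_homog f_neq0 f_reduced rho1_AR.
have [b db eb] := forms_codim sB dn.
have s' := subspI (@forms_subsp K e) sB.
have vlin : linear_on (AR3 k) (fun t => v (row3 t) : S).
  move=> c x y [sx _] [sy _]; rewrite row3_lin vD' ?vZ' ?mul_mpolyC //.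
  exact: syzZ.
pose U : set E3 := [set t | AR3 k t /\ v (row3 t) = 0].
have sU : subsp U.
  split=> [|c x y [hx vx] [hy vy]].
    by split; [case: (AR3_subsp k) | apply: linear_on0 (AR3_subsp k) vlin].
  split; first by case: (AR3_subsp k) => _; apply.
  by rewrite (vlin _ _ _ hx hy) vx vy scaler0 addr0.
have dU : qdim (AR3 k) U b.
  apply: (@dim_pullback _ _ _ (AR3 k) U (forms e `&` B) [set 0] (fun t => v (row3 t))) db => //.
  - exact: set0_subsp.
  - move=> x [sx hx]; split; last by exists (row3 x).
    exact: (v_homog d_gt0 f_homog f_neq0 f_reduced rho1_AR (conj sx hx) ke).
  - by move=> x hx; split=> [[]//|h]; split.
  - move=> y [hy By].
    have [rho hrho <-] := B_homog_lift d_gt0 f_homog f_neq0 f_reduced rho1_AR By hy ke.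
    have [x ex] := row3_surj rho; exists x; first by rewrite /AR3 /= ex.
    by rewrite /= ex subrr.
have [rs rh] := rho1_AR.
pose mu (h : S) : E3 := (h * rho1 0 0, h * rho1 0 1, h * rho1 0 2%:R).
have muE h : row3 (mu h) = h *: rho1.
  apply/rowP => j; rewrite !mxE; by case: (ord3P j) => ->.
have dK : qdim U [set 0] 'C(k - r + 2, k - r).
  apply: (@dim_pushforward _ _ _ (forms (k - r)) [set 0] U [set 0] mu) (forms_dim K (k - r)).
  - exact: forms_subsp.
  - exact: set0_subsp.
  - exact: sU.
  - exact: zero3_subsp.
  - move=> c x y _ _; apply: row3_inj; rewrite row3_lin !muE scalerDl -mul_mpolyC.
    by rewrite scalerA.
  - move=> h hh; split; last by rewrite muE vZ' // (v_rho1 d_gt0 f_homog f_neq0 f_reduced rho1_AR) mulr0.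
    rewrite /AR3 /= muE; split; first exact: syzZ.
    by move=> i; rewrite mxE /S_ /= -(subnK rk); apply: dhomogM => //; exact: (rh i).
  - move=> h hh; split=> [-> /=|/= h0].
      by apply: row3_inj; rewrite muE scale0r; apply/rowP => j; rewrite !mxE; case: (ord3P j) => ->.
    apply: (row_scaleI rho1_neq0); rewrite scale0r -muE h0.
    by apply/rowP => j; rewrite !mxE; case: (ord3P j) => ->.
  - move=> y [[sy hy] vy].
    have [h eh] := v_eq0 d_gt0 f_homog f_neq0 f_reduced f_mdr rho1_AR rho1_neq0 sy vy.
    exists h; last by apply/eqP; rewrite subr_eq0; apply/eqP/row3_inj; rewrite muE.
    have [i ri] := row_neq0_entry rho1_neq0.
    apply: (dhomog_div ri (rh i)); rewrite subnK //.
    by have := hy i; rewrite eh mxE.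
have d3 := dim_add (AR3_subsp k) sU zero3_subsp (fun x (y : U x) => y.1) _ dU dK.
have {d3} /(dim_uniq (AR3_subsp k) zero3_subsp da) -> : qdim (AR3 k) [set 0] (b + 'C(k - r + 2, k - r))%N.
  by apply: d3 => _ ->; case: sU.
by rewrite eb addnAC [(b + n)%N]addnC addnC.
Qed.

Lemma degree_formula : (scheme_degree (V_ B))%:Z = tau_max d r - (tjurina f)%:Z.
Proof.
have hB := B_homogeneous d_gt0 f_homog f_neq0 f_reduced rho1_AR.
have eB := B_eliminable d_gt0 f_homog f_neq0 f_reduced f_mdr rho1_AR rho1_neq0.
have [N [k0 [hN hD]]] := hilbert_degree hB eB.
have [k1 hJ] := tjurina_hilbert d_gt0 f_homog f_neq0 f_reduced.
have -> : scheme_degree (V_ B) = N.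
  by apply: (hD (@proj_points K)) => // p [].
(* Large enough for both Hilbert functions to be constant: that of [B] in degree [e], that of the
   Jacobian ideal in degree [k + d.-1]. *)
pose k := (r + d + k0 + k1)%N; pose e := (k + r.+1 - d)%N.
have ke : (k + r.+1 = e + d)%N by rewrite /e /k; lia.
have [|a da e1] := AR_dim_jac (hJ (k + d.-1)%N (_ : k1 <= _)%N).
  by rewrite /k; lia.
have e2 : (a + N = 'C(k - r + 2, k - r) + 'C(e + 2, e))%N.
  by apply: (AR_dim_B ke) da; [rewrite /k; lia | apply: hN; rewrite /e /k; lia].
have ed : d = d.-1.+1 by rewrite prednK.
have [k2 [ek1 ek2 ek3]] : exists j, [/\ k = (r + d.-1.+1 + j)%N,
    (k - r = d.-1.+1 + j)%N & e = (r + r + j + 1)%N].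
  by exists (k0 + k1)%N; rewrite -ed /e /k; split; lia.
rewrite ed; apply: (@degree_arith d.-1 r k2 a N _ 'C(k + 2, k)
  'C(k + d.-1 + 2, k + d.-1) 'C(k - r + 2, k - r) 'C(e + 2, e)) => //;
  rewrite bin_form_dim ?ek3 ?ek2 //.
- by rewrite ek1.
- by rewrite ek1.
Qed.

End DegreeFormula.

(** * Free and nearly free curves *)

Section PointIdeal.
Variable K : numClosedFieldType.
Local Notation S := {mpoly K[3]}.
Implicit Types (p l : 'rV[K]_3).

Definition independent_forms (a b : S) :=
  forall x y : K, x *: a + y *: b = 0 -> x = 0 /\ y = 0.

Lemma dhomog0_const n (g : {mpoly K[n]}) : g \is 0.-homog -> exists c, g = c%:MP.
Proof.
move=> hg; exists (g@_0%MM); apply/mpolyP => m; rewrite mcoeffC.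
have [->|m0] := eqVneq m 0%MM; first by rewrite mulr1.
rewrite mulr0 (dhomog_nemf_coeff hg) //=; by rewrite mdeg_eq0.
Qed.

Lemma dhomog1_linear (g : S) : g \is 1.-homog -> exists l : 'rV[K]_3, g = linear_form l.
Proof.
move=> hg; have hc j := dhomog0_const (mderiv_homog j hg).
have [c hc'] := choice hc; exists (\row_j c j).
have := euler hg; rewrite mul1r => <-; apply: eq_bigr => j _.
by rewrite hc' mulrC mul_mpolyC mxE.
Qed.

Lemma independent_forms_neq0 (a b : S) : independent_forms a b -> a != 0.
Proof.
move=> h; apply/eqP => a0; have [|/eqP] := h 1 0; first by rewrite a0 scaler0 scale0r addr0.
by rewrite oner_eq0.
Qed.

Lemma independent_formsC (a b : S) : independent_forms a b -> independent_forms b a.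
Proof. by move=> h x y; rewrite addrC => /h[]. Qed.

Lemma subst_linear_form (u : 'I_3 -> S) l :
  linear_form l \mPo [tuple u j | j < 3] = \sum_j l 0 j *: u j.
Proof.
rewrite /linear_form (raddf_sum (comp_mpoly _)); apply: eq_bigr => j _.
by rewrite /= comp_mpolyZ subst_X.
Qed.

(** Solving [g] for one variable gives a substitution that is the identity modulo [g] and
    annihilates [g]. *)
Lemma linear_form_prime (g x y : S) : g \is 1.-homog -> g != 0 ->
  divides g (x * y) -> divides g x \/ divides g y.
Proof.
move=> hg g0; have [l e] := dhomog1_linear hg.
have l0 : l != 0.
  apply: contraNneq g0 => l0; rewrite e l0 /linear_form big1 // => j _.
  by rewrite mxE scale0r.
have [i li] := row_neq0_entry l0.
apply: (@subst_prime _ _ (fun j => 'X_j - (if j == i then (l 0 i)^-1 else 0) *: g)).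
  move=> j; rewrite opprB addrC subrK.
  by exists (if j == i then (l 0 i)^-1 else 0)%:MP; rewrite mul_mpolyC.
rewrite [X in X \mPo _]e subst_linear_form.
under eq_bigr do rewrite scalerBr scalerA.
rewrite sumrB -/(linear_form l) -e -scaler_suml (bigD1 i) //= eqxx divff // big1 => [|j ji].
  by rewrite addr0 scale1r subrr.
by rewrite (negPf ji) mulr0.
Qed.

Lemma independent_forms_ndivides (a b : S) : a \is 1.-homog -> b \is 1.-homog ->
  independent_forms a b -> ~ divides a b.
Proof.
move=> ha hb hi [c e]; have a0 := independent_forms_neq0 hi.
have hc : c \is 0.-homog by apply: (dhomog_div a0 ha); rewrite add0n -e.
have [k ek] := dhomog0_const hc.
have [|_ /eqP] := hi k (-1); first by rewrite e ek mul_mpolyC scaleN1r subrr.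
by rewrite oppr_eq0 oner_eq0.
Qed.

Lemma independent_forms_divides (a b x : S) : a \is 1.-homog -> b \is 1.-homog ->
  independent_forms a b -> divides a (b * x) -> divides a x.
Proof.
move=> ha hb hi; have a0 := independent_forms_neq0 hi.
by case/(linear_form_prime ha a0) => // /(independent_forms_ndivides ha hb hi).
Qed.

Lemma independent_forms_syz (a b x y : S) : a \is 1.-homog -> b \is 1.-homog ->
  independent_forms a b -> a * x + b * y = 0 -> exists t, x = t * b /\ y = - (t * a).
Proof.
move=> ha hb hi e; have a0 := independent_forms_neq0 hi.
have e' : b * y = - (a * x) by apply/eqP; rewrite -addr_eq0 addrC e.
have [t et] : divides a y.
  apply: (independent_forms_divides ha hb hi); rewrite e' -mulrN.
  exact/divides_mulr/divides_refl.
exists (- t); split; last by rewrite mulNr opprK.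
apply: (mulfI a0).
by apply: oppr_inj; rewrite -e' et; ring.
Qed.

Definition point_ideal p : set S := [set g | forall t : K, g.@[fun j => t * p 0 j] = 0].

(** Along the line through [p] the value of [g] is a polynomial in [t] whose coefficients are the
    values of the components; vanishing for infinitely many [t], it is zero. *)
Lemma point_idealP p (g : S) : point_ideal p g <-> forall k, (pihomog mdeg k g).@[p 0] = 0.
Proof.
pose N := msize g.
have ev t : g.@[fun j => t * p 0 j] = (\poly_(k < N) (pihomog mdeg k g).@[p 0]).[t].
  rewrite horner_poly {1}(pihomog_partitionE (leqnn N)) raddf_sum /=.
  by apply: eq_bigr => k _; rewrite (meval_homog _ _ (pihomogP mdeg k g)) mulrC.
split=> [h k|h t].
  have P0 : \poly_(k < N) (pihomog mdeg k g).@[p 0] = 0.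
    apply/eqP/negPn/negP => P0.
    pose rs : seq K := [seq i%:R | i <- iota 0 (size (\poly_(k < N) (pihomog mdeg k g).@[p 0]))].
    have rQ : all (root (\poly_(k < N) (pihomog mdeg k g).@[p 0])) rs.
      by apply/allP => y _; apply/rootP; rewrite -ev; apply: h.
    have urs : uniq rs.
      by rewrite map_inj_uniq ?iota_uniq // => a b /eqP; rewrite eqr_nat => /eqP.
    by have := max_poly_roots P0 rQ urs; rewrite size_map size_iota ltnn.
  have [kN|Nk] := ltnP k N.
    by move/(congr1 (fun q : {poly K} => q`_k)): P0; rewrite coef_poly kN coef0.
  suff -> : pihomog mdeg k g = 0 by rewrite meval0.
  rewrite (pihomog_partitionE (leqnn N)) raddf_sum big1 // => j _ /=.
  apply: (@pihomog_ne0 _ _ _ j); last exact: pihomogP.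
  by apply: contraTneq Nk => <-; rewrite -ltnNge ltn_ord.
rewrite ev horner_poly big1 // => k _; by rewrite h mul0r.
Qed.

Lemma point_ideal_homog p k (g : S) : g \is k.-homog ->
  point_ideal p g <-> g.@[p 0] = 0.
Proof.
move=> hg; split=> [h|g0 t].
  by have := h 1; under meval_eq do rewrite mul1r.
by rewrite (meval_homog _ _ hg) g0 mulr0.
Qed.

Lemma point_ideal_sub p (I : set S) : p != 0 -> is_ideal I ->
  (forall i j, I (minor_form p i j)) -> point_ideal p `<=` I.
Proof.
move=> p0 hI hm g /point_idealP gp; have [I0 ID IM] := hI.
have [i pi] := row_neq0_entry p0.
rewrite (pihomog_partitionE (leqnn (msize g))); elim/big_ind: _ => // k _.
have := point_congr hI (fun j _ => hm i j) (pihomogP mdeg k g).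
rewrite gp scale0r subr0 => /(IM (p 0 i ^+ k)^-1%:MP).
by rewrite mul_mpolyC scalerA mulVf ?scale1r // expf_neq0.
Qed.

Lemma point_ideal_ideal p : is_ideal (point_ideal p).
Proof.
split=> [t|a b ha hb t|a b hb t]; first exact: meval0.
  by rewrite mevalD ha hb addr0.
by rewrite mevalM hb mulr0.
Qed.

Lemma minor_form_point_ideal p i j : point_ideal p (minor_form p i j).
Proof. by apply/(point_ideal_homog _ (minor_form_homog p i j)); apply: minor_form_point. Qed.

Definition ideal_pair (a b : S) : set S := [set g | exists x y, g = x * a + y * b].

Lemma ideal_pair_ideal a b : is_ideal (ideal_pair a b).
Proof.
split.
- by exists 0, 0; rewrite !mul0r addr0.
- by move=> _ _ [x [y ->]] [x' [y' ->]]; exists (x + x'), (y + y'); ring.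
- by move=> c _ [x [y ->]]; exists (c * x), (c * y); ring.
Qed.

(** The point is the normalized cross product of the coefficient vectors; [minor_form_cross] puts
    its minors in the ideal of [a] and [b]. *)
Lemma point_of_independent_forms (a b : S) : a \is 1.-homog -> b \is 1.-homog ->
  independent_forms a b -> exists2 p, proj_points p & ideal_pair a b = point_ideal p.
Proof.
move=> /dhomog1_linear[l el] /dhomog1_linear[l' el'] hi.
have c0 : cross l l' != 0.
  apply/eqP => c0; have lp := cross0_parallel c0.
  have [i li] : exists i, l 0 i != 0.
    apply: row_neq0_entry; apply: contraNneq (independent_forms_neq0 hi) => l0.
    by rewrite el l0 /linear_form big1 // => j _; rewrite mxE scale0r.
  have [|_ /eqP] := hi (l' 0 i) (- l 0 i); last by rewrite oppr_eq0 (negPf li).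
    rewrite el el' -linear_formD.
    have -> : l' 0 i *: l + - l 0 i *: l' = 0.
      apply/rowP => j; rewrite !mxE mulNr; apply/eqP; rewrite subr_eq0; apply/eqP.
      by rewrite lp mulrC.
    by rewrite /linear_form big1 // => j _; rewrite mxE scale0r.
have [c cn pc] := proj_normalize c0; exists (c *: cross l l') => //.
have p0 := proj_point_neq0 pc.
apply/seteqP; split=> [_ [x [y ->]]|].
  have [_ JD JM] := point_ideal_ideal (c *: cross l l').
  have vl u : dot u (cross l l') = 0 -> point_ideal (c *: cross l l') (linear_form u).
    move=> hu; apply/(point_ideal_homog _ (linear_form_homog u)).
    by rewrite (meval_scale _ _ (linear_form_homog u)) linear_form_meval hu mulr0.
  apply: JD; apply: JM; [rewrite el | rewrite el']; apply: vl; first exact: dot_cross_l.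
  by rewrite dotE !crossE; ring.
apply: point_ideal_sub => //; first exact: ideal_pair_ideal.
move=> i j; have [x [y e]] := minor_form_cross l l' i j.
have -> : minor_form (c *: cross l l') i j = c%:MP * (x *: a + y *: b).
  rewrite el el' -linear_formD -e -minor_form_linear mul_mpolyC /minor_form.
  by move: (cross l l') => q; rewrite !mxE scalerBr !scalerA.
have [_ _ PM] := ideal_pair_ideal a b; apply: PM.
by exists x%:MP, y%:MP; rewrite !mul_mpolyC.
Qed.

(** An inclusion in each chart says that a power of each variable brings every component of [g] into
    [I]; saturation removes these powers. *)
Lemma V_inj_saturated (I J : set S) : homogeneous_ideal I -> homogeneous_ideal J ->
  saturated I -> (forall i, V_ J i `<=` V_ I i) -> J `<=` I.
Proof.
move=> hI hJ sI VJI g Jg; have [[I0 ID IM] Ih] := hI.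
rewrite (pihomog_partitionE (leqnn (msize g))); elim/big_ind: _ => // k _.
set u := pihomog mdeg k g; have hu : u \is k.-homog by apply: pihomogP.
have Ju : J u by apply: hJ.2.
have ex i : exists n, I ('X_i ^+ n * u).
  have [v Iv ev] := VJI i _ (ex_intro2 _ _ u Ju erefl).
  pose w := homogenize i (msize v) v.
  have hw : w \is (msize v).-homog by apply: homogenize_homog.
  have ew : dehom i u = dehom i w by rewrite dehom_homogenize.
  exists (msize v); rewrite (dehom_homog_eq hu hw ew).
  by apply: IM; apply: homogenize_ideal.
have [n hn] := choice ex.
pose Q : set S := [set x | I (x * u)].
have iQ : is_ideal Q.
  split; rewrite /Q /= ?mul0r // => a b; first by rewrite mulrDl; apply: ID.
  by move=> h; rewrite -mulrA; apply: IM.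
have [|m hm] := pow_in_forms iQ.
  exists (n 0%R + n 1%R + n 2%:R%R)%N => i; rewrite /Q /=.
  have [e ->] : exists e, (n 0%R + n 1%R + n 2%:R%R = e + n i)%N.
    case: (ord3P i) => ->; [exists (n 1%R + n 2%:R%R)%N | exists (n 0%R + n 2%:R%R)%N
      | by exists (n 0%R + n 1%R)%N]; lia.
  by rewrite exprD -mulrA; apply: IM; apply: hn.
by apply: sI; exists m => h hh; apply: (hm m).
Qed.

End PointIdeal.

(** * Dependence on the syzygy, and freeness *)

Section Rescaling.
Variables (K : numClosedFieldType).
Local Notation S := {mpoly K[3]}.
Variables (d r : nat) (f : S).
Hypotheses (d_gt0 : (0 < d)%N) (f_homog : f \is d.-homog) (f_neq0 : f != 0).
Hypothesis f_reduced : reduced_equation f.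
Hypothesis f_mdr : is_mdr f r.
Variable rho1 : 'rV[S]_3.
Hypotheses (rho1_AR : AR f r rho1) (rho1_neq0 : rho1 != 0).
Implicit Types (a b m rho : 'rV[S]_3) (w h : S).

Local Notation v := (v_ f rho1).
Local Notation B := (B_ f rho1).

Let rho1_syz : syz f rho1. Proof. by case: rho1_AR. Qed.

Let vS := v_spec d_gt0 f_homog f_neq0 f_reduced rho1_AR.
Let vZ' := vZ d_gt0 f_homog f_neq0 f_reduced rho1_AR.
Let vD' := vD d_gt0 f_homog f_neq0 f_reduced rho1_AR.
Let v0' := v0 d_gt0 f_homog f_neq0 f_reduced rho1_AR.
Let vB' := vB d_gt0 f_homog f_neq0 f_reduced rho1_AR.
Let v_rho1' := v_rho1 d_gt0 f_homog f_neq0 f_reduced rho1_AR.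

Lemma Delta_scale h a b : Delta (h *: a) b = h * Delta a b.
Proof. rewrite !Delta_dot; have -> : cross (h *: a) b = h *: cross a b.
  apply/rowP => i; rewrite [RHS]mxE; by case: (ord3P i) => ->; rewrite !crossE !mxE; ring.
by rewrite /dot big_distrr; apply: eq_bigr => i _; rewrite [X in _ * X]mxE mulrCA. Qed.

Lemma v_scale (c : K) rho : syz f rho -> v_ f (c%:MP *: rho1) rho = c%:MP * v rho.
Proof.
move=> hr; apply: (v_uniq f_neq0).
by rewrite Delta_scale vS // mulrA.
Qed.

Lemma rescaled_sequence (c : K) : c != 0 -> same_sequence f rho1 (c%:MP *: rho1).
Proof.
move=> c0; split; last first.
  exists c; split; [exact: c0 | move=> h | exact: v_scale].
  by rewrite /u_ !scalerA mulrC.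
apply/seteqP; split=> _ [rho hr <-].
  rewrite v_scale //; exists (c%:MP *: rho); first exact: syzZ.
  by rewrite vZ'.
exists (c^-1%:MP *: rho); first exact: syzZ.
rewrite v_scale ?vZ' //; last exact: syzZ.
by rewrite mulrA -mpolyCM divff // mul1r.
Qed.

Lemma line_same_sequence e0 : (forall rho, AR f r rho -> exists c, rho = c%:MP *: e0) ->
  forall rho, AR f r rho -> rho != 0 -> same_sequence f rho1 rho.
Proof.
move=> he rho hr r0; have [c ec] := he _ hr; have [c1 ec1] := he _ rho1_AR.
have nz (x : K) a : a = x%:MP *: e0 -> a != 0 -> x != 0.
  by move=> ->; apply: contraNneq => ->; rewrite scale0r.
have c0 := nz _ _ ec r0; have c10 := nz _ _ ec1 rho1_neq0.
have -> : rho = (c / c1)%:MP *: rho1.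
  by rewrite ec1 scalerA -mpolyCM divfK.
by apply: rescaled_sequence; rewrite mulf_neq0 ?invr_eq0.
Qed.

Lemma AR_dim1_line : is_dim (fun (c : K) rho => c%:MP *: rho) (AR f r) [set 0] 1 ->
  exists e0, forall rho, AR f r rho -> exists c, rho = c%:MP *: e0.
Proof.
move=> [e [_ he]]; exists (e 0) => rho /he[c [/eqP hc _]]; exists (c 0 0).
by apply/eqP; rewrite -subr_eq0; move: hc; rewrite big_ord1.
Qed.

(** Coprimality of [B] for [e = 1]; it turns a principal [B], or one with a common factor split off,
    into what is claimed. *)
Lemma B_divisor_unit (t : S) : (forall b : S, B b -> divides t b) -> divides t 1.
Proof.
move=> ht; have [i ri] := row_neq0_entry rho1_neq0.
have t0 : t != 0.
  have [c e] := ht _ (B_rho1 d_gt0 f_homog f_neq0 f_reduced rho1_AR i).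
  by apply: contraNneq ri => t0; rewrite e t0 mulr0.
apply: (B_coprime d_gt0 f_homog f_neq0 f_reduced f_mdr rho1_AR rho1_neq0 t0) => b Bb.
by rewrite mul1r; apply: ht.
Qed.

Lemma v_relation a b : syz f a -> syz f b -> exists h, v b *: a - v a *: b = h *: rho1.
Proof.
move=> ha hb; apply: (v_eq0 d_gt0 f_homog f_neq0 f_reduced f_mdr rho1_AR rho1_neq0).
  by apply: syzB; apply: syzZ.
rewrite (vB' (syzZ _ ha) (syzZ _ hb)) (vZ' _ ha) (vZ' _ hb) [X in X - _]mulrC; exact: subrr.
Qed.

Lemma v_comb n (J : pred 'I_n) (e : 'I_n -> 'rV[S]_3) (c : 'I_n -> S) :
  (forall i, syz f (e i)) -> v (\sum_(i < n | J i) c i *: e i) = \sum_(i < n | J i) c i * v (e i).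
Proof.
move=> he; suff [] : syz f (\sum_(i < n | J i) c i *: e i) /\
  v (\sum_(i < n | J i) c i *: e i) = \sum_(i < n | J i) c i * v (e i) by [].
elim/big_rec2: _ => [|i y x _ [hx <-]]; first by split; [exact: syz0 | exact: v0'].
have hi : syz f (c i *: e i) by apply: syzZ.
by split; [apply: syzD | rewrite vD' // vZ'].
Qed.

(* The degree r part of an expression of rho1 has constant coefficients. *)
Lemma rho1_const_comb n (e : 'I_n -> 'rV[S]_3) (deg : 'I_n -> nat) :
  (forall i, AR f (deg i) (e i)) -> generate_syz f e predT ->
  exists2 c : 'I_n -> K, rho1 = \sum_i (c i)%:MP *: e i & forall i, c i != 0 -> deg i = r.
Proof.
move=> he hg; have [w ew] := hg _ rho1_syz; have [_ rh] := rho1_AR.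
have hc i : exists c, (e i != 0 -> row_pihomog r (w i *: e i) = c%:MP *: e i) /\ (c != 0 -> deg i = r).
  have [_ eh] := he i; have [dr|rd] := ltnP r (deg i).
    exists 0; rewrite eqxx; split=> // _; apply/rowP => j; rewrite !mxE mpolyC0 mul0r.
    exact: pihomogM_lt (eh j) dr.
  have E : row_pihomog r (w i *: e i) = pihomog mdeg (r - deg i) (w i) *: e i.
    by apply/rowP => j; rewrite !mxE -{1}(subnK rd) (pihomogM _ _ (eh j)).
  have [er|nr] := eqVneq (deg i) r.
    have [|c ec] := @dhomog0_const _ _ (pihomog mdeg (r - deg i) (w i)).
      by rewrite er subnn; apply: pihomogP.
    by exists c; rewrite E ec.
  exists 0; rewrite eqxx; split=> // ei; have [j ej] := row_neq0_entry ei.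
  have lt : (deg i < r)%N by rewrite ltn_neqAle nr.
  by case/eqP: ei; apply: (f_mdr.2 _ lt _ (he i)).
have [c hc'] := choice hc; exists c => [|i]; last by case: (hc' i).
have -> : rho1 = \sum_i row_pihomog r (w i *: e i).
  rewrite -[LHS](row_pihomog_id rh) {1}ew; apply/rowP => j; rewrite mxE !summxE raddf_sum.
  by apply: eq_bigr => i _; rewrite [RHS]mxE.
apply: eq_bigr => i _; have [e0|e0] := eqVneq (e i) 0; last by case: (hc' i) => /(_ e0).
by rewrite e0 !scaler0 /row_pihomog map_mx0.
Qed.

(** The coefficient of [e i0], which occurs on the right only, gives [h = 0]; that of [e k] then
    gives the claim. *)
Lemma free_relation n (e : 'I_n -> 'rV[S]_3) (c : 'I_n -> K) i0 j k (x y h : S) :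
  (forall w : 'I_n -> S, \sum_i w i *: e i = 0 -> forall i, w i = 0) -> c i0 != 0 ->
  j != i0 -> k != i0 -> j != k ->
  x *: e j - y *: e k = h *: (\sum_i (c i)%:MP *: e i) -> y = 0.
Proof.
move=> hf c0 ji ki jk; rewrite scaler_sumr => E.
have dl (z : S) l : z *: e l = \sum_i ((i == l)%:R * z) *: e i.
  rewrite (bigD1 l) //= eqxx mul1r big1 ?addr0 // => i /negPf ->.
  by rewrite mul0r scale0r.
have R : forall i, (i == j)%:R * x - (i == k)%:R * y - h * (c i)%:MP = 0.
  apply: hf; transitivity (x *: e j - y *: e k - \sum_i h *: ((c i)%:MP *: e i)); last first.
    by rewrite E subrr.
  rewrite (dl x) (dl y) -!sumrB; apply: eq_bigr => i _.
  by rewrite !scalerBl scalerA.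
have h0 : h = 0.
  move: (R i0); rewrite ![i0 == _]eq_sym (negPf ji) (negPf ki) !mul0r subr0 sub0r => /eqP.
  by rewrite oppr_eq0 mulf_eq0 mpolyC_eq0 (negPf c0) orbF => /eqP.
move: (R k); rewrite h0 eqxx eq_sym (negPf jk) !mul0r mul1r subr0 sub0r => /eqP.
by rewrite oppr_eq0 => /eqP.
Qed.

Lemma B1_of_free : free_curve f -> B 1.
Proof.
move=> [n [e [deg [he hg hf]]]]; have se i : syz f (e i) by case: (he i).
have [c ec _] := rho1_const_comb he hg.
have [i0 c0] : exists i, c i != 0.
  apply: contrapT => hn; case/eqP: rho1_neq0; rewrite ec big1 // => i _.
  by have [->|ci] := eqVneq (c i) 0; [rewrite mpolyC0 scale0r | case: hn; exists i].
(* Two basis elements other than e i0 are related through rho1, which involves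
   e i0: so at most one of them has a nonzero image and B is principal. *)
have dep j k : j != i0 -> k != i0 -> j != k -> v (e j) = 0.
  move=> ji ki jk; have [h] := v_relation (se j) (se k).
  move: (v (e j) : S) (v (e k) : S) => y x; rewrite ec => E.
  exact: (free_relation hf c0 ji ki jk E).
have vc : v rho1 = \sum_i (c i)%:MP * v (e i).
  by rewrite [X in v_ _ _ X]ec; exact: (v_comb predT (fun i => (c i)%:MP) se).
have [t [Bt ht]] : exists t : S, B t /\ forall j, j != i0 -> divides t (v (e j)).
  have [[j [ji vj]]|nj] := pselect (exists j, j != i0 /\ v (e j) != 0).
    exists (v (e j)); split=> [|k ki]; first by exists (e j).
    have [->|kj] := eqVneq k j; first exact: divides_refl.
    by case/eqP: vj; apply: (dep j k) => //; rewrite eq_sym.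
  exists 0; split=> [|j ji]; first by case: (B_ideal d_gt0 f_homog f_neq0 f_reduced rho1_AR).
  suff -> : v (e j) = 0 by apply: divides0.
  by apply/eqP/negPn/negP => vj; apply: nj; exists j.
(* The vanishing of [v_] at [rho1] expresses the image of [e i0] through the images of the
   others. *)
have hti : divides t (v (e i0)).
  have ci : (c i0)%:MP_[3] != 0 by rewrite mpolyC_eq0.
  have -> : v (e i0) = - (c i0)^-1%:MP * \sum_(i | i != i0) (c i)%:MP * v (e i).
    have := vc; rewrite v_rho1' (bigD1 i0) //= => /esym/eqP; rewrite addr_eq0 => /eqP.
    move/(congr1 (fun x => (c i0)^-1%:MP * x)); rewrite mulrA -mpolyCM mulVf // mul1r => ->.
    by rewrite mulrN mulNr.
  apply/divides_mull/divides_sum => i ii0; apply/divides_mull/ht => //.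
have [] : divides t 1.
  apply: B_divisor_unit => _ [rho hr <-]; have [w ->] := hg _ hr.
  rewrite (v_comb predT _ se); apply: divides_sum => i _; apply: divides_mull.
  by have [->//|] := eqVneq i i0; apply: ht.
move=> u ->; by have [_ _] := B_ideal d_gt0 f_homog f_neq0 f_reduced rho1_AR; apply.
Qed.

Lemma free_of_B1 : B 1 -> free_curve f.
Proof.
move=> B1; have [rd|dr] := ltnP d r.+1.
  have /eqP := B_homog_lt d_gt0 f_homog f_neq0 f_reduced rho1_AR B1 (dhomog1 _ _) rd.
  by rewrite oner_eq0.
(* A lift of 1 has degree [d - r.+1]; exactness makes it a basis together with [rho1]. *)
have [|rho2 h2 v2] := @B_homog_lift _ _ _ _ d_gt0 f_homog f_neq0 f_reduced _ rho1_AR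
  (d - r.+1) 0 _ B1 (dhomog1 _ _).
  by rewrite subnK.
have [s2 _] := h2.
exists 2%N, (fun i => if i == 0 then rho1 else rho2), (fun i => if i == 0 then r else (d - r.+1)%N).
split=> [i|rho hr|c].
- by case: ifP.
- have [|h e] := v_eq0 d_gt0 f_homog f_neq0 f_reduced f_mdr rho1_AR rho1_neq0
    (syzB hr (syzZ (v rho) s2)).
    by rewrite vB' ?vZ' ?v2 ?mulr1 ?subrr //; exact: syzZ.
  exists (fun i => if i == 0 then h else v rho).
  by rewrite big_ord_recl big_ord1 /= -e subrK.
- rewrite big_ord_recl big_ord1 /= => e.
  have c1 : c (lift ord0 0) = 0.
    move/(congr1 v): e; rewrite vD' ?vZ' // ?v0' //; try exact: syzZ.
    by rewrite v2 v_rho1' mulr0 add0r mulr1.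
  have c0 : c 0 = 0.
    apply: (row_scaleI rho1_neq0); rewrite scale0r -[RHS]e c1 scale0r addr0.
    by congr (c _ *: _); apply: val_inj.
  by move=> i; case: (ord2P (isT : (0 : 'I_2) != lift ord0 0) i) => ->.
Qed.

End Rescaling.

Section PointPair.
Variable K : numClosedFieldType.
Local Notation S := {mpoly K[3]}.
Implicit Types (p l : 'rV[K]_3).

Lemma point_ideal_homogeneous p : homogeneous_ideal (point_ideal p).
Proof.
split=> [|g k /point_idealP h]; first exact: point_ideal_ideal.
by apply/(point_ideal_homog _ (pihomogP mdeg k g)).
Qed.

Lemma point_ideal_saturated p : p != 0 -> saturated (point_ideal p).
Proof.
move=> p0 g [n hn]; have [i pi] := row_neq0_entry p0.
apply/point_idealP => k; have /point_idealP/(_ (k + n)%N) := hn _ (dhomogXn K i n).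
rewrite mulrC (pihomogM _ _ (dhomogXn K i n)) mevalM (rmorphXn (meval (p 0))) /= mevalXU => /eqP.
by rewrite mulf_eq0 expf_eq0 (negPf pi) andbF orbF => /eqP.
Qed.

Lemma ord3_split (m : 'I_3) : exists j k : 'I_3, [/\ j != m, k != m, j != k,
  forall i, [\/ i = m, i = j | i = k] &
  forall (V : nmodType) (F : 'I_3 -> V), \sum_i F i = F m + F j + F k].
Proof.
case: (ord3P m) => ->; [exists 1, 2%:R | exists 0, 2%:R | exists 0, 1]; split=> // [i|V F]; rewrite ?sum3.
- by case: (ord3P i) => ->; [apply: Or31 | apply: Or32 | apply: Or33].
- by [].
- by case: (ord3P i) => ->; [apply: Or32 | apply: Or31 | apply: Or33].
- by rewrite [F 0 + F 1]addrC.
- by case: (ord3P i) => ->; [apply: Or32 | apply: Or33 | apply: Or31].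
- by rewrite -[RHS]addrA [RHS]addrC.
Qed.

Lemma point_ideal_pair p : p != 0 -> exists a b : S,
  [/\ a \is 1.-homog, b \is 1.-homog, independent_forms a b & point_ideal p = ideal_pair a b].
Proof.
move=> p0; have [i pi] := row_neq0_entry p0; have [j [k [ji ki jk hP _]]] := ord3_split i.
exists (minor_form p i j), (minor_form p i k).
split; [exact: minor_form_homog | exact: minor_form_homog | |].
  move=> x y E.
  have ev (l : 'I_3) : x * (p 0 i * (l == j)%:R - p 0 j * (l == i)%:R)
      + y * (p 0 i * (l == k)%:R - p 0 k * (l == i)%:R) = 0.
    move/(congr1 (meval (fun l' : 'I_3 => ((l == l' :> 'I_3)%:R : K)))): E.
    by rewrite meval0 mevalD !mevalZ !mevalB !mevalZ !mevalXU.
  split.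
    have := ev j; rewrite eqxx (negPf ji) (negPf jk) !mulr0 mulr1 !subr0 mulr0 addr0 => /eqP.
    by rewrite mulf_eq0 (negPf pi) orbF => /eqP.
  have := ev k; rewrite eqxx (negPf ki) eq_sym (negPf jk) !mulr0 mulr1 !subr0 mulr0 add0r => /eqP.
  by rewrite mulf_eq0 (negPf pi) orbF => /eqP.
have iP := ideal_pair_ideal (minor_form p i j) (minor_form p i k).
have [_ PD PM] := iP.
apply/seteqP; split=> [|_ [x [y ->]]]; last first.
  have [_ QD QM] := point_ideal_ideal p.
  by apply: QD; apply: QM; apply: minor_form_point_ideal.
apply: point_ideal_sub => //.
have hi (l : 'I_3) : ideal_pair (minor_form p i j) (minor_form p i k) (minor_form p i l).
  case: (hP l) => ->.
  - by exists 0, 0; rewrite /minor_form subrr !mul0r addr0.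
  - by exists 1, 0; rewrite mul1r mul0r addr0.
  - by exists 0, 1; rewrite mul1r mul0r add0r.
move=> l l'; have -> : minor_form p l l' = (p 0 i)^-1%:MP *
    ((p 0 l)%:MP * minor_form p i l' - (p 0 l')%:MP * minor_form p i l).
  apply: (@mulfI _ (p 0 i)%:MP); first by rewrite mpolyC_eq0.
  rewrite mulrA -mpolyCM divff // mul1r /minor_form -!mul_mpolyC.
  by ring.
by apply: (PM); rewrite -mulNr; apply: PD; apply: (PM).
Qed.

End PointPair.

(** * Nearly free curves and reduced points *)

Section NearlyFree.
Variables (K : numClosedFieldType).
Local Notation S := {mpoly K[3]}.
Variables (d r : nat) (f : S).
Hypotheses (d_gt0 : (0 < d)%N) (f_homog : f \is d.-homog) (f_neq0 : f != 0).
Hypothesis f_reduced : reduced_equation f.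
Hypothesis f_mdr : is_mdr f r.
Variable rho1 : 'rV[S]_3.
Hypotheses (rho1_AR : AR f r rho1) (rho1_neq0 : rho1 != 0).
Implicit Types (a b m rho : 'rV[S]_3) (w h : S).

Local Notation v := (v_ f rho1).
Local Notation B := (B_ f rho1).

Let rho1_syz : syz f rho1. Proof. by case: rho1_AR. Qed.

Let vZ' := vZ d_gt0 f_homog f_neq0 f_reduced rho1_AR.
Let vD' := vD d_gt0 f_homog f_neq0 f_reduced rho1_AR.
Let vB' := vB d_gt0 f_homog f_neq0 f_reduced rho1_AR.
Let v_rho1' := v_rho1 d_gt0 f_homog f_neq0 f_reduced rho1_AR.

(** Saturation of both ideals turns the equality of schemes into [B = ideal_pair a b]. The lifts of
    [a] and [b] have degree [d - r], and the Koszul relation of [a] and [b] lifts to the required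
    relation up to a multiple of [rho1]. *)
Lemma nearly_free_of_point p : proj_points p -> V_ B = reduced_point p -> nearly_free f.
Proof.
move=> pp Zp; have p0 := proj_point_neq0 pp.
have hB := B_homogeneous d_gt0 f_homog f_neq0 f_reduced rho1_AR.
have sB := B_saturated d_gt0 f_homog f_neq0 f_reduced f_mdr rho1_AR rho1_neq0.
have [a [b [ha hb hi Pab]]] := point_ideal_pair p0.
have BE : B = ideal_pair a b.
  rewrite -Pab; have ZE : V_ B = V_ (point_ideal p) by [].
  apply/seteqP; split; apply: V_inj_saturated => //; try exact: point_ideal_homogeneous.
  - exact: point_ideal_saturated.
  - by move=> i; rewrite ZE.
  - by move=> i; rewrite ZE.
have Ba : B a by rewrite BE; exists 1, 0; rewrite mul1r mul0r addr0.
have Bb : B b by rewrite BE; exists 0, 1; rewrite mul1r mul0r add0r.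
have a0 := independent_forms_neq0 hi.
have rd : (r <= d)%N.
  rewrite leqNgt; apply/negP => dr; case/eqP: a0.
  by apply: (B_homog_lt d_gt0 f_homog f_neq0 f_reduced rho1_AR Ba ha); rewrite add1n ltnS.
have kE : (d - r + r.+1 = 1 + d)%N by rewrite addnS subnK.
have [rho2 h2 v2] := B_homog_lift d_gt0 f_homog f_neq0 f_reduced rho1_AR Ba ha kE.
have [rho3 h3 v3] := B_homog_lift d_gt0 f_homog f_neq0 f_reduced rho1_AR Bb hb kE.
have [s2 g2] := h2; have [s3 g3] := h3; have [s1 g1] := rho1_AR.
have [h0 eh0] : exists h, b *: rho2 - a *: rho3 = h *: rho1.
  by rewrite -v3 -v2; apply: (v_relation d_gt0 f_homog f_neq0 f_reduced f_mdr rho1_AR rho1_neq0).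
have rd2 : (r <= d - r)%N.
  rewrite leqNgt; apply/negP => lt; case/eqP: a0.
  have v00 := v0 d_gt0 f_homog f_neq0 f_reduced rho1_AR.
  by rewrite -v2 (f_mdr.2 _ lt _ h2).
have h0_homog : h0 \is (d - r - r + 1).-homog.
  have [i ri] := row_neq0_entry rho1_neq0; apply: (dhomog_div ri (g1 i)).
  move/rowP/(_ i): eh0; rewrite !mxE => <-.
  have -> : (d - r - r + 1 + r = 1 + (d - r))%N by rewrite addnAC subnK // addnC.
  by apply: rpredB; apply: dhomogM => //; [apply: g2 | apply: g3].
pose e (i : 'I_3) := tnth [tuple rho1; rho2; rho3] i.
have vc x y z : v (x *: rho1 + y *: rho2 + z *: rho3) = y * a + z * b.
  rewrite vD' ?vD' ?vZ' //; try by [apply: syzZ | apply: syzD; apply: syzZ].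
  by rewrite v_rho1' v2 v3 mulr0 add0r.
exists r, (d - r)%N, e, (- h0), b, (- a); split.
- by split.
- move=> rho hr; have [x [y exy]] : ideal_pair a b (v rho) by rewrite -BE; exists rho.
  have [|h eh] := v_eq0 d_gt0 f_homog f_neq0 f_reduced f_mdr rho1_AR rho1_neq0
    (syzB hr (syzD (syzZ x s2) (syzZ y s3))).
    rewrite vB' ?vD' ?vZ' //; try by [apply: syzZ | apply: syzD; apply: syzZ].
    by rewrite v2 v3 exy subrr.
  exists (fun i => tnth [tuple h; x; y] i); rewrite sum3 /e /= -[rho](subrK (x *: rho2 + y *: rho3)) eh.
  by rewrite addrA.
- have nd := independent_forms_ndivides ha hb hi.
  have nd' := independent_forms_ndivides hb ha (independent_formsC hi).
  move=> j; case: (ord3P j) => -> hg.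
  (* If [rho1] could be dropped, its expression through the lifts would make [h0] invertible,
     although [h0] has the positive degree [d - r - r + 1]. *)
  + have [x] := hg _ s1; rewrite big_mkcond sum3 /e /= add0r => E.
    have := v_rho1'; rewrite [X in v X]E.
    have := vc 0 (x 1) (x 2%:R); rewrite scale0r add0r => ->.
    rewrite addrC mulrC [x 1 * a]mulrC addrC => R.
    have [t [x1 x2]] := independent_forms_syz ha hb hi R.
    have T : t * h0 = 1.
      apply: (row_scaleI rho1_neq0); rewrite scale1r -scalerA -eh0 [RHS]E x1 x2.
      by rewrite scalerBr !scalerA scaleNr.
    have /mpoly_unitP[c c0 hc] : h0 \is a GRing.unit by apply/unitrPr; exists t; rewrite mulrC.
    have h00 : h0 != 0 by rewrite hc mpolyC_eq0.
    have hh : h0 \is 0.-homog.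
      by rewrite hc -[c%:MP]mulr1 mul_mpolyC; apply: dhomogZ; apply: dhomog1.
    by have := dhomog_uniq h00 h0_homog hh; rewrite addn1.
  + have [x] := hg _ s2; rewrite big_mkcond sum3 /e /= addr0 => E.
    apply: nd'; exists (x 2%:R); rewrite -v2 E.
    by have := vc (x 0) 0 (x 2%:R); rewrite scale0r addr0 mul0r add0r.
  + have [x] := hg _ s3; rewrite big_mkcond sum3 /e /= addr0 => E.
    apply: nd; exists (x 1); rewrite -v3 E.
    by have := vc (x 0) (x 1) 0; rewrite scale0r addr0 mul0r addr0.
- split; [by [] | by rewrite rpredN |].
  move=> x y; rewrite scalerN -scaleNr => E.
  have [|/eqP] := hi (- y) x; first by rewrite addrC.
  by rewrite oppr_eq0 => /eqP.
- by rewrite /e /= !scaleNr -eh0 opprB subrK subrr.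
Qed.

End NearlyFree.

Lemma shear_relation (A : comNzRingType) (V : lmodType A) (a a' y y' : A) (u u' w : V) :
  a *: (u + y *: w) + a' *: (u' + y' *: w) = (y * a + y' * a') *: w + (a *: u + a' *: u').
Proof.
by rewrite !scalerDr scalerDl !scalerA [a * y]mulrC [a' * y']mulrC addrACA addrC.
Qed.

Section NearlyFreeExponents.
Variables (K : numClosedFieldType).
Local Notation S := {mpoly K[3]}.
Variables (d r : nat) (f : S).
Hypotheses (d_gt0 : (0 < d)%N) (f_homog : f \is d.-homog) (f_neq0 : f != 0).
Hypothesis f_reduced : reduced_equation f.
Hypothesis f_mdr : is_mdr f r.
Variable rho1 : 'rV[S]_3.
Hypotheses (rho1_AR : AR f r rho1) (rho1_neq0 : rho1 != 0).
Implicit Types (a b m rho : 'rV[S]_3) (w h : S).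

Local Notation v := (v_ f rho1).
Local Notation B := (B_ f rho1).

Let rho1_syz : syz f rho1. Proof. by case: rho1_AR. Qed.

Hypothesis r_gt0 : (0 < r)%N.
Variables (d1 d2 : nat) (e : 'I_3 -> 'rV[S]_3) (mu : 'I_3 -> S).
Hypotheses (e_AR : forall i, AR f (if i == 0 then d1 else d2) (e i)) (d12 : (d1 <= d2)%N).
Hypotheses (e_gen : generate_syz f e predT) (e_min : forall i, ~ generate_syz f e (predC1 i)).
Hypotheses (mu1_homog : mu 1 \is 1.-homog) (mu2_homog : mu 2%:R \is 1.-homog).
Hypotheses (mu_ind : independent_forms (mu 1) (mu 2%:R)) (mu_rel : \sum_i mu i *: e i = 0).

Let e_syz i : syz f (e i). Proof. by case: (e_AR i). Qed.

(** An invertible coefficient would let [e i] be expressed through the other generators. *)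
Lemma minimal_coef (w : 'I_3 -> S) i : w i \is a GRing.unit -> \sum_j w j *: e j <> 0.
Proof.
move=> wi E; apply: (@e_min i) => rho /e_gen[c ->].
exists (fun j => c j - c i / w i * w j).
have := congr1 (fun x => (c i / w i) *: x) E; rewrite scaler0 scaler_sumr (bigD1 i) //=.
rewrite scalerA divrK // => /eqP; rewrite addr_eq0 => /eqP Ei.
rewrite (bigD1 i) //= Ei -sumrN -big_split /=; apply: eq_bigr => j ji.
by rewrite scalerBl scalerA addrC.
Qed.

(** [rho1] is a constant combination of generators of degree [r], so there is one, and [e 0] has the
    least degree. *)
Lemma minimal_degree : d1 = r.
Proof.
have e0 : e 0 != 0.
  apply/eqP => e0; apply: (@minimal_coef (fun j => (j == 0)%:R) 0); first by rewrite eqxx unitr1.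
  by rewrite sum3 e0 scaler0 !scale0r !addr0.
have rd : (r <= d1)%N.
  rewrite leqNgt; apply/negP => lt; case/eqP: e0; apply: (f_mdr.2 _ lt).
  exact: (e_AR 0).
have [c ec hc] := rho1_const_comb f_mdr rho1_AR (deg := fun i => if i == 0 then d1 else d2) e_AR e_gen.
have [i c0] : exists i, c i != 0.
  apply: contrapT => hn; case/eqP: rho1_neq0; rewrite ec big1 // => i _.
  by have [->|ci] := eqVneq (c i) 0; [rewrite mpolyC0 scale0r | case: hn; exists i].
have := hc i c0; case: ifP => _ h; first exact: h.
by apply/eqP; rewrite eqn_leq rd andbT -h.
Qed.

(** If [mu 0] were a combination of the two others, a change of generators would remove it from the
    relation. Then [e 1] plus a constant multiple of [e 0] would be [mu 2%:R] times a syzygy of too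
    small a degree, hence zero, against minimality. *)
Lemma mu_independent (z : 'I_3 -> K) : d2 = r -> \sum_i z i *: mu i = 0 -> forall i, z i = 0.
Proof.
move=> d2r; rewrite sum3 => E.
suff z0 : z 0 = 0.
  move: E; rewrite z0 scale0r add0r => /mu_ind[z1 z2] i.
  by case: (ord3P i) => ->.
apply/eqP/negPn/negP => z0.
have [y [y' ey]] : exists y y', mu 0 = y *: mu 1 + y' *: mu 2%:R.
  exists (- (z 1 / z 0)), (- (z 2%:R / z 0)); apply: (@scalerI _ _ (z 0)) => //.
  rewrite scalerDr !scalerA !mulrN ![z 0 * (_ / _)]mulrCA divff // !mulr1 !scaleNr.
  by apply/eqP; rewrite -subr_eq0 opprD !opprK addrA E.
have R : mu 1 *: (e 1 + y%:MP *: e 0) + mu 2%:R *: (e 2%:R + y'%:MP *: e 0) = 0.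
  by rewrite -[RHS]mu_rel sum3 ey -!mul_mpolyC shear_relation addrA.
have et j : exists t, (e 1 + y%:MP *: e 0) 0 j = mu 2%:R * t.
  have := congr1 (fun u : 'rV[S]_3 => u 0 j) R.
  rewrite /= [LHS]mxE [RHS]mxE [X in X + _]mxE [X in _ + X]mxE => Rj.
  have [t [xt _]] := independent_forms_syz mu1_homog mu2_homog mu_ind Rj.
  by exists t; rewrite [RHS]mulrC -xt.
have [t et'] := choice et; pose T : 'rV[S]_3 := \row_j t j.
have ET : e 1 + y%:MP *: e 0 = mu 2%:R *: T by apply/rowP => j; rewrite [RHS]mxE [T _ _]mxE.
have m20 := independent_forms_neq0 (independent_formsC mu_ind).
(* T is a syzygy of degree r - 1. *)
have T0 : T = 0.
  apply: (f_mdr.2 r.-1); first by rewrite prednK.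
  split; first by apply: (syz_scale_inv m20); rewrite -ET; apply: syzD => //; apply: syzZ.
  move=> j; rewrite mxE; apply: (dhomog_div m20 mu2_homog); rewrite addn1 prednK // mulrC -et' !mxE.
  have [_ h0] := e_AR 0; have [_ h1] := e_AR 1.
  apply: rpredD; first by rewrite -d2r; apply: h1.
  by rewrite mul_mpolyC; apply: dhomogZ; rewrite -minimal_degree; apply: h0.
apply: (@minimal_coef (fun j => if j == 0 then y%:MP else (j == 1)%:R) 1) => /=; first exact: unitr1.
by rewrite sum3 /= scale1r scale0r addr0 addrC ET T0 scaler0.
Qed.


Lemma relation_forms : d2 = r -> forall i, mu i \is 1.-homog.
Proof.
move=> d2r; have dr := minimal_degree; apply: forall_ord3 => //.
have eh i j : e i 0 j \is r.-homog.
  by have [_ /(_ j)] := e_AR i; case: ifP => _; rewrite ?dr ?d2r.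
have e0 : e 0 != 0.
  apply/eqP => e0; apply: (@minimal_coef (fun j => (j == 0)%:R) 0); first by rewrite eqxx unitr1.
  by rewrite sum3 e0 scaler0 !scale0r !addr0.
have [j ej] := row_neq0_entry e0; apply: (dhomog_div ej (eh 0 j)).
have := congr1 (fun u : 'rV[S]_3 => u 0 j) mu_rel.
rewrite /= sum3 !mxE -addrA => /eqP; rewrite addr_eq0 => /eqP ->.
by rewrite rpredN; apply: rpredD; apply: dhomogM.
Qed.

Lemma eliminate_relation (c : 'I_3 -> K) (m j k : 'I_3) (u : 'I_3 -> S) : c m != 0 ->
  mu m * u m + mu j * u j + mu k * u k = 0 ->
  (c m)%:MP * u m + (c j)%:MP * u j + (c k)%:MP * u k = 0 ->
  (mu j - (c j / c m) *: mu m) * u j + (mu k - (c k / c m) *: mu m) * u k = 0.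
Proof.
move=> cm E F; apply: (@mulfI _ (c m)%:MP); first by rewrite mpolyC_eq0.
rewrite mulr0 mulrDr !mulrA !mulrBr -!mul_mpolyC ![_ * (_%:MP * _)]mulrA -!mpolyCM.
rewrite ![c m * (_ / _)]mulrC !divfK //.
transitivity ((c m)%:MP * (mu m * u m + mu j * u j + mu k * u k)
  - mu m * ((c m)%:MP * u m + (c j)%:MP * u j + (c k)%:MP * u k)).
  by ring.
by rewrite E F !mulr0 subrr.
Qed.

(** The images of the generators satisfy two relations, one from [mu] and one from the vanishing of
    [v_] at [rho1]; eliminating the one of index [m] leaves linear coefficients. If [d2] differs
    from [r], only [e 0] occurs in [rho1]; if [d2 = r], the three [mu i] are independent linear
    forms and elimination keeps [a], [b] independent. *)
Lemma pencil : exists (m j k : 'I_3) (c : 'I_3 -> K) (a b : S),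
  [/\ [/\ c m != 0, rho1 = \sum_i (c i)%:MP *: e i,
       AR f d2 (e j) & forall (V : nmodType) (F : 'I_3 -> V), \sum_i F i = F m + F j + F k],
     a \is 1.-homog, b \is 1.-homog, independent_forms a b &
     forall u : 'I_3 -> S, \sum_i mu i * u i = 0 -> \sum_i (c i)%:MP * u i = 0 ->
       a * u j + b * u k = 0].
Proof.
have [c ec hc] := rho1_const_comb f_mdr rho1_AR (deg := fun i => if i == 0 then d1 else d2) e_AR e_gen.
have [m cm] : exists i, c i != 0.
  apply: contrapT => hn; case/eqP: rho1_neq0; rewrite ec big1 // => i _.
  by have [->|ci] := eqVneq (c i) 0; [rewrite mpolyC0 scale0r | case: hn; exists i].
have [d2r|d2r] := eqVneq d2 r; last first.
  have ci i : i != 0 -> c i = 0.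
    move=> i0; apply/eqP/negPn/negP => /hc /eqP.
    by rewrite (negPf i0) (negPf d2r).
  have m0 : m = 0 by apply/eqP/negPn/negP => /ci/eqP; rewrite (negPf cm).
  exists 0, 1, 2%:R, c, (mu 1), (mu 2%:R); split=> //.
    split=> //; [by rewrite -m0 | exact: (e_AR 1) | by move=> V F; rewrite sum3].
  move=> u; rewrite !sum3 (ci 1) // (ci 2%:R) // mpolyC0 !mul0r !addr0 => E /eqP.
  rewrite mulf_eq0 mpolyC_eq0 -m0 (negPf cm) /= m0 => /eqP u0.
  by move: E; rewrite u0 mulr0 add0r.
have [j [k [jm km jk hP hS]]] := ord3_split m.
have hmu := relation_forms d2r.
exists m, j, k, c, (mu j - (c j / c m) *: mu m), (mu k - (c k / c m) *: mu m).
split; [| by rewrite rpredB ?dhomogZ // | by rewrite rpredB ?dhomogZ // | |].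
- split=> //; have := e_AR j; case: ifP => // _.
  by rewrite minimal_degree d2r.
- move=> x y E; pose z i := if i == j then x else if i == k then y
    else - (x * (c j / c m) + y * (c k / c m)).
  have z0 : forall i, z i = 0.
    apply: mu_independent => //; rewrite hS /z eqxx ![m == _]eq_sym (negPf jm) (negPf km).
    rewrite [k == j]eq_sym (negPf jk) eqxx -[RHS]E.
    move: (mu m) (mu j) (mu k) (c j / c m) (c k / c m) => M Mj Mk A A'.
    rewrite -!mul_mpolyC mpolyCN mpolyCD !mpolyCM; ring.
  by have := z0 k; have := z0 j; rewrite /z !eqxx eq_sym (negPf jk).
- move=> u; rewrite !hS => E F; exact: (eliminate_relation cm E F).
Qed.

(** The relation of [pencil] forces the two remaining images to be [t * b] and [- (t * a)]. The
    common factor [t] is a unit by [B_divisor_unit], so [a] and [b] generate [B]; that [v_ (e j)]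
    has degree 1 gives the equation for [d2]. *)
Lemma nearly_free_point : (d2 + r = d)%N /\ exists2 p, proj_points p & B = point_ideal p.
Proof.
have vZ' := vZ d_gt0 f_homog f_neq0 f_reduced rho1_AR.
have [m [j [k [c [a [b [[cm ec ej hS] ha hb hi hu]]]]]]] := pencil.
pose u i : S := v (e i).
have vc (w : 'I_3 -> S) : v (\sum_i w i *: e i) = \sum_i w i * u i.
  exact: (v_comb d_gt0 f_homog f_neq0 f_reduced rho1_AR predT w e_syz).
have U1 : \sum_i mu i * u i = 0.
  by rewrite -vc mu_rel; apply: (v0 d_gt0 f_homog f_neq0 f_reduced rho1_AR).
have U2 : \sum_i (c i)%:MP * u i = 0.
  by rewrite -vc -ec; apply: (v_rho1 d_gt0 f_homog f_neq0 f_reduced rho1_AR).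
have [t [uj uk]] := independent_forms_syz ha hb hi (hu u U1 U2).
have um : u m = - (c m)^-1%:MP * ((c j)%:MP * u j + (c k)%:MP * u k).
  move: U2; rewrite hS -addrA => /eqP; rewrite addr_eq0 => /eqP F.
  by rewrite mulNr -mulrN -F mulrA -mpolyCM mulVf // mul1r.
have BI := B_ideal d_gt0 f_homog f_neq0 f_reduced rho1_AR; have [B0 BD BM] := BI.
have Bc (I : set S) : is_ideal I -> I (u j) -> I (u k) -> B `<=` I.
  move=> [I0 ID IM] Ij Ik _ [rho /e_gen[w ->] <-]; rewrite vc hS um.
  by apply: (ID); [apply: (ID); apply: (IM); [apply: (IM); apply: (ID); apply: (IM) | ] | apply: (IM)].
have t1 : divides t 1.
  apply: (B_divisor_unit d_gt0 f_homog f_neq0 f_reduced f_mdr rho1_AR rho1_neq0).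
  apply: (Bc _ (divides_ideal t)); first by rewrite uj; apply/divides_mulr/divides_refl.
  by rewrite uk; apply/divides_opp/divides_mulr/divides_refl.
have [s es] := t1.
have /mpoly_unitP[x x0 ex] : t \is a GRing.unit by apply/unitrPr; exists s; rewrite mulrC.
have Bu i : B (u i) by exists (e i).
have BE : B = ideal_pair a b.
  apply/seteqP; split.
    apply: (Bc _ (ideal_pair_ideal a b)); first by exists 0, t; rewrite mul0r add0r.
    by exists (- t), 0; rewrite mul0r addr0 uk mulNr.
  move=> _ [y [y' ->]]; apply: BD; apply: (BM).
    have -> : a = - s * u k by rewrite uk mulrNN mulrA -es mul1r.
    exact: BM.
  have -> : b = s * u j by rewrite uj mulrA -es mul1r.
  exact: BM.
split; last first.
  by have [p pp E] := point_of_independent_forms ha hb hi; exists p; rewrite ?BE.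
have b0 := independent_forms_neq0 (independent_formsC hi).
have uj0 : u j != 0 by rewrite uj mulf_neq0 // ex mpolyC_eq0.
have uj1 : u j \is 1.-homog by rewrite uj ex mul_mpolyC; apply: dhomogZ.
have [lt|le] := ltnP (d2 + r.+1) d.
  by case/eqP: uj0; apply: (v_homog_lt d_gt0 f_homog f_neq0 f_reduced rho1_AR ej lt).
have := v_homog d_gt0 f_homog f_neq0 f_reduced rho1_AR ej (esym (subnK le)).
move/(dhomog_uniq uj0 uj1) => e1; apply/eqP.
by rewrite -eqSS -addnS -(subnK le) -e1.
Qed.

End NearlyFreeExponents.

Section NearlyFreeSummary.
Variables (K : numClosedFieldType).
Local Notation S := {mpoly K[3]}.
Variables (d r : nat) (f : S).
Hypotheses (d_gt0 : (0 < d)%N) (f_homog : f \is d.-homog) (f_neq0 : f != 0).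
Hypothesis f_reduced : reduced_equation f.
Hypothesis f_mdr : is_mdr f r.
Variable rho1 : 'rV[S]_3.
Hypotheses (rho1_AR : AR f r rho1) (rho1_neq0 : rho1 != 0).
Implicit Types (a b m rho : 'rV[S]_3) (w h : S).

Local Notation v := (v_ f rho1).
Local Notation B := (B_ f rho1).

Let rho1_syz : syz f rho1. Proof. by case: rho1_AR. Qed.

Hypothesis r_gt0 : (0 < r)%N.

(** The last clause yields the independence of [rho1]: when [r < d2], only the generator [e 0] has
    degree [r]. *)
Lemma nearly_free_exp_point d1 d2 : nearly_free_exp f d1 d2 ->
  [/\ d1 = r, (d2 + r = d)%N, exists2 p, proj_points p & B = point_ideal p &
    (r < d2)%N -> exists e0, forall rho, AR f r rho -> exists c, rho = c%:MP *: e0].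
Proof.
move=> [e [g [l2 [l3 [[h0 h1 h2 d12] eg em [hl2 hl3 hi] rel]]]]].
have he i : AR f (if i == 0 then d1 else d2) (e i) by case: (ord3P i) => ->.
pose mu (i : 'I_3) := tnth [tuple g; l2; l3] i.
have hr : \sum_i mu i *: e i = 0 by rewrite sum3.
have [dd pt] := @nearly_free_point _ _ _ _ d_gt0 f_homog f_neq0 f_reduced f_mdr _ rho1_AR rho1_neq0
  r_gt0 d1 d2 e mu he d12 eg em hl2 hl3 hi hr.
have d1r := minimal_degree f_mdr rho1_AR rho1_neq0 he d12 eg em.
split=> // rd2; exists (e 0) => rho hrho.
have [c -> hc] := rho1_const_comb f_mdr hrho (deg := fun i => if i == 0 then d1 else d2) he eg.
exists (c 0); have ci i : i != 0 -> c i = 0.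
  move=> i0; apply/eqP/negPn/negP => /hc; rewrite (negPf i0) => e2.
  by rewrite e2 ltnn in rd2.
by rewrite sum3 (ci 1) // (ci 2%:R) // mpolyC0 !scale0r !addr0.
Qed.

End NearlyFreeSummary.

Theorem theorem5p1 (R : realType) (d r : nat) (f : {mpoly R[i][3]})
  (hd : (0 < d)%N) (hfd : f \is d.-homog) (hf0 : f != 0)
  (hred : reduced_equation f) (hr : is_mdr f r) (hr1 : (1 <= r)%N)
  (rho1 : 'rV[{mpoly R[i][3]}]_3) (hrho1 : AR f r rho1) (hrho1_0 : rho1 != 0) :
  let B := B_ f rho1 in
  let Z := V_ B in
  (forall rho, syz f rho -> Delta rho1 rho = v_ f rho1 rho * f) /\
  homogeneous_ideal B /\
  graded_short_exact
    (gshift (@S_ R[i]) (- r%:Z) : grading {mpoly R[i][3]}^o) (AR f)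
    (gshift (graded_part B) (r%:Z - d%:Z + 1) : grading {mpoly R[i][3]}^o)
    (u_ rho1) (v_ f rho1) /\
  [/\ saturated B, scheme_dim_le Z 0,
      (scheme_degree Z)%:Z =
        (d%:Z - 1) ^+ 2 - r%:Z * (d%:Z - r%:Z - 1) - (tjurina f)%:Z
    & (scheme_degree Z)%:Z = tau_max d r - (tjurina f)%:Z] /\
  (ideal_lci 2 B /\ scheme_lci 2 Z) /\
  (is_dim (fun (c : R[i]) rho => c%:MP *: rho) (AR f r) [set 0] 1 ->
     forall rho1', AR f r rho1' -> rho1' != 0 ->
       B_ f rho1' = B /\ V_ (B_ f rho1') = Z) /\
  (free_curve f <-> B = setT) /\
  (nearly_free f <-> exists2 p, proj_points p & Z = reduced_point p) /\
  (forall d1 d2, nearly_free_exp f d1 d2 ->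
     ((2 * r < d)%N <-> [/\ r = d1, (d1 < d2)%N & d2 = (d - r)%N])) /\
  (nearly_free f -> (2 * r < d)%N ->
     forall rho1', AR f r rho1' -> rho1' != 0 ->
       same_sequence f rho1 rho1' /\
       forall p, proj_points p ->
         Z = reduced_point p -> V_ (B_ f rho1') = reduced_point p).
Proof.
move=> B Z.
have vs := v_spec hd hfd hf0 hred hrho1.
have hB := B_homogeneous hd hfd hf0 hred hrho1.
have ex := bourbaki_exact hd hfd hf0 hred hr hrho1 hrho1_0.
have sB := B_saturated hd hfd hf0 hred hr hrho1 hrho1_0.
have dim0 := eliminable_dim0 (B_eliminable hd hfd hf0 hred hr hrho1 hrho1_0).
have deg := degree_formula hd hfd hf0 hred hr hrho1 hrho1_0.
have nf d1 d2 := @nearly_free_exp_point _ _ _ _ hd hfd hf0 hred hr _ hrho1 hrho1_0 hr1 d1 d2.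
have same e0 := @line_same_sequence _ _ _ _ hd hfd hf0 hred _ hrho1 hrho1_0 e0.
split; [exact: vs|split; [exact: hB|split; [exact: ex|split; [split|split; [split|split; [|split; [|split; [|split]]]]]]]].
- exact: sB.
- exact: dim0.
- by rewrite deg /tau_max [d%:Z - 1 - r%:Z]addrAC.
- exact: deg.
- exact: (B_lci hd hfd hf0 hred hr hrho1 hrho1_0).
- exact: (Z_lci hd hfd hf0 hred hr hrho1 hrho1_0).
- move=> /AR_dim1_line[e0 he0] rho1' h' n'.
  by have [-> _] := same e0 he0 _ h' n'.
- split=> [fr|BT].
    have B1 := B1_of_free hd hfd hf0 hred hr hrho1 hrho1_0 fr.
    apply/seteqP; split=> // g _; have [[_ _ BM] _] := hB.
    by rewrite -[g]mulr1; apply: BM.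
  by apply: (free_of_B1 hd hfd hf0 hred hr hrho1 hrho1_0); rewrite -/B BT.
- split=> [[d1 [d2 /nf[_ _ [p pp Bp] _]]]|[p pp Zp]].
    by exists p => //; rewrite /Z /B Bp.
  exact: (nearly_free_of_point hd hfd hf0 hred hr hrho1 hrho1_0 pp Zp).
- move=> d1 d2 /nf[-> <- _ _]; split=> [h|[_ h1 h2]].
    by split=> //; lia.
  by lia.
- move=> [d1 [d2 /nf[_ dd _ line]]] rd rho1' h' n'.
  (* With [d2 + r = d], the inequality [2 * r < d] becomes [r < d2]. *)
  have [e0 he0] : exists e0, forall rho, AR f r rho -> exists c, rho = c%:MP *: e0 by apply: line; lia.
  have sm := same e0 he0 _ h' n'; split; first exact: sm.
  by move=> p pp <-; rewrite (proj1 sm).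
Qed.
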